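(* There is an absolute constant $b_0>0$ such that the following holds. Let $\lambda>0$ and $0\le\Lambda<\infty$. Then there are finite positive constants $b_1,\dots,b_8$ such that the following statements hold for all finite connected transitive graphs $\mathbb G$ (with $V$ vertices of degree $\Omega$), provided the triangle condition $\nabla_{p_c}(x,y)\le\delta_{x,y}+a_0$ (for all $x,y\in\mathbb V$) holds at $p_c=p_c(\mathbb G,\lambda)$ for some constant $a_0\le b_0$, and $\lambda V^{1/3}\ge b_0^{-1}$. Let $p=p_c+\Omega^{-1}\epsilon\in[0,1]$ with $|\epsilon|\le\Lambda V^{-1/3}$. (i) If $1\le k\le b_1V^{2/3}$, then $$\frac{b_2}{\sqrt k}\le P_{\ge k}(p)\le\frac{b_3}{\sqrt k}.$$ (ii) $$b_4V^{2/3}\le\mathbb E_p\big[|\mathcal C_{\max}|\big]\le b_5V^{2/3},$$ and, if $\omega\ge1$, then $$\mathbb P_p\Big(\omega^{-1}V^{2/3}\le|\mathcal C_{\max}|\le\omega V^{2/3}\Big)\ge1-\frac{b_6}{\omega}.$$ (iii) $$b_7V^{1/3}\le\chi(p)\le b_8V^{1/3}.$$ The constants $b_2$ and $b_3$ can be chosen independent of $\lambda$ and $\Lambda$, the constants $b_5$ and $b_8$ depend on $\Lambda$ and not on $\lambda$, and the constants $b_1,b_4,b_6,b_7$ depend on both $\lambda$ and $\Lambda$.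
   Context: $\mathbb G=(\mathbb V,\mathbb B)$ is a finite connected graph with vertex set $\mathbb V$ and bond (edge) set $\mathbb B$. It is transitive: for all $x,y\in\mathbb V$ there is a graph automorphism mapping $x$ to $y$. $V=|\mathbb V|$, and $\Omega$ is the common degree of the vertices. In percolation with parameter $p\in[0,1]$ each bond is independently occupied with probability $p$ and vacant otherwise; $\mathbb P_p,\mathbb E_p$ denote probability and expectation. $x\leftrightarrow y$ means there is a path of occupied bonds from $x$ to $y$ (and $x\leftrightarrow x$ always); $\tau_p(x,y)=\mathbb P_p(x\leftrightarrow y)$; $C(x)$ is the set of vertices connected to $x$; $0\in\mathbb V$ is a fixed vertex; $P_{\ge k}(p)=\mathbb P_p(|C(0)|\ge k)$; $\chi(p)=\mathbb E_p|C(0)|$, a strictly increasing function of $p$ with $\chi(0)=1$, $\chi(1)=V$; $|\mathcal C_{\max}|=\max\{|C(x)|:x\in\mathbb V\}$. The triangle diagram is $\nabla_p(x,y)=\sum_{u,v\in\mathbb V}\tau_p(x,u)\tau_p(u,v)\tau_p(v,y)$. For $\lambda>0$, the critical threshold $p_c=p_c(\mathbb G,\lambda)$ is the unique solution of $\chi(p_c)=\lambda V^{1/3}$; it is always assumed that $1<\lambda V^{1/3}<V$, so that $p_c$ is well defined and $0<p_c<1$. *)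

(* Defs.v *)
From HB Require Import structures.
From mathcomp Require Import all_boot all_order all_algebra all_fingroup.
From mathcomp Require Import reals exp.

Set Implicit Arguments.
Unset Strict Implicit.
Unset Printing Implicit Defensive.

Import Order.TTheory GRing.Theory Num.Theory.
Local Open Scope ring_scope.

Record sgraph := SGraph {
  vertex :> finType;
  adj : rel vertex;
  adj_sym : symmetric adj;
  adj_irrefl : irreflexive adj }.

Definition bonds (G : sgraph) : {set {set G}} :=
  [set [set xy.1; xy.2] | xy : G * G & adj xy.1 xy.2].

Definition degree (G : sgraph) (x : G) : nat := #|[set y | adj x y]|.

Definition graph_connected (G : sgraph) : Prop :=
  forall x y : G, connect (@adj G) x y.

Definition automorphism (G : sgraph) (s : {perm G}) : Prop :=
  forall x y : G, adj (s x) (s y) = adj x y.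

Definition vertex_transitive (G : sgraph) : Prop :=
  forall x y : G, exists2 s : {perm G}, automorphism s & s x = y.

(* A configuration is identified with its set of occupied bonds; only subsets
   of [bonds G] are given weight in [percP] and [percE] below. *)
Definition config (G : sgraph) := {set {set G}}.

Definition connected_in (G : sgraph) (S : config G) (x y : G) : bool :=
  connect [rel u v : G | [set u; v] \in S] x y.

Definition cluster (G : sgraph) (S : config G) (x : G) : {set G} :=
  [set y | connected_in S x y].

Definition max_cluster_size (G : sgraph) (S : config G) : nat :=
  \max_(x : G) #|cluster S x|.

Definition perc_weight (R : realType) (G : sgraph) (p : R) (S : config G) : R :=
  \prod_(b in bonds G) (if b \in S then p else 1 - p).

Definition percP (R : realType) (G : sgraph) (p : R) (A : pred (config G)) : R :=
  \sum_(S in powerset (bonds G) | A S) perc_weight p S.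

Definition percE (R : realType) (G : sgraph) (p : R) (X : config G -> R) : R :=
  \sum_(S in powerset (bonds G)) perc_weight p S * X S.

Definition tau (R : realType) (G : sgraph) (p : R) (x y : G) : R :=
  percP p (fun S => connected_in S x y).

Definition P_ge (R : realType) (G : sgraph) (o : G) (k : nat) (p : R) : R :=
  percP p (fun S => k <= #|cluster S o|)%N.

Definition chi (R : realType) (G : sgraph) (o : G) (p : R) : R :=
  percE p (fun S => #|cluster S o|%:R).

Definition triangle (R : realType) (G : sgraph) (p : R) (x y : G) : R :=
  \sum_(u : G) \sum_(v : G) tau p x u * tau p u v * tau p v y.

(* For lambda > 0 with 1 < lambda V^(1/3) < V there is exactly one such pc,
   as chi is a strictly increasing polynomial in p with chi 0 = 1, chi 1 = V. *)
Definition critical_threshold (R : realType) (G : sgraph) (o : G)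
    (lambda pc : R) : Prop :=
  0 <= pc <= 1 /\ chi o pc = lambda * #|G|%:R `^ (1 / 3).

Definition triangle_condition (R : realType) (G : sgraph) (p a0 : R) : Prop :=
  forall x y : G, triangle p x y <= (x == y)%:R + a0.

(* Main.v *)
From HB Require Import structures.
From mathcomp Require Import all_boot all_order all_algebra all_fingroup.
From mathcomp Require Import reals exp topology normedtype sequences derive realfun.
From mathcomp Require Import ring lra.
(* last, so that [cluster] is the percolation cluster and not that of a filter *)
Require Import Defs.

Set Implicit Arguments.
Unset Strict Implicit.
Unset Printing Implicit Defensive.

Import Order.TTheory GRing.Theory Num.Theory.
Import numFieldNormedType.Exports.
Local Open Scope ring_scope.

(** The three conclusions describe mean-field percolation, and all of them follow from
    two facts: throughout the window, the magnetization [mag o p g], which is the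
    probability that the cluster of [o] is hit by an independent random set of density
    [1 - g], is at most of order [s] at density [s ^ 2]; and [chi] is of order
    [V ^ (1 / 3)].

    Near independence.  An occupied bond connects its ends, so the triangle condition
    makes [pc] at most [1 / 1000].  Below [p = 1/2] the van den Berg--Kesten inequality
    [BK] has a short proof by induction on the bonds, and it gives the tree-graph upper
    bounds.  Lower bounds come from exploring clusters one after the other: a new
    branch avoids what has been seen up to an error which is a sum of triangles
    ([explore_step]), so that two or three branches are nearly independent.

    The magnetization at [pc].  The union bound [mag <= s ^ 2 * chi] suffices unless
    [chi] at [pc] exceeds [1 / (18 * s)].  Otherwise choose [p < pc] at which [chi]
    equals this value.  There the union bound can be improved by a fixed factor
    ([mag_deficit]), because the second moment of the cluster is at least a multiple of
    [chi ^ 3] ([second_moment_lower]): a vertex with exactly three open neighbours and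
    three disjoint branches yields triples of connected vertices, and no triple has two
    branch points.  Russo's formula gives the Aizenman--Barsky inequality
    [mag_derive_le], a partial differential inequality for the magnetization in [p] and
    [g]; along its characteristics the bound at [p] passes to [pc] with a smaller
    density ([mag_characteristic]).  The mean-field inequalities for [chi] place [p] at
    distance about [1 / (Omega * chi)] from [pc], so that the loss of density nearly
    exhausts the density at [p], and the factor gained in [mag_deficit] is what leaves
    some of it ([mag_critical]).

    The window.  Over a window of width of order [V ^ (-1/3) / Omega] a characteristic
    changes a density of order [V ^ (-2/3)] by a constant factor only ([mag_window]).
    This gives the upper tail bound ([P_ge_upper]).  For the lower one, [p] is lowered
    to the point where [chi] is a large multiple of [sqrt k]; clusters smaller than [k]
    contribute at most half of [chi] by the bound on the magnetization, and the second
    moment turns the other half into a tail ([P_ge_lower]).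

    The susceptibility.  The lower bound integrates the derivative of [1 / chi].  Above
    [pc] the same inequality may explode within the window, as [Lambda] is arbitrary.
    Instead, the expected number of pairs of vertices in hit clusters obeys a linear
    differential inequality ([hit_pairs_derive_le]), since only bonds between a hit and
    an unhit cluster matter to it and unhit clusters are controlled by the
    magnetization; Gronwall's inequality then bounds [chi] ([chi_upper]).

    The largest cluster.  Its second moment is at most [V * chi], and the second-moment
    method for the number of vertices in clusters of size at least [k], with the lower
    tail bound, shows that it is rarely small ([small_max_cluster]). *)

(** * Independent bits on a list *)

Section Bernoulli.
Variables (R : realType) (T : finType).
Implicit Types (p : R) (l : seq T) (S A B : {set T}) (phi psi : {set T} -> R).

(** Averaging over the bits of a list one after the other: the recursion makes
    independence, Russo's formula and the BK inequality plain inductions. *)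
Fixpoint bern p l phi : R :=
  if l is b :: l' then
    (1 - p) * bern p l' phi + p * bern p l' (fun S => phi (b |: S))
  else phi set0.

Lemma bern_eq p l phi psi :
  (forall S, {subset S <= l} -> phi S = psi S) -> bern p l phi = bern p l psi.
Proof.
elim: l phi psi => [|b l IH] phi psi eq_phi /=.
  by apply: eq_phi => x; rewrite inE.
congr (_ * _ + _ * _); apply: IH => S sS; apply: eq_phi => x.
  by rewrite inE => /sS ->; rewrite orbT.
by rewrite !inE => /orP[-> //|/sS ->]; rewrite orbT.
Qed.

Lemma bern_ext p l phi psi : phi =1 psi -> bern p l phi = bern p l psi.
Proof. by move=> e; apply: bern_eq => S _; rewrite e. Qed.

Lemma bernD p l phi psi :
  bern p l (fun S => phi S + psi S) = bern p l phi + bern p l psi.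
Proof. by elim: l phi psi => [|b l IH] phi psi //=; rewrite !IH; ring. Qed.

Lemma bernZ p l c phi : bern p l (fun S => c * phi S) = c * bern p l phi.
Proof. by elim: l phi => [|b l IH] phi //=; rewrite !IH; ring. Qed.

Lemma bernB p l phi psi :
  bern p l (fun S => phi S - psi S) = bern p l phi - bern p l psi.
Proof. by elim: l phi psi => [|b l IH] phi psi //=; rewrite !IH; ring. Qed.

Lemma bern_le p l phi psi : 0 <= p <= 1 ->
  (forall S, phi S <= psi S) -> bern p l phi <= bern p l psi.
Proof.
move=> /andP[p0 p1]; elim: l phi psi => [|b l IH] phi psi le_phi //=.
by rewrite lerD // ler_wpM2l ?subr_ge0 ?IH.
Qed.

Lemma bern_indep p l A B phi psi : [disjoint A & B] ->
  (forall S, phi S = phi (S :&: A)) -> (forall S, psi S = psi (S :&: B)) ->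
  bern p l (fun S => phi S * psi S) = bern p l phi * bern p l psi.
Proof.
move=> dAB; elim: l phi psi => [|b l IH] phi psi phiA psiB //=.
have loc (C : {set T}) (f : {set T} -> R) : (forall S, f S = f (S :&: C)) ->
    forall S, f (b |: S) = f (b |: (S :&: C)).
  by move=> fC S; rewrite fC [RHS]fC setIUl [in RHS]setIUl -setIA setIid.
have loc0 (C : {set T}) (f : {set T} -> R) : b \notin C -> (forall S, f S = f (S :&: C)) ->
    forall S, f (b |: S) = f S.
  move=> bC fC S; rewrite fC [RHS]fC setIUl; congr f.
  have -> : [set b] :&: C = set0.
    by apply/eqP; rewrite setI_eq0 disjoints1.
  by rewrite set0U.
have [bA|bA] := boolP (b \in A).
  have bB : b \notin B by apply/negP => bB; move/pred0P/(_ b): dAB; rewrite /= bA bB.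
  rewrite (bern_ext _ _ (loc0 _ _ bB psiB)).
  rewrite (@bern_ext _ _ (fun S => phi (b |: S) * psi (b |: S))
     (fun S => phi (b |: S) * psi S)); last by move=> S; rewrite (loc0 _ _ bB psiB).
  rewrite IH // (IH (fun S => phi (b |: S))) //; first ring.
  by move=> S; rewrite (loc _ _ phiA).
rewrite (bern_ext _ _ (loc0 _ _ bA phiA)).
rewrite (@bern_ext _ _ (fun S => phi (b |: S) * psi (b |: S))
   (fun S => phi S * psi (b |: S))); last by move=> S; rewrite (loc0 _ _ bA phiA).
rewrite IH // (IH _ (fun S => psi (b |: S))) //; first ring.
by move=> S; rewrite (loc _ _ psiB).
Qed.

Lemma bern_prod p l (w : T -> bool -> R) : uniq l ->
  bern p l (fun S => \prod_(b <- l) w b (b \in S))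
  = \prod_(b <- l) (p * w b true + (1 - p) * w b false).
Proof.
elim: l => [|b l IH] /=; first by rewrite !big_nil.
case/andP => bl ul; rewrite big_cons -IH //.
have -> : bern p l (fun S => \prod_(b0 <- b :: l) w b0 (b0 \in S)) =
          w b false * bern p l (fun S => \prod_(b0 <- l) w b0 (b0 \in S)).
  rewrite -bernZ; apply: bern_eq => S sS; rewrite big_cons.
  by rewrite (negbTE (contra (sS b) bl)).
have -> : bern p l (fun S => \prod_(b0 <- b :: l) w b0 (b0 \in b |: S)) =
          w b true * bern p l (fun S => \prod_(b0 <- l) w b0 (b0 \in S)).
  rewrite -bernZ; apply: bern_ext => S; rewrite big_cons !inE eqxx /=.
  congr (_ * _); apply: eq_big_seq => c cl; rewrite !inE.
  by case: eqVneq cl bl => // -> ->.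
by ring.
Qed.

Lemma bernE p l phi : uniq l ->
  \sum_(S in powerset [set b in l])
     (\prod_(b <- l) (if b \in S then p else 1 - p)) * phi S = bern p l phi.
Proof.
elim: l phi => [|b l IH] phi /=.
  have -> : [set b in [::]] = set0 :> {set T} by apply/setP => x; rewrite !inE.
  by rewrite powerset0 big_set1 big_nil mul1r.
case/andP => bl ul; rewrite set_cons (bigID (fun S : {set T} => b \in S)) /= addrC.
have bS S : {subset S <= l} -> b \notin S by move=> sS; exact: contra (sS b) bl.
congr (_ + _).
  rewrite -IH // mulr_sumr; apply: eq_big => S.
    rewrite !powersetE; apply/andP/subsetP => [[/subsetP sS nb] x xS|sS].
      by have := sS x xS; rewrite !inE; case: eqVneq => // xb; rewrite -xb xS in nb.
    split; last by apply: bS => x /sS; rewrite inE.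
    by apply/subsetP => x /sS; rewrite !inE => ->; rewrite orbT.
  by case/andP => _ nb; rewrite big_cons (negbTE nb) mulrA.
rewrite -IH // mulr_sumr.
rewrite (reindex_onto (fun S => b |: S) (fun S => S :\ b)) /=; last first.
  by move=> S /andP[_ bSS]; rewrite setD1K.
apply: eq_big => S.
  rewrite !powersetE setU11 andbT; apply/andP/subsetP => [[/subsetP sS /eqP eS] x xS|sS].
    have : x \in b |: S by rewrite inE xS orbT.
    move/sS; rewrite !inE; case: eqVneq => // xb.
    by move: xS; rewrite -eS xb !inE eqxx.
  split; last first.
    by apply/eqP; rewrite setU1K // bS // => x /sS; rewrite inE.
  by apply/subsetP => x; rewrite !inE => /orP[-> //|/sS]; rewrite inE => ->; rewrite orbT.
move=> _; rewrite big_cons !inE eqxx /= -!mulrA; congr (_ * (_ * _)).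
apply: eq_big_seq => c cl; rewrite !inE.
by case: eqVneq cl bl => // -> ->.
Qed.

End Bernoulli.

(** * Disjoint occurrence *)

Section DisjointOccurrence.
Variables (R : realType) (T : finType).
Implicit Types (p : R) (l : seq T) (S : {set T}) (A B : pred {set T}).

Definition increasing A := forall S S' : {set T}, S \subset S' -> A S -> A S'.

Definition disj_occ A B : pred {set T} := fun S =>
  [exists I : {set T}, [exists J : {set T},
    [&& I \subset S, J \subset S, [disjoint I & J], A I & B J]]].

Lemma disj_occP A B S :
  reflect (exists I J : {set T},
     [/\ I \subset S, J \subset S, [disjoint I & J], A I & B J]) (disj_occ A B S).
Proof.
apply: (iffP existsP) => [[I /existsP[J /and5P[*]]]|[I [J [*]]]].
  by exists I, J.
by exists I; apply/existsP; exists J; apply/and5P.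
Qed.

Lemma disj_occ_incr A B : increasing (disj_occ A B).
Proof.
move=> S S' sS /disj_occP[I [J [sI sJ d a b]]]; apply/disj_occP; exists I, J.
by split=> //; apply: subset_trans sS.
Qed.

(** The van den Berg--Kesten inequality for [p <= 1/2].  Conditioning on one bit,
    disjoint occurrence with that bit on is the union of two events, according
    to which of the two witnesses uses it, and both contain disjoint occurrence
    with the bit off.  Inclusion-exclusion bounds the union, and [p <= 1/2] makes
    the coefficient [1 - 2 p] of the smaller event nonnegative. *)
Lemma BK p l A B : 0 <= p <= 2^-1 -> increasing A -> increasing B ->
  bern p l (fun S => (disj_occ A B S)%:R)
  <= bern p l (fun S => (A S)%:R) * bern p l (fun S => (B S)%:R).
Proof.
move=> /andP[p0 p2]; have p01 : 0 <= p <= 1 by apply/andP; split=> //; lra.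
elim: l A B => [|b l IH] A B incA incB /=.
  rewrite -natrM mulnb ler_nat; case: disj_occP => // -[I [J [sI sJ _ aI bJ]]].
  by rewrite (incA _ _ sI aI) (incB _ _ sJ bJ).
pose A1 S := A (b |: S); pose B1 S := B (b |: S).
have incr1 C : increasing C -> increasing (fun S => C (b |: S)).
  by move=> incC S S' sS; apply: incC; apply: setUS.
have incA1 : increasing A1 by exact: incr1.
have incB1 : increasing B1 by exact: incr1.
have sub1 S : disj_occ A B S -> disj_occ A1 B S.
  case/disj_occP => I [J [sI sJ d a b']]; apply/disj_occP; exists I, J; split=> //.
  exact: incA (subsetUr _ _) a.
have sub2 S : disj_occ A B S -> disj_occ A B1 S.
  case/disj_occP => I [J [sI sJ d a b']]; apply/disj_occP; exists I, J; split=> //.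
  exact: incB (subsetUr _ _) b'.
have split1 S : disj_occ A B (b |: S) -> disj_occ A1 B S || disj_occ A B1 S.
  have drop (I : {set T}) : I \subset b |: S -> b \notin I -> I \subset S.
    move=> /subsetP sI bI; apply/subsetP => x xI; move: (sI x xI).
    by rewrite !inE => /orP[/eqP xb|//]; rewrite -xb xI in bI.
  case/disj_occP => I [J [sI sJ d a b']]; have [bI|bI] := boolP (b \in I).
    have bJ : b \notin J by apply/negP => bJ; move/pred0P/(_ b): d; rewrite /= bI bJ.
    apply/orP; left; apply/disj_occP; exists (I :\ b), J; split=> //.
    - by rewrite subDset.
    - exact: drop.
    - by apply: disjointWl d; apply: subD1set.
    - by rewrite /A1 setD1K.
  apply/orP; right; apply/disj_occP; exists I, (J :\ b); split=> //.
  - exact: drop.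
  - by rewrite subDset.
  - by apply: disjointWr d; apply: subD1set.
  - by apply: incB b'; rewrite -subDset.
set a0 := bern p l (fun S => (A S)%:R); set b0 := bern p l (fun S => (B S)%:R).
set a1 := bern p l (fun S => (A (b |: S))%:R).
set b1 := bern p l (fun S => (B (b |: S))%:R).
set d0 := bern p l (fun S => (disj_occ A B S)%:R).
set d1 := bern p l (fun S => (disj_occ A B (b |: S))%:R).
have d1_le : d1 + d0 <= bern p l (fun S => (disj_occ A1 B S)%:R)
                        + bern p l (fun S => (disj_occ A B1 S)%:R).
  rewrite -!bernD; apply: bern_le => // S; rewrite -!natrD ler_nat.
  move: (@sub1 S) (@sub2 S) (@split1 S).
  case: (disj_occ A B S) => [/(_ isT) -> /(_ isT) ->|_ _].
    by case: (disj_occ A B _).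
  by case: (disj_occ A B _) => // /(_ isT); do 2!case: disj_occ.
have i0 : d0 <= a0 * b0 by exact: IH.
have i1 : bern p l (fun S => (disj_occ A1 B S)%:R) <= a1 * b0 by exact: IH.
have i2 : bern p l (fun S => (disj_occ A B1 S)%:R) <= a0 * b1 by exact: IH.
have a01 : a0 <= a1.
  apply: bern_le => // U; rewrite ler_nat.
  by have := incA _ _ (subsetUr [set b] U); case: (A U) => // ->.
have b01 : b0 <= b1.
  apply: bern_le => // U; rewrite ler_nat.
  by have := incB _ _ (subsetUr [set b] U); case: (B U) => // ->.
have h1 : p * d1 <= p * (a1 * b0 + a0 * b1 - d0).
  apply: ler_wpM2l => //; rewrite lerBrDr (le_trans d1_le) //; exact: lerD.
have h2 : (1 - p - p) * d0 <= (1 - p - p) * (a0 * b0) by apply: ler_wpM2l => //; lra.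
have h3 : 0 <= p * p * ((a1 - a0) * (b1 - b0)).
  by rewrite !mulr_ge0 // subr_ge0.
move: h1 h2 h3; rewrite !(mulrDl, mulrDr, mulrBl, mulrBr, mulNr, mulrN); lra.
Qed.

End DisjointOccurrence.

(** * Connections in a configuration *)

Section Connections.
Variable G : sgraph.
Implicit Types (S : config G) (A B D : {set G}) (u v w x y z : G).

Lemma conn_refl S x : connected_in S x x. Proof. exact: connect0. Qed.

Lemma conn1 S x y : [set x; y] \in S -> connected_in S x y.
Proof. by move=> b; apply: connect1. Qed.

Lemma conn_trans S x y z :
  connected_in S x y -> connected_in S y z -> connected_in S x z.
Proof. exact: connect_trans. Qed.

Lemma conn_symE S x y : connected_in S x y = connected_in S y x.
Proof. by apply: sym_connect_sym => u v; rewrite /= setUC. Qed.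

Lemma mem_cluster S x y : (y \in cluster S x) = connected_in S x y.
Proof. by rewrite inE. Qed.

Lemma cluster_refl S x : x \in cluster S x.
Proof. by rewrite mem_cluster conn_refl. Qed.

Lemma cluster_eq S x y : connected_in S x y -> cluster S x = cluster S y.
Proof.
move=> cxy; apply/setP => z; rewrite !mem_cluster; apply/idP/idP.
  by apply: conn_trans; rewrite conn_symE.
exact: conn_trans.
Qed.

(** A walk stays in [S'] as soon as [S'] keeps every bond of [S] that leaves a
    vertex reached from the start. *)
Lemma conn_sub S S' x y :
  (forall u v, connected_in S x u -> [set u; v] \in S -> [set u; v] \in S') ->
  connected_in S x y -> connected_in S' x y.
Proof.
move=> sub /connectP[p]; elim/last_ind: p y => [|p z IH] y; first by move=> _ -> ; exact: conn_refl.
rewrite rcons_path last_rcons => /andP[pp e] ->.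
have c1 : connected_in S x (last x p) by apply/connectP; exists p.
exact: conn_trans (IH _ pp erefl) (conn1 (sub _ _ c1 e)).
Qed.

Lemma conn_closed S x y D :
  (forall u v, [set u; v] \in S -> u \in D -> v \in D) -> x \in D ->
  connected_in S x y -> y \in D.
Proof.
move=> cl xD /connectP[p]; elim: p x xD => [|z p IH] x xD /=; first by move=> _ ->.
by move=> /andP[e pp]; apply: IH => //; apply: cl e xD.
Qed.

Lemma conn_mono x y : increasing (fun S => connected_in S x y).
Proof. by move=> S S' /subsetP sS; apply: conn_sub => u v _; exact: sS. Qed.

Lemma cluster_mono S S' x : S \subset S' -> cluster S x \subset cluster S' x.
Proof. by move=> sS; apply/subsetP => y; rewrite !mem_cluster; apply: conn_mono. Qed.

(** [off S A] is what remains of [S] once the bonds at [A] have been revealed. *)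
Definition off S A : config G := [set b in S | [disjoint b & A]].
Definition touching S A : config G := [set b in S | ~~ [disjoint b & A]].

Lemma off_sub S A : off S A \subset S.
Proof. by apply/subsetP => b; rewrite inE => /andP[]. Qed.

Lemma off0 S : off S set0 = S.
Proof.
by apply/setP => b; rewrite inE -setI_eq0 setI0 eqxx andbT.
Qed.

Lemma off_off S A B : off (off S A) B = off S (A :|: B).
Proof.
apply/setP => b; rewrite !inE -andbA; congr (_ && _).
by rewrite -!setI_eq0 setIUr setU_eq0.
Qed.

Lemma disjoint_pair u v A : [disjoint [set u; v] & A] = (u \notin A) && (v \notin A).
Proof.
by rewrite -setI_eq0 setIUl setU_eq0 !setI_eq0 !disjoints1.
Qed.

(** What makes exploration work: no bond away from [B] is needed to decide that
    [B] is the cluster of [w]. *)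
Lemma cluster_touching S w B :
  (cluster S w == B) = (cluster (touching S B) w == B).
Proof.
have tS : touching S B \subset S by apply/subsetP => b; rewrite inE => /andP[].
apply/eqP/eqP => [<-|eB].
  apply/eqP; rewrite eqEsubset cluster_mono //=; last first.
    by apply/subsetP => b; rewrite inE => /andP[].
  apply/subsetP => y; rewrite !mem_cluster; apply: conn_sub => u v cu uv.
  by rewrite inE uv disjoint_pair mem_cluster cu.
apply/eqP; rewrite eqEsubset -{2}eB cluster_mono // andbT.
have wB : w \in B by rewrite -eB cluster_refl.
apply/subsetP => y; rewrite mem_cluster; apply: conn_closed => // u v uv uB.
have : connected_in (touching S B) w u by rewrite -mem_cluster eB.
move=> cu; rewrite -eB mem_cluster; apply: conn_trans cu _; apply: conn1.
by rewrite inE uv disjoint_pair uB.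
Qed.

Lemma cluster_off S u v : ~~ connected_in S u v ->
  cluster (off S (cluster S u)) v = cluster S v.
Proof.
move=> nuv; apply/eqP; rewrite eqEsubset cluster_mono ?off_sub //=.
apply/subsetP => y; rewrite !mem_cluster; apply: conn_sub => w t cw wt.
rewrite inE wt disjoint_pair !mem_cluster /=.
have cvt := conn_trans cw (conn1 wt).
by apply/andP; split; apply: contra nuv => /conn_trans; apply; rewrite conn_symE.
Qed.

Lemma off_notin S A w y : w \notin A -> connected_in (off S A) w y -> y \notin A.
Proof.
move=> wA c; rewrite -in_setC; apply: conn_closed c; last by rewrite inE.
by move=> u v; rewrite !inE disjoint_pair => /and3P[].
Qed.

Lemma set2_eq u v x y :
  [set x; y] = [set u; v] -> (x = u /\ y = v) \/ (x = v /\ y = u).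
Proof.
move=> e; have : x \in [set u; v] by rewrite -e set21.
have : y \in [set u; v] by rewrite -e set22.
have : u \in [set x; y] by rewrite e set21.
have : v \in [set x; y] by rewrite e set22.
rewrite !inE => /orP[]/eqP h1 /orP[]/eqP h2 /orP[]/eqP h3 /orP[]/eqP h4;
  (left; split; congruence) || (right; split; congruence).
Qed.

Lemma cluster_add_in S u v x :
  x \in cluster S u :|: cluster S v ->
  cluster ([set u; v] |: S) x = cluster S u :|: cluster S v.
Proof.
move=> xD; apply/eqP; rewrite eqEsubset; apply/andP; split.
  apply/subsetP => y; rewrite mem_cluster; apply: conn_closed => // a b.
  rewrite !inE => /orP[/eqP/set2_eq|ab].
    by case=> -[_ ->]; rewrite conn_refl ?orbT.
  by case/orP => /conn_trans /(_ (conn1 ab)) ->; rewrite ?orbT.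
have uv : connected_in ([set u; v] |: S) u v by apply: conn1; rewrite !inE eqxx.
have up := subsetUr [set [set u; v]] S.
have toU z : z \in cluster S u :|: cluster S v -> connected_in ([set u; v] |: S) u z.
  rewrite !inE => /orP[]; first by apply: conn_mono.
  by move=> /(conn_mono up); apply: conn_trans.
apply/subsetP => y /toU cy; rewrite mem_cluster; apply: conn_trans cy.
by rewrite conn_symE; apply: toU.
Qed.

Lemma cluster_add_out S u v x :
  x \notin cluster S u :|: cluster S v ->
  cluster ([set u; v] |: S) x = cluster S x.
Proof.
rewrite !inE negb_or => /andP[nu nv]; apply/eqP; rewrite eqEsubset.
rewrite (cluster_mono _ (subsetUr _ _)) andbT; apply/subsetP => y.
rewrite !mem_cluster; apply: conn_sub => a b; set S' := _ |: S.
have cl c : connected_in S' x c -> c \in cluster S x.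
  apply: conn_closed; last exact: cluster_refl.
  move=> a' b'; rewrite !inE => /orP[/eqP/set2_eq|ab]; last first.
    by move=> /conn_trans; apply; apply: conn1.
  by case=> -[-> _]; rewrite conn_symE ?(negbTE nu) ?(negbTE nv).
move=> /cl; rewrite mem_cluster !inE => ca /orP[/eqP/set2_eq|//].
by case=> -[ea _]; move: nu nv; rewrite !(conn_symE _ _ x) -ea ca.
Qed.

Lemma cluster_add_same S u v x : connected_in S u v ->
  cluster ([set u; v] |: S) x = cluster S x.
Proof.
move=> uv; have [xD|] := boolP (x \in cluster S u :|: cluster S v); last first.
  exact: cluster_add_out.
rewrite cluster_add_in //; move: xD; rewrite -(cluster_eq uv) setUid mem_cluster.
exact: cluster_eq.
Qed.

(** Two connections that meet in one vertex only use disjoint sets of bonds;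
    singletons are discarded since they would be shared. *)
Definition within S D : config G := [set b in S | (b \subset D) && (1 < #|b|)%N].

Lemma within_sub S D : within S D \subset S.
Proof. by apply/subsetP => b; rewrite inE => /andP[]. Qed.

Lemma conn_within S D x p :
  path [rel u v : G | [set u; v] \in S] x p -> uniq (x :: p) ->
  {subset x :: p <= D} -> connected_in (within S D) x (last x p).
Proof.
elim: p x => [|y p IH] x; first by rewrite /= conn_refl.
move=> /= /andP[xy pp] /and3P[xp yp up] sD.
apply: (@conn_trans _ _ y); last first.
  apply: IH => //=; first by rewrite yp.
  by move=> z zp; apply: sD; rewrite inE zp orbT.
apply: conn1; rewrite inE xy cards2 /=; apply/andP; split.
  by apply/subsetP => z; rewrite !inE => /orP[]/eqP ->; apply: sD; rewrite !inE eqxx ?orbT.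
by move: xp; rewrite inE negb_or => /andP[-> _].
Qed.

Lemma conn_path S x y : connected_in S x y ->
  exists p, [/\ path [rel u v : G | [set u; v] \in S] x p, uniq (x :: p) & y = last x p].
Proof.
by move=> /connectP[p pp ->]; have [p' pp' up' _] := shortenP pp; exists p'.
Qed.

Lemma within_disjoint S D D' z : D :&: D' \subset [set z] ->
  [disjoint within S D & within S D'].
Proof.
move=> sz; rewrite -setI_eq0; apply/eqP/setP => b; rewrite !inE.
apply/negP => /andP[/and3P[_ bD b1] /and3P[_ bD' _]].
have : b \subset [set z] by apply: subset_trans sz; rewrite subsetI bD bD'.
by move=> /subset_leq_card; rewrite cards1 leqNgt b1.
Qed.

Lemma uniq_split_meet x p1 p2 : uniq (x :: p1 ++ p2) ->
  [set y in x :: p1] :&: [set y in last x p1 :: p2] \subset [set last x p1].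
Proof.
rewrite -cat_cons cat_uniq => /and3P[_ /hasPn h _].
apply/subsetP => y; rewrite !inE => /andP[y1 /orP[//|/h]].
by rewrite /= inE y1.
Qed.

(** A self-avoiding path from [w] to [y] must visit [A]; cut there, it gives the
    two disjoint witnesses. *)
Lemma through_disj_occ S A w y :
  connected_in S w y -> ~~ connected_in (off S A) w y ->
  exists2 a, a \in A & disj_occ (fun S => connected_in S w a)
                                (fun S => connected_in S a y) S.
Proof.
move=> /conn_path[p [pp up ->]] nc.
have [/hasP[a ap aA]|/hasPn nA] := boolP (has (mem A) (w :: p)); last first.
  case/negP: nc; apply: (conn_mono (S := within S (~: A))); last first.
    by apply: conn_within => // z /nA zA; rewrite in_setC.
  apply/subsetP => b; rewrite !inE => /and3P[-> bA _] /=.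
  by rewrite -(setCK A) disjoints_subset setCK.
exists a => //.
case/splitPl: ap pp up nc => p1 p2 <-; rewrite cat_path last_cat => /andP[pp1 pp2] up _.
apply/disj_occP; exists (within S [set y in w :: p1]).
exists (within S [set y in last w p1 :: p2]); split; rewrite ?within_sub //.
- exact: within_disjoint (uniq_split_meet up).
- apply: conn_within => //; last by move=> z; rewrite !inE.
  by move: up; rewrite -cat_cons cat_uniq => /andP[].
apply: conn_within => //; last by move=> z; rewrite !inE.
move: up; rewrite -cat_cons cat_uniq => /and3P[_ /hasPn h up2] /=.
by rewrite up2 andbT; apply/negP => /h /=; rewrite mem_last.
Qed.

(** The branch vertex [z] is where a path from [w] first meets a path from [u] to [x]. *)
Lemma tree_disj_occ S u x w :
  connected_in S u x -> connected_in S u w ->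
  exists z, disj_occ (disj_occ (fun S => connected_in S u z) (fun S => connected_in S z x))
                     (fun S => connected_in S z w) S.
Proof.
move=> /conn_path[p [pp up ->]]; rewrite conn_symE => /connectP[q pq uq].
pose P := [set y in u :: p].
have [z zP cwz] : exists2 z, z \in P &
    connected_in [set b in S | ~~ (b \subset P)] w z.
  have: last w q \in P by rewrite -uq !inE eqxx.
  elim: q w pq {uq} => [|y q IH] w /=; first by exists w => //; exact: conn_refl.
  move=> /andP[wy pq] lP.
  have [wP|wP] := boolP (w \in P); first by exists w => //; exact: conn_refl.
  have [z zP cz] := IH _ pq lP; exists z => //; apply: conn_trans cz.
  apply: conn1; rewrite inE wy /=; apply: contra wP => /subsetP; apply.
  by rewrite set21.
exists z; rewrite /P inE in zP.
case/splitPl: zP pp up @P cwz => p1 p2 <-.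
rewrite cat_path last_cat => /andP[pp1 pp2] up P cwz.
apply/disj_occP; exists (within S P), [set b in S | ~~ (b \subset P)]; split.
- exact: within_sub.
- by apply/subsetP => b; rewrite inE => /andP[].
- rewrite -setI_eq0; apply/eqP/setP => b; rewrite !inE.
  by case: (b \subset P); rewrite ?andbF.
- have sub D : D \subset P -> within S D \subset within S P.
    move=> sD; apply/subsetP => b; rewrite !inE => /and3P[-> /subset_trans -> //].
  apply/disj_occP; exists (within S [set y in u :: p1]).
  exists (within S [set y in last u p1 :: p2]); split.
  + by apply: sub; apply/subsetP => y; rewrite !inE mem_cat orbA => ->.
  + apply: sub; apply/subsetP => y; rewrite /P !in_set -cat_cons mem_cat inE.
    by move=> /orP[/eqP ->|->]; rewrite ?mem_last ?orbT.
  + exact: within_disjoint (uniq_split_meet up).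
  + apply: conn_within => //; last by move=> y; rewrite !inE.
    by move: up; rewrite -cat_cons cat_uniq => /andP[].
  apply: conn_within => //; last by move=> y; rewrite !inE.
  move: up; rewrite -cat_cons cat_uniq => /and3P[_ /hasPn h up2] /=.
  by rewrite up2 andbT; apply/negP => /h /=; rewrite mem_last.
- by rewrite conn_symE.
Qed.

(** Every path from [y] to [v] visits [v'], and its part up to there has not yet
    met [v]. *)
Lemma conn_off_first S v v' y : v != v' -> y != v' ->
  connected_in S y v -> ~~ connected_in (off S [set v']) y v ->
  connected_in (off S [set v]) y v'.
Proof.
move=> vv' yv' /conn_path[p [pp up ev]] nc; rewrite {}ev in vv' nc *.
have [ap|nap] := boolP (v' \in y :: p); last first.
  case/negP: nc; apply: (conn_mono (S := within S [set z in y :: p])); last first.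
    by apply: conn_within => // z; rewrite !inE.
  apply/subsetP => b; rewrite !inE => /and3P[-> /subsetP bA _] /=.
  by rewrite disjoint_sym disjoints1; apply: contra nap => /bA; rewrite inE.
case/splitPl: ap pp up nc vv' => p1 p2 e; rewrite cat_path last_cat.
move=> /andP[pp1 pp2] up _ vv'; rewrite -e.
apply: (conn_mono (S := within S [set z in y :: p1])); last first.
  apply: conn_within => //; last by move=> z; rewrite !inE.
  by move: up; rewrite -cat_cons cat_uniq => /andP[].
apply/subsetP => b; rewrite !inE => /and3P[-> /subsetP bA _] /=.
rewrite disjoint_sym disjoints1; apply/negP => /bA; rewrite inE.
move: up; rewrite -cat_cons cat_uniq => /and3P[_ /hasPn h _].
case: p2 vv' pp2 h => [|a p2] /=; first by rewrite e eqxx.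
by move=> _ _ /(_ (last a p2)); rewrite mem_last => /(_ isT) /= /negbTE ->.
Qed.

Definition move_config (s : {perm G}) S : config G := [set s @: (b : {set G}) | b in S].

Lemma move_pair (s : {perm G}) u v S :
  ([set s u; s v] \in move_config s S) = ([set u; v] \in S).
Proof.
have -> : [set s u; s v] = s @: [set u; v] by rewrite imsetU1 imset_set1.
by rewrite mem_imset //; apply: imset_inj; apply: perm_inj.
Qed.

Lemma conn_move (s : {perm G}) S x y :
  connected_in (move_config s S) (s x) (s y) = connected_in S x y.
Proof.
have fwd (t : {perm G}) S1 S2 x' y' :
    (forall u v, ([set t u; t v] \in S2) = ([set u; v] \in S1)) ->
    connected_in S1 x' y' -> connected_in S2 (t x') (t y').
  move=> tS /connectP[p]; elim: p x' => [|z p IH] x' /=; first by move=> _ ->; exact: conn_refl.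
  move=> /andP[e pp] ey; apply: conn_trans (IH _ pp ey).
  by apply: conn1; rewrite tS.
apply/idP/idP; last by apply: fwd => u v; rewrite move_pair.
move=> /(fwd s^-1%g _ S); rewrite !permK; apply=> u v.
by rewrite -(move_pair s) !permKV.
Qed.

Lemma cluster_move (s : {perm G}) S x :
  cluster (move_config s S) (s x) = s @: cluster S x.
Proof.
apply/setP => y; rewrite mem_cluster -(permKV s y) conn_move.
by rewrite mem_imset ?mem_cluster //; apply: perm_inj.
Qed.

End Connections.

(** * Russo's formula *)

Section Russo.
Variables (R : realType) (T : finType).
Implicit Types (p : R) (l : seq T) (S : {set T}) (phi : {set T} -> R).

(** The derivative in [p], in the shape the recursion gives it. *)
Fixpoint dbern p l phi : R :=
  if l is b :: l' then
    - bern p l' phi + (1 - p) * dbern p l' phi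
    + (bern p l' (fun S => phi (b |: S)) + p * dbern p l' (fun S => phi (b |: S)))
  else 0.

Lemma is_derive_bern (q : R -> R) (phi : R -> {set T} -> R) (t dq : R) dphi l :
  is_derive t 1 q dq -> (forall S, is_derive t 1 (phi^~ S) (dphi S)) ->
  is_derive t 1 (fun s => bern (q s) l (phi s))
    (dq * dbern (q t) l (phi t) + bern (q t) l dphi).
Proof.
move=> dq1; elim: l phi dphi => [|b l IH] phi dphi dphi1 /=.
  by apply: is_derive_eq (dphi1 _) _; rewrite mulr0 add0r.
have D1 : is_derive t 1 (fun s : R => 1 - q s) (- dq).
  have := is_deriveB (is_derive_cst (1 : R) t 1) dq1.
  by rewrite sub0r.
have D2 := is_deriveM D1 (IH _ _ dphi1).
have D3 := is_deriveM dq1 (IH (fun s S => phi s (b |: S)) (fun S => dphi (b |: S))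
             (fun S => dphi1 (b |: S))).
apply: is_derive_eq (is_deriveD D2 D3) _.
by rewrite /GRing.scale /=; ring.
Qed.

(** Russo's formula, in the form that adds a bit instead of comparing the two
    values of the bit: the factor [1 - p] is the probability that it is off. *)
Lemma russo p l phi :
  (1 - p) * dbern p l phi = \sum_(b <- l) bern p l (fun S => phi (b |: S) - phi S).
Proof.
elim: l phi => [|b l IH] phi /=; first by rewrite big_nil mulr0.
rewrite big_cons big_split /= -!mulr_sumr -(IH phi).
have -> : \sum_(b0 <- l) bern p l (fun S => phi (b0 |: (b |: S)) - phi (b |: S))
  = (1 - p) * dbern p l (fun S => phi (b |: S)).
  rewrite IH; apply: eq_bigr => c _; apply: bern_ext => S.
  by rewrite setUCA.
have -> : bern p l (fun S => phi (b |: (b |: S)) - phi (b |: S)) = 0.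
  rewrite (@bern_ext _ _ _ _ _ (fun S => 0 * phi S)) ?bernZ ?mul0r // => S.
  by rewrite setUA setUid subrr mul0r.
by rewrite bernB; ring.
Qed.

Lemma bern_mono p q l phi : 0 <= p -> p <= q -> q <= 1 ->
  (forall S S', S \subset S' -> phi S <= phi S') -> bern p l phi <= bern q l phi.
Proof.
move=> p0 pq q1; elim: l phi => [|b l IH] phi mphi //=.
have h1 := IH phi mphi.
have h2 : bern p l (fun S => phi (b |: S)) <= bern q l (fun S => phi (b |: S)).
  by apply: IH => S S' sS; apply/mphi/setUS.
have h3 : bern p l phi <= bern p l (fun S => phi (b |: S)).
  apply: bern_le => [|S]; first by rewrite p0 (le_trans pq).
  exact/mphi/subsetUr.
apply: (@le_trans _ _ ((1 - q) * bern p l phi + q * bern p l (fun S => phi (b |: S)))).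
  rewrite -subr_ge0; have -> : (1 - q) * bern p l phi
    + q * bern p l (fun S => phi (b |: S)) - ((1 - p) * bern p l phi
    + p * bern p l (fun S => phi (b |: S)))
    = (q - p) * (bern p l (fun S => phi (b |: S)) - bern p l phi) by ring.
  by rewrite mulr_ge0 // subr_ge0.
by rewrite lerD // ler_wpM2l ?subr_ge0 // (le_trans p0).
Qed.

End Russo.

(** * Percolation expectations *)

Section Expectation.
Variables (R : realType) (G : sgraph).
Implicit Types (p : R) (S : config G) (X Y : config G -> R) (A B : {set G}).

Lemma percEE p X : percE p X = bern p (enum (bonds G)) X.
Proof.
rewrite -bernE ?enum_uniq // /percE /perc_weight.
have -> : [set b in enum (bonds G)] = bonds G by apply/setP => b; rewrite inE mem_enum.
by apply: eq_bigr => S _; rewrite -big_enum.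
Qed.

Lemma percE_eq p X Y : (forall S, S \subset bonds G -> X S = Y S) ->
  percE p X = percE p Y.
Proof. by move=> e; apply: eq_bigr => S; rewrite powersetE => /e ->. Qed.

Lemma percED p X Y : percE p (fun S => X S + Y S) = percE p X + percE p Y.
Proof. by rewrite !percEE bernD. Qed.

Lemma percEB p X Y : percE p (fun S => X S - Y S) = percE p X - percE p Y.
Proof. by rewrite !percEE bernB. Qed.

Lemma percEZ p c X : percE p (fun S => c * X S) = c * percE p X.
Proof. by rewrite !percEE bernZ. Qed.

Lemma percEZr p c X : percE p (fun S => X S * c) = percE p X * c.
Proof. by rewrite mulrC -percEZ; apply: percE_eq => S _; rewrite mulrC. Qed.

Lemma percE_cst p c : @percE R G p (fun=> c) = c.
Proof. by rewrite percEE; elim: (enum _) => //= b l ->; ring. Qed.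

Lemma percE_sum p (I : Type) (r : seq I) (P : pred I) (F : I -> config G -> R) :
  percE p (fun S => \sum_(i <- r | P i) F i S) = \sum_(i <- r | P i) percE p (F i).
Proof.
rewrite /percE exchange_big /=; apply: eq_bigr => S _.
by rewrite mulr_sumr.
Qed.

Lemma percPE p (A : pred (config G)) : percP p A = percE p (fun S => (A S)%:R).
Proof.
rewrite /percP /percE big_mkcondr; apply: eq_bigr => S _.
by case: (A S); rewrite ?mulr1 ?mulr0.
Qed.

Lemma percE_indep p (D D' : {set {set G}}) X Y : [disjoint D & D'] ->
  (forall S, X S = X (S :&: D)) -> (forall S, Y S = Y (S :&: D')) ->
  percE p (fun S => X S * Y S) = percE p X * percE p Y.
Proof. by move=> *; rewrite !percEE; apply: (@bern_indep _ _ _ _ D D'). Qed.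

Section Nonneg.
Variable p : R.
Hypothesis p01 : 0 <= p <= 1.

Lemma perc_weight_ge0 S : 0 <= perc_weight p S.
Proof. by case/andP: p01 => *; apply: prodr_ge0 => b _; case: ifP; rewrite ?subr_ge0. Qed.

Lemma percE_le X Y : (forall S, S \subset bonds G -> X S <= Y S) ->
  percE p X <= percE p Y.
Proof.
move=> h; apply: ler_sum => S; rewrite powersetE => /h.
exact/ler_wpM2l/perc_weight_ge0.
Qed.

Lemma percE_ge0 X : (forall S, 0 <= X S) -> 0 <= percE p X.
Proof. by move=> h; rewrite -[leLHS](percE_cst p); apply: percE_le => S _. Qed.

Definition monotone X := forall S S', S \subset S' -> X S <= X S'.

Lemma percE_off_le X A : monotone X -> percE p (fun S => X (off S A)) <= percE p X.
Proof. by move=> mX; apply: percE_le => S _; apply/mX/off_sub. Qed.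

(** Exploring the cluster of [w] outside [A] reveals only bonds that touch it, so
    the rest of the configuration is still fresh. *)
Lemma exploration A w (H : {set G} -> config G -> R) :
  percE p (fun S => H (cluster (off S A) w) (off S (A :|: cluster (off S A) w)))
  = \sum_(B : {set G}) percE p (fun S => (cluster (off S A) w == B)%:R)
                     * percE p (fun S => H B (off S (A :|: B))).
Proof.
transitivity (\sum_(B : {set G}) percE p (fun S => (cluster (off S A) w == B)%:R
                     * H B (off S (A :|: B)))).
  rewrite -percE_sum; apply: percE_eq => S _.
  rewrite (bigD1 (cluster (off S A) w)) //= eqxx mul1r big1 ?addr0 // => B.
  by rewrite eq_sym => /negbTE ->; rewrite mul0r.
apply: eq_bigr => B _.
pose D := [set b : {set G} | ~~ [disjoint b & B]].
pose D' := [set b : {set G} | [disjoint b & A :|: B]].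
apply: (@percE_indep _ D D').
- rewrite -setI_eq0; apply/eqP/setP => b; rewrite !inE.
  apply/negP => /andP[/negP h]; rewrite -setI_eq0 setIUr setU_eq0 => /andP[_].
  by rewrite setI_eq0.
- move=> S; rewrite cluster_touching [in RHS]cluster_touching.
  congr ((cluster _ w == B)%:R); apply/setP => b; rewrite !inE.
  by case: (b \in S) => //=; case: [disjoint b & B]; rewrite ?andbF ?andbT.
move=> S; congr (H B _); apply/setP => b; rewrite !inE.
by case: (b \in S) => //=; case: [disjoint b & A :|: B].
Qed.

Lemma explore_le A w (H : {set G} -> config G -> R) (K : {set G} -> R) :
  (forall B, percE p (fun S => H B (off S (A :|: B))) <= K B) ->
  percE p (fun S => H (cluster (off S A) w) (off S (A :|: cluster (off S A) w)))
  <= percE p (fun S => K (cluster (off S A) w)).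
Proof.
move=> h; have := exploration A w (fun B _ => K B) => /= ->; rewrite exploration.
apply: ler_sum => B _; rewrite percE_cst; apply: ler_wpM2l => //.
exact: percE_ge0.
Qed.

Lemma explore_ge A w (H : {set G} -> config G -> R) (K : {set G} -> R) :
  (forall B, K B <= percE p (fun S => H B (off S (A :|: B)))) ->
  percE p (fun S => K (cluster (off S A) w)) <=
  percE p (fun S => H (cluster (off S A) w) (off S (A :|: cluster (off S A) w))).
Proof.
move=> h; have := exploration A w (fun B _ => K B) => /= ->; rewrite exploration.
apply: ler_sum => B _; rewrite percE_cst; apply: ler_wpM2l => //.
exact: percE_ge0.
Qed.

End Nonneg.

Lemma percE_mono_p p q X : 0 <= p -> p <= q -> q <= 1 -> monotone X ->
  percE p X <= percE q X.
Proof. by move=> *; rewrite !percEE; apply: bern_mono. Qed.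

Definition dpercE p X : R := dbern p (enum (bonds G)) X.

Lemma is_derive_percE (q : R -> R) (X : R -> config G -> R) (t dq : R) dX :
  is_derive t 1 q dq -> (forall S, is_derive t 1 (X^~ S) (dX S)) ->
  is_derive t 1 (fun s => percE (q s) (X s))
    (dq * dpercE (q t) (X t) + percE (q t) dX).
Proof.
move=> dq1 dX1; rewrite percEE.
have -> : (fun s => percE (q s) (X s)) = (fun s => bern (q s) (enum (bonds G)) (X s)).
  by apply/boolp.funext => s; rewrite percEE.
exact: is_derive_bern.
Qed.

(** A bond has two orientations. *)
Lemma sum_bonds (H : {set G} -> R) :
  \sum_(u : G) \sum_(v | adj u v) H [set u; v] = (\sum_(b in bonds G) H b) *+ 2.
Proof.
rewrite pair_big_dep /=.
rewrite (partition_big (fun xy : G * G => [set xy.1; xy.2]) (mem (bonds G))) /=; last first.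
  by move=> [x y] /= xy; apply/imsetP; exists (x, y); rewrite ?inE.
rewrite -sumrMnl; apply: eq_bigr => b /imsetP[[x y]]; rewrite inE /= => xy ->.
have nxy : (y, x) != (x, y).
  by apply/eqP => -[e _]; rewrite e adj_irrefl in xy.
rewrite (bigD1 (x, y)) /=; last by rewrite xy eqxx.
rewrite (bigD1 (y, x)) /=; last by rewrite adj_sym xy setUC eqxx nxy.
rewrite big1 ?addr0; first by rewrite [in X in _ + X]setUC mulr2n.
move=> [u v] /= /andP[/andP[/andP[_ /eqP/set2_eq e] n1] n2].
by case: e n1 n2 => -[-> ->]; rewrite ?eqxx.
Qed.

Lemma russo_percE p X :
  (1 - p) * dpercE p X
  = 2^-1 * \sum_(u : G) \sum_(v | adj u v)
             percE p (fun S => X ([set u; v] |: S) - X S).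
Proof.
rewrite (sum_bonds (fun b => percE p (fun S => X (b |: S) - X S))).
rewrite -[X in _ = _ * X]mulr_natl mulKf ?pnatr_eq0 // /dpercE russo big_enum.
by apply: eq_bigr => b _; rewrite percEE.
Qed.

(** ** Invariance under automorphisms *)

Lemma move_bonds (s : {perm G}) (b : {set G}) : automorphism s ->
  (s @: b \in bonds G) = (b \in bonds G).
Proof.
have fwd (t : {perm G}) (c : {set G}) : automorphism t ->
    c \in bonds G -> t @: c \in bonds G.
  move=> at_ /imsetP[[x y]]; rewrite inE /= => xy ->.
  rewrite imsetU1 imset_set1; apply/imsetP; exists (t x, t y) => //.
  by rewrite inE /= at_.
move=> as_; apply/idP/idP; last exact: fwd.
have as' : automorphism s^-1%g by move=> x y; rewrite -as_ !permKV.
move=> /(fwd _ _ as'); rewrite -imset_comp (eq_imset _ (g := id)) ?imset_id // => x.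
by rewrite /= permK.
Qed.

Lemma percE_move p (s : {perm G}) X : automorphism s ->
  percE p (fun S => X (move_config s S)) = percE p X.
Proof.
move=> as_; have inj_b : injective (fun b : {set G} => s @: b).
  by apply: imset_inj; apply: perm_inj.
have inj_S : injective (@move_config G s) by apply: imset_inj.
rewrite /percE [RHS](reindex_inj inj_S) /=; apply: eq_big => S.
  rewrite !powersetE; apply/subsetP/subsetP => sS b.
    by move=> /imsetP[c cS ->]; rewrite move_bonds // sS.
  by move=> bS; rewrite -(move_bonds _ as_) sS // mem_imset.
move=> _; congr (_ * _); rewrite /perc_weight [RHS](reindex_inj inj_b) /=.
by apply: eq_big => b; rewrite ?move_bonds // mem_imset.
Qed.

End Expectation.

(** * The two-point function on a transitive graph *)

Section TwoPoint.
Variables (R : realType) (G : sgraph).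
Implicit Types (p : R) (S : config G) (A B : {set G}) (u v w x y z : G).

Lemma tauE p x y : tau p x y = percE p (fun S => (connected_in S x y)%:R).
Proof. exact: percPE. Qed.

Lemma tau_sym p x y : tau p x y = tau p y x.
Proof. by rewrite !tauE; apply: percE_eq => S _; rewrite conn_symE. Qed.

Lemma tau_refl p x : tau p x x = 1.
Proof.
rewrite tauE -[RHS](@percE_cst R G p); apply: percE_eq => S _.
by rewrite conn_refl.
Qed.

Lemma tau_ge0 p x y : 0 <= p <= 1 -> 0 <= tau p x y.
Proof. by move=> p01; rewrite tauE percE_ge0. Qed.

Lemma card_clusterE S x :
  #|cluster S x|%:R = \sum_y (connected_in S x y)%:R :> R.
Proof.
rewrite -natr_sum -sum1_card big_mkcond /=; congr (_%:R).
by apply: eq_bigr => y _; rewrite mem_cluster; case: connected_in.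
Qed.

Lemma percE_card_cluster p x : percE p (fun S => #|cluster S x|%:R) = \sum_y tau p x y.
Proof.
under [RHS]eq_bigr do rewrite tauE.
by rewrite -percE_sum; apply: percE_eq => S _; rewrite card_clusterE.
Qed.

Lemma card_cluster_gt0 S x : (0 < #|cluster S x|)%N.
Proof. by apply/card_gt0P; exists x; apply: cluster_refl. Qed.

Lemma card_mono S S' x : S \subset S' -> (#|cluster S x| <= #|cluster S' x|)%N.
Proof. by move=> sS; apply/subset_leq_card/cluster_mono. Qed.

Lemma sum_mem (A : {set G}) (F : G -> R) : \sum_(a in A) F a = \sum_a (a \in A)%:R * F a.
Proof.
by rewrite big_mkcond; apply: eq_bigr => a _; case: (a \in A); rewrite ?mul1r ?mul0r.
Qed.

Lemma BK_percE p (P Q : pred (config G)) : 0 <= p <= 2^-1 ->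
  increasing P -> increasing Q ->
  percE p (fun S => (disj_occ P Q S)%:R)
  <= percE p (fun S => (P S)%:R) * percE p (fun S => (Q S)%:R).
Proof. by move=> *; rewrite !percEE; apply: BK. Qed.

Lemma half_le1 p : 0 <= p <= 2^-1 -> 0 <= p <= 1.
Proof. by move=> /andP[-> h] /=; lra. Qed.

(** The tree-graph inequality: BK, applied twice to the tree of [tree_disj_occ]. *)
Lemma tree_graph p u x w : 0 <= p <= 2^-1 ->
  percE p (fun S => (connected_in S u x)%:R * (connected_in S u w)%:R)
  <= \sum_z tau p u z * tau p z x * tau p z w.
Proof.
move=> p2; have p01 := half_le1 p2.
pose T z S := disj_occ (disj_occ (fun S => connected_in S u z) (fun S => connected_in S z x))
                     (fun S => connected_in S z w) S.
apply: (@le_trans _ _ (percE p (fun S => \sum_z (T z S)%:R))).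
  apply: percE_le => // S _; case cx: (connected_in S u x); last first.
    by rewrite mul0r sumr_ge0.
  case cw: (connected_in S u w); last by rewrite mulr0 sumr_ge0.
  have [z Tz] := tree_disj_occ cx cw.
  by rewrite (bigD1 z) //= /T Tz mulr1 lerDl sumr_ge0.
rewrite percE_sum; apply: ler_sum => z _; rewrite !tauE.
apply: (le_trans (BK_percE p2 (@disj_occ_incr _ _ _) (@conn_mono _ _ _))).
rewrite ler_wpM2r ?percE_ge0 //.
exact: BK_percE (@conn_mono _ _ _) (@conn_mono _ _ _).
Qed.

Lemma sum_tau_row p u : \sum_y tau p u y = \sum_y tau p y u.
Proof. by apply: eq_bigr => y _; rewrite tau_sym. Qed.

Lemma tau_le_triangle p x y : 0 <= p <= 1 -> tau p x y <= triangle p x y.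
Proof.
move=> p01; rewrite /triangle (bigD1 x) //= (bigD1 x) //= !tau_refl !mul1r -addrA lerDl.
rewrite addr_ge0 //; apply: sumr_ge0 => z _; rewrite ?sumr_ge0 // => *;
  by rewrite !mulr_ge0 ?tau_ge0.
Qed.

End TwoPoint.

Section Transitive.
Variables (R : realType) (G : sgraph) (o : G).
Hypothesis trG : vertex_transitive G.
Implicit Types (p : R) (S : config G) (A B : {set G}) (u v w x y z : G).

Lemma percE_vertex p (H : config G -> G -> R) x y :
  (forall (s : {perm G}) S z, H (move_config s S) (s z) = H S z) ->
  percE p (H^~ x) = percE p (H^~ y).
Proof.
move=> eqH; have [s as_ <-] := trG x y.
rewrite -(percE_move p (fun S => H S (s x)) as_).
by apply: percE_eq => S _; rewrite eqH.
Qed.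

Lemma card_cluster_move (s : {perm G}) S z :
  #|cluster (move_config s S) (s z)| = #|cluster S z|.
Proof. by rewrite cluster_move card_imset //; apply: perm_inj. Qed.

Lemma percE_card p (F : nat -> R) x :
  percE p (fun S => F #|cluster S x|) = percE p (fun S => F #|cluster S o|).
Proof.
apply: (percE_vertex p (H := fun S x => F #|cluster S x|)) => s S z.
by rewrite card_cluster_move.
Qed.

Lemma sum_tau p x : \sum_y tau p x y = chi o p.
Proof. by rewrite -percE_card_cluster (percE_card p (fun n => n%:R)). Qed.

Lemma sum_tau' p x : \sum_y tau p y x = chi o p.
Proof. by rewrite -sum_tau_row sum_tau. Qed.

Section SmallP.
Variable p : R.
Hypothesis p2 : 0 <= p <= 2^-1.
Let p01 : 0 <= p <= 1 := half_le1 p2.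
Notation X := (chi o p).
Notation tau := (tau p).

Lemma chi_ge1 : 1 <= X.
Proof.
rewrite -[leLHS](@percE_cst R G p); apply: percE_le => // S _.
by rewrite ler1n card_cluster_gt0.
Qed.

Lemma chi_ge0 : 0 <= X. Proof. exact: le_trans ler01 chi_ge1. Qed.

(** The vertices lost by removing the bonds at [A] are reached only through [A],
    and BK separates the way to [A] from the way on. *)
Lemma cluster_loss A w :
  percE p (fun S => #|cluster S w|%:R - #|cluster (off S A) w|%:R)
  <= X * \sum_(a in A) tau w a.
Proof.
pose T a y S := disj_occ (fun S => connected_in S w a) (fun S => connected_in S a y) S.
apply: (@le_trans _ _ (percE p (fun S => \sum_y \sum_(a in A) (T a y S)%:R))).
  apply: percE_le => // S _; rewrite !card_clusterE -sumrB; apply: ler_sum => y _.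
  have h0 : 0 <= \sum_(a in A) (T a y S)%:R :> R by apply: sumr_ge0.
  case c1: (connected_in S w y); last first.
    by rewrite (le_trans _ h0) // sub0r oppr_le0.
  case c2: (connected_in (off S A) w y); first by rewrite subrr.
  have [a aA Ta] := through_disj_occ c1 (negbT c2).
  by rewrite (bigD1 a) //= /T Ta subr0 lerDl sumr_ge0.
rewrite percE_sum.
apply: (@le_trans _ _ (\sum_y \sum_(a in A) tau w a * tau a y)).
  apply: ler_sum => y _; rewrite percE_sum; apply: ler_sum => a _; rewrite !tauE.
  exact: BK_percE (@conn_mono _ _ _) (@conn_mono _ _ _).
rewrite exchange_big /= mulr_sumr; apply: ler_sum => a _.
by rewrite -mulr_sumr sum_tau mulrC.
Qed.

(** Sum over one leaf of the tree-graph inequality. *)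
Lemma cluster_mem_le u w :
  percE p (fun S => #|cluster S u|%:R * (connected_in S u w)%:R)
  <= X * \sum_z tau u z * tau z w.
Proof.
apply: (@le_trans _ _ (\sum_x percE p (fun S => (connected_in S u x)%:R * (connected_in S u w)%:R))).
  rewrite -percE_sum; apply: percE_le => // S _.
  by rewrite card_clusterE mulr_suml.
apply: (@le_trans _ _ (\sum_x \sum_z tau u z * tau z x * tau z w)).
  by apply: ler_sum => x _; apply: tree_graph.
rewrite exchange_big /= mulr_sumr; apply: ler_sum => z _.
rewrite -mulr_suml -mulr_sumr sum_tau.
by rewrite mulrAC [X * _]mulrC.
Qed.

Lemma cluster_mem_triangle u w :
  percE p (fun S => #|cluster S u|%:R * \sum_(a in cluster S u) tau w a)
  <= X * triangle p u w.
Proof.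
apply: (@le_trans _ _ (\sum_a tau w a * percE p (fun S => #|cluster S u|%:R * (connected_in S u a)%:R))).
  under eq_bigr do rewrite -percEZ.
  rewrite -percE_sum; apply: percE_le => // S _; rewrite sum_mem mulr_sumr.
  apply: ler_sum => a _; rewrite mem_cluster.
  by rewrite mulrA [leRHS]mulrC.
apply: (@le_trans _ _ (\sum_a tau w a * (X * \sum_z tau u z * tau z a))).
  by apply: ler_sum => a _; rewrite ler_wpM2l ?tau_ge0 // cluster_mem_le.
rewrite /triangle exchange_big /= mulr_sumr; apply: ler_sum => a _.
by rewrite -mulr_suml mulrCA (tau_sym p w) [tau a w * _]mulrC.
Qed.

Lemma second_moment_le : percE p (fun S => #|cluster S o|%:R ^+ 2) <= X ^+ 3.
Proof.
apply: (@le_trans _ _ (\sum_w percE p (fun S => #|cluster S o|%:R * (connected_in S o w)%:R))).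
  rewrite -percE_sum; apply: percE_le => // S _.
  by rewrite -mulr_sumr -card_clusterE expr2.
apply: (@le_trans _ _ (\sum_w (X * \sum_z tau o z * tau z w))).
  by apply: ler_sum => w _; apply: cluster_mem_le.
rewrite -mulr_sumr exchange_big /=.
under eq_bigr do rewrite -mulr_sumr sum_tau.
by rewrite -mulr_suml sum_tau !exprS expr0 mulr1 mulrA.
Qed.

Lemma sum_triangle x : \sum_y triangle p x y = X ^+ 3.
Proof.
rewrite /triangle exchange_big /=.
under eq_bigr => u _.
  rewrite exchange_big /=.
  under eq_bigr do rewrite -mulr_sumr sum_tau.
  rewrite -mulr_suml -mulr_sumr sum_tau; over.
by rewrite -!mulr_suml sum_tau !exprS expr0 mulr1 mulrA.
Qed.

(** ** Lower bounds by successive explorations *)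

Section Explore.
(* used with the identity and with the killed size [kw g] *)
Variable h : nat -> R.
Hypothesis h_ge0 : forall n, 0 <= h n.
Hypothesis h_le : forall n, h n <= n%:R.
Hypothesis h_lip : forall m n, (m <= n)%N -> h n - h m <= n%:R - m%:R.

Let eta := percE p (fun S => h #|cluster S o|).
Let T A w := \sum_(a in A) tau w a.

Let T_ge0 A w : 0 <= T A w.
Proof. by apply: sumr_ge0 => a _; rewrite tau_ge0. Qed.

Let T_setU A B w : T (A :|: B) w <= T A w + T B w.
Proof.
rewrite /T !sum_mem -big_split /=; apply: ler_sum => a _; rewrite -mulrDl.
by rewrite ler_wpM2r ?tau_ge0 // -natrD ler_nat inE; do 2!case: (_ \in _).
Qed.

Let eta_le : eta <= X.
Proof. exact: percE_le. Qed.

Let eta_ge0 : 0 <= eta.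
Proof. exact: percE_ge0. Qed.

Definition branch A w S : R := (w \notin A)%:R * h #|cluster (off S A) w|.

Let branch_ge0 A w S : 0 <= branch A w S.
Proof. by rewrite mulr_ge0. Qed.

Let branch_le A w S : branch A w S <= #|cluster S w|%:R.
Proof.
apply: (@le_trans _ _ (h #|cluster (off S A) w|)).
  by rewrite -[leRHS]mul1r ler_wpM2r // lern1 leq_b1.
by rewrite (le_trans (h_le _)) // ler_nat card_mono // off_sub.
Qed.

Lemma branch_lower A w : eta - X * T A w <= percE p (branch A w).
Proof.
have [wA|wA] := boolP (w \in A).
  apply: (@le_trans _ _ 0); last exact: percE_ge0.
  rewrite subr_le0 (le_trans eta_le) // -[leLHS]mulr1 ler_wpM2l ?chi_ge0 //.
  by rewrite /T (bigD1 w) //= tau_refl lerDl sumr_ge0 // => a _; rewrite tau_ge0.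
rewrite lerBlDl -lerBlDr; apply: le_trans (cluster_loss A w).
rewrite /eta -(percE_card p h w) -percEB; apply: percE_le => // S _.
by rewrite /branch wA mul1r h_lip // card_mono // off_sub.
Qed.

(** One more exploration: a lower bound [m] for what remains to be explored from
    the vertices [ws], with an error linear in the two-point functions to the
    region already seen, gives a bound of the same shape for the product with a
    fresh branch at [u]; the new errors are triangles. *)
Lemma explore_step A u (ws : seq G) (m c k : R) (Y : {set G} -> config G -> R) :
  0 <= m -> 0 <= c -> 0 <= k ->
  (forall A', m - c - k * \sum_(w <- ws) T A' w <= percE p (fun S => Y A' (off S A'))) ->
  m * eta - X * (m * T A u + c + k * \sum_(w <- ws) (T A w + triangle p u w))
  <= percE p (fun S => branch A u S * Y (A :|: cluster (off S A) u)
                                        (off S (A :|: cluster (off S A) u))).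
Proof.
move=> m0 c0 k0 hY.
pose F (B : {set G}) := (u \notin A)%:R * h #|B|.
pose K B := F B * (m - c - k * \sum_(w <- ws) T (A :|: B) w).
have hK B : K B <= percE p (fun S => F B * Y (A :|: B) (off S (A :|: B))).
  by rewrite percEZ ler_wpM2l // mulr_ge0.
apply: le_trans (@explore_ge R G p p01 A u (fun B S => F B * Y (A :|: B) S) K hK).
pose L S := m * branch A u S - #|cluster S u|%:R * (c + k * \sum_(w <- ws) T A w)
   - k * \sum_(w <- ws) (#|cluster S u|%:R * T (cluster S u) w).
apply: (@le_trans _ _ (percE p L)); last first.
  apply: percE_le => // S _; rewrite /L /K /F -/(branch A u S).
  set b := branch A u S; set C := cluster (off S A) u.
  have b0 : 0 <= b by exact: branch_ge0.
  have hT w : T (A :|: C) w <= T A w + T (cluster S u) w.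
    apply: le_trans (T_setU _ _ _) _; rewrite lerD2l /T !sum_mem.
    apply: ler_sum => a _; rewrite ler_wpM2r ?tau_ge0 // ler_nat.
    by have := subsetP (cluster_mono u (off_sub S A)) a; rewrite -/C; case: (a \in C) => // ->.
  have h1 : b * (c + k * \sum_(w <- ws) T (A :|: C) w)
     <= #|cluster S u|%:R * (c + k * \sum_(w <- ws) (T A w + T (cluster S u) w)).
    apply: ler_pM => //.
      by rewrite addr_ge0 // mulr_ge0 // sumr_ge0.
    - exact: branch_le.
    - by rewrite lerD2l ler_wpM2l // ler_sum.
  by move: h1; rewrite big_split /= -mulr_sumr; lra.
have -> : percE p L = m * percE p (branch A u) - X * (c + k * \sum_(w <- ws) T A w)
   - k * \sum_(w <- ws) percE p (fun S => #|cluster S u|%:R * T (cluster S u) w).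
  rewrite -percE_sum -!percEZ /L 2!percEB; congr (_ - _ - _).
  by rewrite percEZr (percE_card p (fun n => n%:R) u).
have h1 : m * (eta - X * T A u) <= m * percE p (branch A u).
  by rewrite ler_wpM2l // branch_lower.
have h2 : k * (\sum_(w <- ws) percE p (fun S => #|cluster S u|%:R * T (cluster S u) w))
   <= k * \sum_(w <- ws) X * triangle p u w.
  by rewrite ler_wpM2l // ler_sum // => w _; apply: cluster_mem_triangle.
move: h1 h2; rewrite big_split /= -mulr_sumr; lra.
Qed.

Lemma two_branches A u v :
  eta ^+ 2 - X ^+ 2 * (T A u + T A v + triangle p u v)
  <= percE p (fun S => branch A u S * branch (A :|: cluster (off S A) u) v S).
Proof.
have hY A' : eta - 0 - X * \sum_(w <- [:: v]) T A' w
    <= percE p (fun S => (v \notin A')%:R * h #|cluster (off S A') v|).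
  by rewrite subr0 big_seq1; apply: branch_lower.
apply: le_trans (explore_step A u (Y := fun A' S' => (v \notin A')%:R * h #|cluster S' v|)
  eta_ge0 (lexx 0) chi_ge0 hY).
rewrite big_seq1 addr0 mulrDr opprD addrA expr2 -subr_ge0.
have : 0 <= (X - eta) * (X * T A u) by rewrite !mulr_ge0 ?subr_ge0 ?chi_ge0.
rewrite expr2; lra.
Qed.

Lemma three_branches A u v w :
  eta ^+ 3 - X ^+ 3 * (T A u + T A v + T A w
     + triangle p u v + triangle p u w + triangle p v w)
  <= percE p (fun S => branch A u S *
       (branch (A :|: cluster (off S A) u) v S *
        branch (A :|: cluster (off S A) u :|:
                cluster (off S (A :|: cluster (off S A) u)) v) w S)).
Proof.
pose Y (A' : {set G}) S' := (v \notin A')%:R * h #|cluster S' v| *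
  ((w \notin A' :|: cluster S' v)%:R * h #|cluster (off S' (cluster S' v)) w|).
have hY A' : eta ^+ 2 - X ^+ 2 * triangle p v w - X ^+ 2 * \sum_(z <- [:: v; w]) T A' z
    <= percE p (fun S => Y A' (off S A')).
  rewrite big_cons big_seq1 -addrA -opprD -mulrDr addrC [triangle p v w + _]addrC.
  rewrite addrC; apply: le_trans (two_branches A' v w) _.
  by apply: percE_le => // S _; rewrite /Y off_off /branch.
have X2 : 0 <= X ^+ 2 by rewrite exprn_ge0 ?chi_ge0.
have tr0 : 0 <= X ^+ 2 * triangle p v w.
  by rewrite mulr_ge0 // (le_trans _ (tau_le_triangle v w p01)) // tau_ge0.
have e2 : 0 <= eta ^+ 2 by rewrite exprn_ge0.
apply: le_trans (le_trans (explore_step A u e2 tr0 X2 hY) _); last first.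
  by apply: percE_le => // S _; rewrite /Y off_off /branch.
rewrite big_cons big_seq1 -subr_ge0.
have eX : eta ^+ 2 <= X ^+ 2 by rewrite lerXn2r ?nnegrE ?chi_ge0.
have : 0 <= (X ^+ 2 - eta ^+ 2) * (X * T A u) by rewrite !mulr_ge0 ?subr_ge0 ?chi_ge0.
rewrite !exprS expr0 mulr1; lra.
Qed.

End Explore.

(** The Aizenman--Newman lower bound: two neighbours have nearly independent
    clusters when the triangle between them is small. *)
Lemma two_clusters_lower u v :
  X ^+ 2 * (1 - triangle p u v)
  <= percE p (fun S => (~~ connected_in S u v)%:R
                        * (#|cluster S u|%:R * #|cluster S v|%:R)).
Proof.
have lip m n : (m <= n)%N -> n%:R - m%:R <= n%:R - m%:R :> R by [].
have := @two_branches (fun n => n%:R) (fun n => ler0n R n) (fun n => lexx n%:R) lip set0 u v.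
rewrite -/(chi o p) !big_set0 !add0r mulrBr mulr1 => /le_trans; apply.
apply: percE_le => // S _; rewrite /branch set0U off0 in_set0 mul1r mem_cluster.
case: (boolP (connected_in S u v)) => [_|/cluster_off ->]; first by rewrite !mul0r mulr0.
by rewrite !mul1r.
Qed.

End SmallP.

Section AnyP.
Variable p : R.
Hypothesis p01 : 0 <= p <= 1.

(** Once the cluster of [u] is explored, an increasing quantity sees fewer bonds
    than in a fresh configuration. *)
Lemma explore_mono_le u (F : {set G} -> R) (H : config G -> R) :
  (forall B, 0 <= F B) -> monotone H ->
  percE p (fun S => F (cluster S u) * H (off S (cluster S u)))
  <= percE p (fun S => F (cluster S u)) * percE p H.
Proof.
move=> F0 mH.
have h B : percE p (fun S => F B * H (off S (set0 :|: B))) <= F B * percE p H.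
  by rewrite percEZ ler_wpM2l // percE_off_le.
have le1 := @explore_le R G p p01 set0 u (fun B S => F B * H S) (fun B => F B * percE p H) h.
apply: (le_trans _ (le_trans le1 _)).
  by apply: percE_le => // S _; rewrite off0 set0U.
rewrite percEZr le_eqVlt; apply/orP; left; apply/eqP; congr (_ * _).
by apply: percE_eq => S _; rewrite off0.
Qed.

Lemma two_clusters_le u v (F f : nat -> R) :
  (forall n, 0 <= F n) -> (forall n, 0 <= f n) ->
  (forall m n, (m <= n)%N -> f m <= f n) ->
  percE p (fun S => (~~ connected_in S u v)%:R * (F #|cluster S u| * f #|cluster S v|))
  <= percE p (fun S => F #|cluster S o|) * percE p (fun S => f #|cluster S o|).
Proof.
move=> F0 f0 mf; rewrite -(percE_card p F u) -(percE_card p f v).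
apply: le_trans (explore_mono_le (H := fun S => f #|cluster S v|) u (F := fun B => F #|B|) _ _) => //.
  apply: percE_le => // S _; case: (boolP (connected_in S u v)) => [_|/cluster_off ->].
    by rewrite mul0r mulr_ge0.
  by rewrite mul1r.
by move=> S S' sS; apply/mf/card_mono.
Qed.

End AnyP.
End Transitive.

(** * Branch points *)

Section BranchPoint.
Variable G : sgraph.
Implicit Types (S : config G) (u v w x y z : G).

Definition open_nbrs S v : {set G} := [set w | [set v; w] \in S].

(** Exactly three open neighbours, in this order: then a triple of vertices
    determines the tripod that joins it. *)
Definition tripod S v w1 w2 w3 : bool :=
  let S' := off S [set v] in
  [&& open_nbrs S v == [set w1; w2; w3], w1 != v, w2 != v, w3 != v,
      ~~ connected_in S' w1 w2, ~~ connected_in S' w1 w3 & ~~ connected_in S' w2 w3].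

Definition tripod_at S x y z v w1 w2 w3 : bool :=
  let S' := off S [set v] in
  [&& tripod S v w1 w2 w3, connected_in S' w1 x, connected_in S' w2 y
    & connected_in S' w3 z].

Lemma tripod_atP S x y z v w1 w2 w3 : tripod_at S x y z v w1 w2 w3 ->
  let S' := off S [set v] in
  [/\ [/\ connected_in S x v, connected_in S y v & connected_in S z v],
      [/\ x != v, y != v & z != v] &
      [/\ ~~ connected_in S' x y, ~~ connected_in S' x z & ~~ connected_in S' y z]].
Proof.
case/and4P => /and5P[/eqP ow n1 n2 n3 /and3P[d12 d13 d23]] c1 c2 c3 /=.
have open w : w \in [set w1; w2; w3] -> connected_in S w v.
  by rewrite -ow inE => vw; rewrite conn_symE; apply: conn1.
have toS a b : connected_in (off S [set v]) a b -> connected_in S b a.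
  by rewrite conn_symE; apply: conn_mono; apply: off_sub.
have neq a b : a != v -> connected_in (off S [set v]) a b -> b != v.
  by move=> av /(off_notin (A := [set v])); rewrite !inE; apply.
have dis a b c d : connected_in (off S [set v]) a b -> connected_in (off S [set v]) c d ->
    ~~ connected_in (off S [set v]) a c -> ~~ connected_in (off S [set v]) b d.
  move=> ab cd; apply: contra => bd; apply: conn_trans ab (conn_trans bd _).
  by rewrite conn_symE.
split.
- by split; [have := toS _ _ c1 | have := toS _ _ c2 | have := toS _ _ c3];
     move/conn_trans; apply; apply: open; rewrite !inE eqxx ?orbT.
- by split; [apply: neq c1 | apply: neq c2 | apply: neq c3].
- by split; [apply: dis c1 c2 _ | apply: dis c1 c3 _ | apply: dis c2 c3 _].
Qed.

(** Deleting another vertex [v'] leaves two of the three legs at [v] intact, so [v']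
    does not separate the two vertices that they lead to. *)
Lemma tripod_center S x y z v w1 w2 w3 v' w1' w2' w3' :
  tripod_at S x y z v w1 w2 w3 -> tripod_at S x y z v' w1' w2' w3' -> v = v'.
Proof.
move=> /tripod_atP[[xv yv zv] _ [nxy nxz nyz]].
move=> /tripod_atP[_ [xv' yv' zv'] [nxy' nxz' nyz']].
apply/eqP; apply/negPn/negP => vv'.
have key a b : a != v' -> b != v' -> connected_in S a v -> connected_in S b v ->
    ~~ connected_in (off S [set v]) a b ->
    connected_in (off S [set v']) a v || connected_in (off S [set v']) b v.
  move=> av' bv' ca cb; apply: contraR; rewrite negb_or => /andP[na nb].
  apply: conn_trans (conn_off_first vv' av' ca na) _.
  by rewrite conn_symE; apply: conn_off_first vv' bv' cb nb.
have meet a b : connected_in (off S [set v']) a v -> connected_in (off S [set v']) b v ->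
    connected_in (off S [set v']) a b.
  by move=> ca; rewrite conn_symE => cb; apply: conn_trans ca _.
have := key x y xv' yv' xv yv nxy; have := key x z xv' zv' xv zv nxz.
have := key y z yv' zv' yv zv nyz.
case cx: (connected_in (off S [set v']) x v).
  move=> + _ _; case/orP => c; move: nxy' nxz'; rewrite (meet _ _ cx c) //.
by move=> /= _ cz cy; case/negP: nyz'; apply: meet.
Qed.

(** With the same centre, the legs are told apart by the vertices they lead to. *)
Lemma tripod_unique S x y z v w1 w2 w3 v' w1' w2' w3' :
  tripod_at S x y z v w1 w2 w3 -> tripod_at S x y z v' w1' w2' w3' ->
  (v, w1, w2, w3) = (v', w1', w2', w3').
Proof.
move=> t t'; have vv' := tripod_center t t'; rewrite -{v'}vv' in t' *.
case/and4P: t => /and5P[/eqP ow n1 n2 n3 /and3P[d12 d13 d23]] c1 c2 c3.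
case/and4P: t' => /and5P[/eqP ow' _ _ _ _] c1' c2' c3'.
have link a b c : connected_in (off S [set v]) a c -> connected_in (off S [set v]) b c ->
    connected_in (off S [set v]) a b.
  by move=> ac; rewrite conn_symE => cb; apply: conn_trans ac _.
have sub w : w \in [set w1'; w2'; w3'] -> [\/ w = w1, w = w2 | w = w3].
  rewrite -ow' ow !inE => /orP[/orP[]|] /eqP ->; [exact: Or31|exact: Or32|exact: Or33].
have e1 : w1' = w1.
  have := link _ _ _ c1 c1'; have : w1' \in [set w1'; w2'; w3'] by rewrite !inE eqxx.
  by move/sub => [->|->|->] // c; move: d12 d13; rewrite c.
have e2 : w2' = w2.
  have := link _ _ _ c2 c2'; have : w2' \in [set w1'; w2'; w3'] by rewrite !inE eqxx ?orbT.
  by move/sub => [->|->|->] // c; [rewrite conn_symE c in d12|rewrite c in d23].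
have e3 : w3' = w3.
  have := link _ _ _ c3 c3'; have : w3' \in [set w1'; w2'; w3'] by rewrite !inE eqxx ?orbT.
  by move/sub => [->|->|->] // c; move: d13 d23; rewrite !(conn_symE _ _ w3) c.
by rewrite e1 e2 e3.
Qed.

Lemma tripod_card S v w1 w2 w3 : tripod S v w1 w2 w3 ->
  let c w := #|cluster (off S [set v]) w| in
  (#|cluster S v| <= (c w1 + c w2 + c w3).+1)%N.
Proof.
case/and5P => /eqP ow _ _ _ _ /=; set S' := off S [set v].
pose D := v |: (cluster S' w1 :|: cluster S' w2 :|: cluster S' w3).
apply: (@leq_trans #|D|).
  apply/subset_leq_card/subsetP => y; rewrite mem_cluster; apply: conn_closed; last first.
    by rewrite !inE eqxx.
  move=> a b ab; have [->|bv] := eqVneq b v; first by rewrite !inE eqxx.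
  have [av|av] := eqVneq a v.
    have : b \in open_nbrs S v by rewrite inE -av.
    rewrite ow !inE => /orP[/orP[]|] /eqP -> _; by rewrite conn_refl ?orbT.
  have ab' : [set a; b] \in S'.
    by rewrite inE ab disjoint_pair !inE av bv.
  rewrite !inE (negbTE av) (negbTE bv) /= => /orP[/orP[]|] /conn_trans /(_ (conn1 ab')) ->;
    by rewrite ?orbT.
rewrite /D cardsU1 -add1n leq_add ?leq_b1 //.
apply: (leq_trans (leq_card_setU _ _)); rewrite leq_add2r.
exact: leq_card_setU.
Qed.

End BranchPoint.

Lemma sum_unique_le (R : realType) (I : finType) (P : pred I) (F : I -> R) (M : R) :
  0 <= M -> (forall i j, P i -> P j -> i = j) -> (forall i, P i -> F i <= M) ->
  \sum_(i | P i) F i <= M.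
Proof.
move=> M0 u hF; case: (pickP P) => [i Pi|nP]; last by rewrite big_pred0.
by rewrite (big_pred1 i) ?hF // => j; apply/idP/eqP => [Pj|->] //; apply: u.
Qed.

Section TripodMoment.
Variables (R : realType) (G : sgraph) (o : G) (Omega : nat).
Hypothesis trG : vertex_transitive G.
Hypothesis degG : forall x : G, degree x = Omega.
Variables (p g : R).
Hypothesis p2 : 0 <= p <= 2^-1.
Hypothesis g01 : 0 <= g <= 1.
Let p01 : 0 <= p <= 1 := half_le1 p2.
Let g0 : 0 <= g. Proof. by case/andP: g01. Qed.
Let g1 : g <= 1. Proof. by case/andP: g01. Qed.

(** The mean size of a cluster of [n] vertices, set to [0] when a random set of
    density [1 - g] hits it. *)
Definition kw (n : nat) : R := n%:R * g ^+ n.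

Lemma kw_ge0 n : 0 <= kw n.
Proof. by rewrite mulr_ge0 // exprn_ge0. Qed.

Lemma kw_le n : kw n <= n%:R.
Proof. by rewrite -[leRHS]mulr1 ler_wpM2l // exprn_ile1. Qed.

Lemma kw_lip m n : (m <= n)%N -> kw n - kw m <= n%:R - m%:R.
Proof.
move=> mn; rewrite /kw; have gg : g ^+ n <= g ^+ m by rewrite ler_wiXn2l.
have gm : g ^+ m <= 1 by rewrite exprn_ile1.
have hm : 0 <= (n%:R - m%:R) * (1 - g ^+ m).
  by rewrite mulr_ge0 ?subr_ge0 ?ler_nat.
have : n%:R * g ^+ n <= n%:R * g ^+ m by rewrite ler_wpM2l.
move: hm; lra.
Qed.

(** A triple of vertices has at most one tripod, so it is counted at most once. *)
Lemma tripod_count (S : config G) :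
  \sum_v \sum_w1 \sum_w2 \sum_w3 (tripod S v w1 w2 w3)%:R *
    (g * (kw #|cluster (off S [set v]) w1| * (kw #|cluster (off S [set v]) w2| *
          kw #|cluster (off S [set v]) w3|)))
  <= \sum_(x : G) #|cluster S x|%:R ^+ 2 * g ^+ #|cluster S x|.
Proof.
pose c v w := #|cluster (off S [set v]) w|.
pose F (i : G * G * G * G) : R :=
  g ^+ (c i.1.1.1 i.1.1.2 + c i.1.1.1 i.1.2 + c i.1.1.1 i.2).+1.
pose P x y z (i : G * G * G * G) := tripod_at S x y z i.1.1.1 i.1.1.2 i.1.2 i.2.
rewrite !pair_bigA /=.
apply: (@le_trans _ _ (\sum_x \sum_y \sum_z \sum_(i | P x y z i) F i)); last first.
  apply: ler_sum => x _.
  have -> : #|cluster S x|%:R ^+ 2 * g ^+ #|cluster S x| =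
      \sum_y \sum_z (connected_in S x y)%:R * (connected_in S x z)%:R * g ^+ #|cluster S x|.
    rewrite expr2 {1 2}card_clusterE !mulr_suml; apply: eq_bigr => y _.
    by rewrite mulr_sumr mulr_suml.
  apply: ler_sum => y _; apply: ler_sum => z _; apply: sum_unique_le.
  - by rewrite !mulr_ge0 // exprn_ge0.
  - move=> [[[v w1] w2] w3] [[[v' w1'] w2'] w3'] /= t t'; exact: tripod_unique t t'.
  move=> [[[v w1] w2] w3] /= t; have [[xv yv zv] _ _] := tripod_atP t.
  have xy : connected_in S x y by apply: conn_trans xv _; rewrite conn_symE.
  have xz : connected_in S x z by apply: conn_trans xv _; rewrite conn_symE.
  rewrite xy xz !mul1r ler_wiXn2l // (cluster_eq xv).
  by case/and4P: t => /tripod_card.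
have -> : \sum_x \sum_y \sum_z \sum_(i | P x y z i) F i =
    \sum_i \sum_x \sum_y \sum_z (P x y z i)%:R * F i.
  rewrite [RHS]exchange_big; apply: eq_bigr => x _; rewrite [RHS]exchange_big.
  apply: eq_bigr => y _; rewrite [RHS]exchange_big; apply: eq_bigr => z _.
  by rewrite big_mkcond; apply: eq_bigr => i _; case: P; rewrite ?mul1r ?mul0r.
apply: ler_sum => -[[[v w1] w2] w3] _ /=.
rewrite /P /tripod_at /F /kw /c /=; set S' := off S [set v].
case: (tripod S v w1 w2 w3) => /=; last first.
  by rewrite mul0r; do 3!(apply: sumr_ge0 => ? _); rewrite mul0r.
rewrite mul1r [leLHS](_ : _ = \sum_x \sum_y \sum_z
    (connected_in S' w1 x)%:R * (connected_in S' w2 y)%:R * (connected_in S' w3 z)%:R *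
    g ^+ (#|cluster S' w1| + #|cluster S' w2| + #|cluster S' w3|).+1); last first.
  rewrite exprS !exprD {1}card_clusterE {1}(card_clusterE R S' w2) {1}(card_clusterE R S' w3).
  set a := g ^+ _; set b := g ^+ _; set d := g ^+ _.
  under [RHS]eq_bigr => x _.
    under eq_bigr => y _ do rewrite -mulr_suml -mulr_sumr.
    rewrite -mulr_suml -mulr_suml -mulr_sumr; over.
  rewrite -!mulr_suml; ring.
apply: ler_sum => x _; apply: ler_sum => y _; apply: ler_sum => z _.
by rewrite -!mulnb !natrM mulrA.
Qed.

Lemma prob_open_nbrs v (W : {set G}) : W \subset [set w | adj v w] -> #|W| = 3%N ->
  p ^+ 3 * (1 - p) ^+ Omega <= percE p (fun S => (open_nbrs S v == W)%:R).
Proof.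
case/andP: p01 => p0 p1 sW W3.
pose wt (b : {set G}) (i : bool) : R :=
  if v \in b then ((i == [exists w in W, b == [set v; w]])%:R) else 1.
have set2inj w w' : [set v; w] = [set v; w'] -> w = w'.
  by case/set2_eq => [[]//|[<- ->]].
have ex w : [exists w' in W, [set v; w] == [set v; w']] = (w \in W).
  apply/exists_inP/idP => [[w' w'W /eqP/set2inj -> //]|wW]; by exists w.
apply: (@le_trans _ _ (percE p (fun S => \prod_(b <- enum (bonds G)) wt b (b \in S)))); last first.
  apply: percE_le => // S sS.
  have wt01 b i : 0 <= wt b i <= 1.
    by rewrite /wt; case: ifP; rewrite ?ler01 ?lexx // ler0n lern1 leq_b1.
  have [_|nW] := boolP (open_nbrs S v == W).
    elim: (enum _) => [|b l IH]; first by rewrite big_nil.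
    rewrite big_cons mulr_ile1 //; try by case/andP: (wt01 b (b \in S)).
    by apply: prodr_ge0 => c _; case/andP: (wt01 c (c \in S)).
  suff [w [bw wtw]] : exists w, [set v; w] \in bonds G /\ wt [set v; w] ([set v; w] \in S) = 0.
    by rewrite (bigD1_seq [set v; w]) ?mem_enum ?enum_uniq //= wtw mul0r.
  have /existsP[w hw] : [exists w, (w \in open_nbrs S v) != (w \in W)].
    apply: contraNT nW; rewrite negb_exists => /forallP h; apply/eqP/setP => w.
    by apply/eqP; rewrite -[_ == _]negbK h.
  rewrite inE in hw; exists w; split.
    case vw: ([set v; w] \in S) hw; first by rewrite (subsetP sS _ vw).
    move=> h; have wW : w \in W by case: (w \in W) h.
    have := subsetP sW w wW; rewrite inE => avw.
    by apply/imsetP; exists (v, w); rewrite ?inE.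
  by rewrite /wt set21 ex (negbTE hw).
rewrite percEE bern_prod ?enum_uniq // big_enum /=.
pose N := [set w | adj v w].
have card_N : #|N| = Omega by rewrite -(degG v).
rewrite (bigID (fun b : {set G} => v \in b)) /= [X in _ <= _ * X]big1; last first.
  by move=> b /andP[_ /negbTE vb]; rewrite /wt vb; ring.
rewrite mulr1 (eq_bigl (mem [set [set v; w] | w in N])); last first.
  move=> b; apply/andP/imsetP => [[/imsetP[[x y]] ]|[w]]; rewrite inE /=.
    move=> xy ->; rewrite !inE => /orP[] /eqP e; [exists y|exists x]; rewrite ?inE e //.
    - by rewrite adj_sym.
    - by rewrite setUC.
  move=> vw ->; rewrite set21; split=> //.
  by apply/imsetP; exists (v, w); rewrite ?inE.
rewrite big_imset /=; last by move=> w w' _ _; exact: set2inj.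
rewrite (big_setID W) /= (setIidPr sW).
rewrite (eq_bigr (fun=> p)); last first.
  by move=> w wW; rewrite /wt set21 ex wW /=; ring.
rewrite [X in _ <= _ * X](eq_bigr (fun=> 1 - p)); last first.
  by move=> w; rewrite inE => /andP[/negbTE nW _]; rewrite /wt set21 ex nW /=; ring.
rewrite !prodr_const W3 ler_wpM2l ?exprn_ge0 //.
rewrite ler_wiXn2l ?subr_ge0 //; first by lra.
by rewrite -card_N subset_leq_card // subsetDl.
Qed.

(** The bonds at [v] are independent of those off [v], and the latter are explored
    from [w1], [w2] and [w3] in turn; the factor [6] counts the six pairs among
    [v], [w1], [w2], [w3]. *)
Lemma tripod_lower (v w1 w2 w3 : G) (a0 : R) :
  (forall x y : G, x != y -> triangle p x y <= a0) ->
  adj v w1 -> adj v w2 -> adj v w3 -> w1 != w2 -> w1 != w3 -> w2 != w3 ->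
  p ^+ 3 * (1 - p) ^+ Omega *
    (percE p (fun S => kw #|cluster S o|) ^+ 3 - 6 * a0 * chi o p ^+ 3)
  <= percE p (fun S => (tripod S v w1 w2 w3)%:R *
       (kw #|cluster (off S [set v]) w1| * (kw #|cluster (off S [set v]) w2| *
          kw #|cluster (off S [set v]) w3|))).
Proof.
move=> tri a1 a2 a3 n12 n13 n23; set eta := percE p _.
have nv w : adj v w -> w != v by apply: contraTneq => ->; rewrite adj_irrefl.
pose A := [set v].
pose B S := branch kw A w1 S *
       (branch kw (A :|: cluster (off S A) w1) w2 S *
        branch kw (A :|: cluster (off S A) w1 :|:
                cluster (off S (A :|: cluster (off S A) w1)) w2) w3 S).
have br A' w S : 0 <= branch kw A' w S by apply: mulr_ge0; rewrite ?kw_ge0.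
have B0 S : 0 <= B S by do 2!apply: mulr_ge0 => //.
have c0 : 0 <= p ^+ 3 * (1 - p) ^+ Omega.
  by case/andP: p01 => *; rewrite mulr_ge0 ?exprn_ge0 // subr_ge0.
pose W := [set w1; w2; w3].
apply: (@le_trans _ _ (percE p (fun S => (open_nbrs S v == W)%:R * B S))); last first.
  apply: percE_le => // S _; rewrite /tripod -/W -/A.
  case: (open_nbrs S v == W) => /=; last by rewrite !mul0r.
  rewrite !nv //= mul1r /B /branch !in_set1 !nv // !mul1r.
  set S1 := off S A.
  rewrite [w2 \in _]inE in_set1 (negbTE (nv _ a2)) /= mem_cluster.
  rewrite [w3 \in _]inE [w3 \in _ :|: _]inE in_set1 (negbTE (nv _ a3)) /= !mem_cluster.
  rewrite -!off_off -/S1.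
  case c12 : (connected_in S1 w1 w2) => /=; first by rewrite !(mul0r, mulr0).
  rewrite (cluster_off (negbT c12)).
  case c13 : (connected_in S1 w1 w3) => /=; first by rewrite !(mul0r, mulr0).
  have e3 : cluster (off S1 (cluster S1 w1)) w3 = cluster S1 w3.
    by rewrite (cluster_off (negbT c13)).
  have e23 : connected_in (off S1 (cluster S1 w1)) w2 w3 = connected_in S1 w2 w3.
    by rewrite -!mem_cluster (cluster_off (negbT c12)).
  rewrite -(cluster_off (negbT c12)).
  case c23 : (connected_in S1 w2 w3); rewrite /= e23 c23 /=; first by rewrite !(mul0r, mulr0).
  rewrite (@cluster_off _ _ w2 w3) ?e23 ?c23 // e3 !mul1r //.
have -> : percE p (fun S => (open_nbrs S v == W)%:R * B S)
    = percE p (fun S => (open_nbrs S v == W)%:R) * percE p B.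
  apply: (@percE_indep _ _ _ [set b : {set G} | v \in b] [set b : {set G} | v \notin b]).
  - by rewrite -setI_eq0; apply/eqP/setP => b; rewrite !inE andbN.
  - move=> S; congr ((_ == W)%:R); apply/setP => w; rewrite !inE eqxx.
    by rewrite andbT.
  move=> S; have eoff (D : {set G}) : v \in D ->
      off (S :&: [set b : {set G} | v \notin b]) D = off S D.
    move=> vD; apply/setP => b; rewrite !inE -andbA; congr (_ && _).
    have [bD|] := boolP [disjoint b & D]; last by rewrite andbF.
    by rewrite andbT; apply/negP => vb; move/pred0P/(_ v): bD; rewrite /= vb vD.
  by rewrite /B /branch !eoff ?inE ?eqxx.
have sW : W \subset [set w | adj v w].
  by apply/subsetP => w; rewrite !inE => /orP[/orP[]|] /eqP ->.
have W3 : #|W| = 3%N.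
  rewrite /W -setUA cardsU1 !inE negb_or n12 n13 cards2 n23 //.
apply: (@le_trans _ _ (p ^+ 3 * (1 - p) ^+ Omega * percE p B)); last first.
  by rewrite ler_wpM2r ?percE_ge0 // prob_open_nbrs.
rewrite ler_wpM2l //.
have := three_branches o trG p2 kw_ge0 kw_le kw_lip A w1 w2 w3; apply: le_trans.
rewrite lerD2l lerN2 !big_set1 [leRHS]mulrC ler_wpM2l ?exprn_ge0 ?chi_ge0 //.
have T w : adj v w -> tau p w v <= a0.
  by move=> /nv vw; apply: le_trans (tau_le_triangle w v p01) (tri _ _ vw).
have := T _ a1; have := T _ a2; have := T _ a3.
have := tri _ _ n12; have := tri _ _ n13; have := tri _ _ n23; lra.
Qed.

Lemma sum_distinct_nbrs (v : G) : (2 < Omega)%N ->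
  \sum_(w1 | adj v w1) \sum_(w2 | adj v w2 && (w1 != w2))
    \sum_(w3 | [&& adj v w3, w1 != w3 & w2 != w3]) (1 : R)
  = Omega%:R * (Omega%:R - 1) * (Omega%:R - 2).
Proof.
move=> O2; pose N := [set w | adj v w]; have cN : #|N| = Omega by rewrite -(degG v).
have -> : Omega%:R - 2 = (Omega - 2)%:R :> R by rewrite natrB // ltnW.
have -> : Omega%:R - 1 = (Omega - 1)%:R :> R by rewrite natrB // ltnW // ltnW.
have c1 w1 : adj v w1 -> #|N :\ w1| = (Omega - 1)%N.
  by move=> a1; rewrite -cN (cardsD1 w1 N) inE a1 /= add1n subn1.
have c2 w1 w2 : adj v w1 -> adj v w2 -> w1 != w2 -> #|N :\ w1 :\ w2| = (Omega - 2)%N.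
  move=> a1 a2 n12; have := cardsD1 w2 (N :\ w1).
  rewrite !inE a2 eq_sym n12 /= c1 // add1n => e.
  by rewrite -[LHS]/(_.+1.-1) -e -subn1 -subnDA.
rewrite (eq_bigr (fun=> (Omega - 1)%:R * (Omega - 2)%:R)); last first.
  move=> w1 a1; rewrite (eq_bigr (fun=> (Omega - 2)%:R)); last first.
    move=> w2 /andP[a2 n12]; rewrite sumr_const -(c2 _ _ a1 a2 n12); congr (_%:R).
    apply: eq_card => w; rewrite !inE unfold_in /= !(eq_sym w).
    by case: adj; rewrite ?andbF //= andbT andbC.
  rewrite sumr_const -[LHS]mulr_natl -(c1 _ a1); congr (_%:R * _).
  by apply: eq_card => w; rewrite !inE unfold_in /= (eq_sym w) andbC.
rewrite sumr_const -[LHS]mulr_natl -mulrA; congr (_%:R * _).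
by rewrite -cN; apply: eq_card => w; rewrite inE.
Qed.

(** Tripods alone make the second moment cubic in [chi], which is the order of the
    upper bound [second_moment_le]. *)
Lemma second_moment_lower (a0 : R) : (2 < Omega)%N ->
  (forall x y : G, x != y -> triangle p x y <= a0) ->
  g * (Omega%:R * (Omega%:R - 1) * (Omega%:R - 2) * (p ^+ 3 * (1 - p) ^+ Omega *
    (percE p (fun S => kw #|cluster S o|) ^+ 3 - 6 * a0 * chi o p ^+ 3)))
  <= percE p (fun S => #|cluster S o|%:R ^+ 2 * g ^+ #|cluster S o|).
Proof.
move=> O2 tri; set K := p ^+ 3 * _ * _.
have V0 : 0 < #|G|%:R :> R by rewrite ltr0n; apply/card_gt0P; exists o.
rewrite -(ler_pM2l V0).
pose F (n : nat) : R := n%:R ^+ 2 * g ^+ n.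
have -> : #|G|%:R * percE p (fun S => #|cluster S o|%:R ^+ 2 * g ^+ #|cluster S o|)
    = percE p (fun S => \sum_(x : G) F #|cluster S x|).
  rewrite percE_sum (eq_bigr (fun=> percE p (fun S => F #|cluster S o|))); last first.
    by move=> x _; rewrite -(percE_card o trG p F x).
  by rewrite sumr_const mulr_natl.
apply: le_trans (percE_le p01 (fun S _ => tripod_count S)).
rewrite percE_sum [leLHS](_ : _ = \sum_(v : G) g * (Omega%:R * (Omega%:R - 1)
  * (Omega%:R - 2) * K)); last by rewrite sumr_const [LHS]mulr_natl.
apply: ler_sum => v _.
rewrite percE_sum -(sum_distinct_nbrs v O2) mulrCA !mulr_suml.
have pos w1 w2 w3 : 0 <= percE p (fun S => (tripod S v w1 w2 w3)%:R *
    (g * (kw #|cluster (off S [set v]) w1| * (kw #|cluster (off S [set v]) w2| *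
          kw #|cluster (off S [set v]) w3|)))).
  by apply: percE_ge0 => // S; rewrite !mulr_ge0 ?exprn_ge0.
rewrite [leRHS](bigID (fun w1 => adj v w1)) /= ler_wpDr ?sumr_ge0 //.
  move=> w1 _; rewrite percE_sum sumr_ge0 // => w2 _; rewrite percE_sum sumr_ge0 //.
apply: ler_sum => w1 a1; rewrite !mulr_suml percE_sum.
rewrite [leRHS](bigID (fun w2 => adj v w2 && (w1 != w2))) /= ler_wpDr ?sumr_ge0 //.
  by move=> w2 _; rewrite percE_sum sumr_ge0.
apply: ler_sum => w2 /andP[a2 n12]; rewrite !mulr_suml percE_sum.
rewrite [leRHS](bigID (fun w3 => [&& adj v w3, w1 != w3 & w2 != w3])) /= ler_wpDr ?sumr_ge0 //.
apply: ler_sum => w3 /and3P[a3 n13 n23]; rewrite mul1r.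
apply: le_trans (ler_wpM2l g0 (tripod_lower tri a1 a2 a3 n12 n13 n23)) _.
rewrite -percEZ; apply: percE_le => // S _.
by rewrite mulrCA.
Qed.

End TripodMoment.

(** * Differential inequalities on an interval *)

Section Calculus.
Variable R : realType.
Implicit Types (f df : R -> R) (a b : R).

Lemma derive_continuous f (x dfx : R) : is_derive x 1 f dfx -> {for x, continuous f}.
Proof. by move=> d; apply/differentiable_continuous/derivable1_diffP; case: d. Qed.

Lemma is_derive_exp f (t dft : R) m : is_derive t 1 f dft ->
  is_derive t 1 (fun s => f s ^+ m) (m%:R * f t ^+ m.-1 * dft).
Proof.
move=> D; elim: m => [|m IH].
  by rewrite mul0r mul0r; exact: is_derive_cst.
have -> : (fun s => f s ^+ m.+1) = (fun s => f s * f s ^+ m).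
  by apply/boolp.funext => s; rewrite exprS.
apply: is_derive_eq (is_deriveM D IH) _; rewrite /GRing.scale /=.
case: m {IH} => [|m] /=; first by rewrite !expr0; ring.
by rewrite -[in RHS]natr1 exprS; ring.
Qed.

Lemma decay (c x : R) :
  is_derive x 1 (fun t : R => expR (c * t)) (expR (c * x) * (c * 1)).
Proof.
have D : is_derive x 1 (fun t : R => c * t) (c * 1).
  apply: is_derive_eq (is_deriveM (is_derive_cst c x (1 : R)) (is_derive_id x (1 : R))) _.
  by rewrite scaler0 addr0.
exact: (is_derive1_comp (is_derive_expR (c * x)) D).
Qed.

Lemma derive_le0_le f df a b : a <= b ->
  (forall x, a <= x <= b -> is_derive x 1 f (df x)) ->
  (forall x, a < x < b -> df x <= 0) -> f b <= f a.
Proof.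
move=> ab dfx df0; have [c cab e] : exists2 c, c \in `]a, b[%R \/ a = b &
    f b - f a = df c * (b - a).
  move: ab; rewrite le_eqVlt => /predU1P[->|ab].
    by exists b; [right | rewrite !subrr mulr0].
  have [||c cab e] := @MVT R f df a b ab.
  - by move=> x; rewrite in_itv /= => /andP[ax xb]; apply: dfx; rewrite !ltW.
  - apply: derivable_within_continuous => x; rewrite in_itv /= => xab.
    by case: (dfx x xab).
  - by exists c; [left|].
rewrite -subr_le0 e; case: cab => [|->]; last by rewrite subrr mulr0.
by rewrite in_itv /= => /df0 h; rewrite mulr_le0_ge0 // subr_ge0.
Qed.

(** After its last nonpositive time, [f] would have to grow exponentially from a
    nonpositive value. *)
Lemma barrier f df (L a b : R) : a <= b ->
  (forall x, a <= x <= b -> is_derive x 1 f (df x)) ->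
  (forall x, a < x < b -> 0 < f x -> df x <= L * f x) ->
  f a <= 0 -> f b <= 0.
Proof.
move=> ab dfx dfL fa; rewrite leNgt; apply/negP => fb.
pose E : classical_sets.set R := fun t => a <= t <= b /\ f t <= 0.
have Ea : E a by rewrite /E lexx ab.
have supE : classical_sets.has_sup E.
  by split; [exists a | exists b => t [/andP[_ ->]]].
pose s := sup E.
have sa : a <= s by apply: ub_le_sup => //; exact: supE.2.
have sb : s <= b by apply: ge_sup => [|t [/andP[_ ->]] //]; exists a.
have fs : f s <= 0.
  rewrite leNgt; apply/negP => fs0.
  have cs : {for s, continuous f} by apply: (derive_continuous (dfx s _)); rewrite sa sb.
  have : \forall t \near s, 0 < f t by apply: (cvgr_gt (f s) cs).
  move=> /nbhs_ballP[e /= e0 he].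
  have [t Et st] := sup_adherent e0 supE; have [_ ft] := Et.
  have ts : t <= s by apply: ub_le_sup => //; exact: supE.2.
  have : 0 < f t.
    by apply: he; rewrite /ball /= ger0_norm ?subr_ge0 // ltrBlDr -ltrBlDl.
  by rewrite ltNge ft.
have pos t : s < t -> t <= b -> 0 < f t.
  move=> st tb; rewrite ltNge; apply/negP => ft; have := st; rewrite ltNge => /negP; apply.
  by apply: ub_le_sup; [exact: supE.2 | split=> //; rewrite tb (le_trans sa (ltW st))].
have : f b * expR (- L * b) <= f s * expR (- L * s).
  apply: (@derive_le0_le (fun t => f t * expR (- L * t))
    (fun t => (df t - L * f t) * expR (- L * t))) => //.
    move=> x /andP[sx xb]; have D1 := dfx x; rewrite xb (le_trans sa sx) in D1.
    have D2 : is_derive x 1 (fun t : R => expR (- L * t)) (expR (- L * x) * (- L * 1)).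
      exact: decay.
    apply: is_derive_eq (is_deriveM (D1 isT) D2) _.
    by rewrite /GRing.scale /=; ring.
  move=> x /andP[sx xb]; rewrite mulr_le0_ge0 ?expR_ge0 // subr_le0 dfL //.
    by rewrite xb (le_lt_trans sa).
  by rewrite pos // ltW.
apply/negP; rewrite -ltNge (@le_lt_trans _ _ 0) ?mulr_gt0 ?expR_gt0 //.
by rewrite mulr_le0_ge0 // expR_ge0.
Qed.

Lemma gronwall f df (al be a b : R) : a <= b -> 0 <= be ->
  (forall x, a <= x <= b -> is_derive x 1 f (df x)) ->
  (forall x, a < x < b -> df x <= be * (f x + al)) ->
  f b + al <= (f a + al) * expR (be * (b - a)).
Proof.
move=> ab be0 dfx dfL.
have : (f b + al) * expR (- be * b) <= (f a + al) * expR (- be * a).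
  apply: (@derive_le0_le (fun t => (f t + al) * expR (- be * t))
    (fun t => (df t - be * (f t + al)) * expR (- be * t))) => //.
    move=> x /dfx D1.
    have D0 : is_derive x 1 (fun t => f t + al) (df x).
      by apply: is_derive_eq (is_deriveD D1 (is_derive_cst al x (1 : R))) _; rewrite addr0.
    have D2 : is_derive x 1 (fun t : R => expR (- be * t)) (expR (- be * x) * (- be * 1)).
      exact: decay.
    apply: is_derive_eq (is_deriveM D0 D2) _.
    by rewrite /GRing.scale /=; ring.
  by move=> x xab; rewrite mulr_le0_ge0 ?expR_ge0 // subr_le0 dfL.
have -> : expR (be * (b - a)) = expR (be * b) * expR (- be * a).
  by rewrite -expRD; congr expR; ring.
move=> h; rewrite -[leLHS]mulr1 -(expRxMexpNx_1 (be * b)) -mulNr [expR (be * b) * _]mulrC.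
rewrite [leLHS]mulrA [leRHS](_ : _ = (f a + al) * expR (- be * a) * expR (be * b)); last by ring.
by rewrite ler_wpM2r ?expR_ge0.
Qed.

End Calculus.

(** * Differential inequalities for percolation *)

Section PercolationODE.
Variables (R : realType) (G : sgraph) (o : G) (Omega : nat).
Hypothesis trG : vertex_transitive G.
Hypothesis degG : forall x : G, degree x = Omega.
Implicit Types (p q : R) (S : config G) (u v x y : G).

Local Notation V := (#|G|%:R : R).
Local Notation n S x := #|cluster S x|.

Lemma card_gt0R : 0 < V.
Proof. by rewrite ltr0n; apply/card_gt0P; exists o. Qed.

Lemma sum_adj_const (c : R) : \sum_(u : G) \sum_(v | adj u v) c = V * Omega%:R * c.
Proof.
rewrite (eq_bigr (fun=> Omega%:R * c)); last first.
  move=> u _; rewrite sumr_const [RHS]mulr_natl -(degG u); congr (_ *+ _).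
  by apply: eq_card => v; rewrite inE.
by rewrite sumr_const -[LHS]mulr_natl mulrA.
Qed.

Lemma sum_adj_sym (F : G -> G -> R) :
  \sum_(u : G) \sum_(v | adj u v) F u v = \sum_(u : G) \sum_(v | adj u v) F v u.
Proof.
rewrite (exchange_big_dep xpredT) //=; apply: eq_bigr => v _.
by apply: eq_bigl => u; rewrite adj_sym.
Qed.

Lemma sum_vertices p (F : nat -> R) :
  percE p (fun S => \sum_x F (n S x)) = V * percE p (fun S => F (n S o)).
Proof.
rewrite percE_sum (eq_bigr (fun=> percE p (fun S => F (n S o)))).
  by rewrite sumr_const -[LHS]mulr_natl.
by move=> x _; rewrite -(percE_card o trG p F x).
Qed.

(** Only the vertices of the two merged clusters contribute. *)
Lemma merge_sum (F : nat -> R) S u v :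
  \sum_x F (n ([set u; v] |: S) x) - \sum_x F (n S x)
  = (~~ connected_in S u v)%:R *
    ((n S u)%:R * (F (n S u + n S v)%N - F (n S u))
     + (n S v)%:R * (F (n S u + n S v)%N - F (n S v))).
Proof.
rewrite -sumrB; case uv: (connected_in S u v).
  by rewrite mul0r big1 // => x _; rewrite cluster_add_same // subrr.
rewrite mul1r; have dis : [disjoint cluster S u & cluster S v].
  rewrite -setI_eq0; apply/eqP/setP => x; rewrite !inE; apply/negP => /andP[ux vx].
  by move: uv; rewrite (conn_trans ux) // conn_symE.
have cU : #|cluster S u :|: cluster S v| = (n S u + n S v)%N.
  by rewrite cardsU disjoint_setI0 // cards0 subn0.
have ind (A : {set G}) c : \sum_x (x \in A)%:R * c = #|A|%:R * c :> R.
  have -> : #|A| = (\sum_x (x \in A))%N by rewrite -sum1_card big_mkcond.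
  by rewrite natr_sum mulr_suml.
rewrite -!ind -big_split /=; apply: eq_bigr => x _.
have [xu|xu] := boolP (x \in cluster S u).
  rewrite (disjointFr dis xu) mul1r mul0r addr0 cluster_add_in ?inE ?xu //; last first.
    by rewrite -mem_cluster xu.
  by rewrite cU; move: xu; rewrite mem_cluster => /cluster_eq ->.
have [xv|xv] := boolP (x \in cluster S v).
  rewrite mul1r mul0r add0r cluster_add_in; last by rewrite inE xv orbT.
  by rewrite cU; move: xv; rewrite mem_cluster => /cluster_eq ->.
by rewrite cluster_add_out ?inE 1?negb_or -?mem_cluster ?xu ?xv // subrr !mul0r addr0.
Qed.

Lemma is_derive_percE1 X p : is_derive p 1 (fun q => @percE R G q X) (dpercE p X).
Proof.
have := is_derive_percE (is_derive_id p (1 : R)) (fun S => is_derive_cst (X S) p (1 : R)).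
move=> D; apply: is_derive_eq D _; rewrite mul1r.
by rewrite [X in _ + X](_ : _ = 0) ?addr0 //; exact: percE_cst.
Qed.

Lemma dpercE_uniq (X X' : config G -> R) p : (forall q, @percE R G q X = percE q X') ->
  dpercE p X = dpercE p X'.
Proof.
move=> e; have [_ <-] := is_derive_percE1 X p; have [_ <-] := is_derive_percE1 X' p.
by congr ('D_1 _ p); apply/boolp.funext.
Qed.

Lemma dpercEZ (c : R) X p : dpercE p (fun S : config G => c * X S) = c * dpercE p X.
Proof.
have D1 := is_derive_percE1 (fun S => c * X S) p.
have D2 := is_deriveM (is_derive_cst c p (1 : R)) (is_derive_percE1 X p).
have [_ <-] := D1; have [_ e2] := D2.
rewrite scaler0 addr0 in e2; rewrite -[RHS]e2.
by congr ('D_1 _ p); apply/boolp.funext => q; rewrite percEZ.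
Qed.

(** Russo's formula for a function of the cluster size: by transitivity the sum
    over pivotal bonds becomes a sum over ordered pairs of neighbours. *)
Lemma derive_cluster p (F : nat -> R) :
  V * ((1 - p) * dpercE p (fun S => F (n S o)))
  = \sum_u \sum_(v | adj u v) percE p (fun S => (~~ connected_in S u v)%:R *
      ((n S u)%:R * (F (n S u + n S v)%N - F (n S u)))).
Proof.
rewrite mulrCA -dpercEZ (@dpercE_uniq _ (fun S => \sum_x F (n S x))); last first.
  by move=> q; rewrite sum_vertices percEZ.
pose T u v := percE p (fun S => (~~ connected_in S u v)%:R *
      ((n S u)%:R * (F (n S u + n S v)%N - F (n S u)))).
rewrite russo_percE -/T.
rewrite (eq_bigr (fun u => \sum_(v | adj u v) (T u v + T v u))); last first.
  move=> u _; apply: eq_bigr => v _; rewrite /T -percED; apply: percE_eq => S _.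
  by rewrite merge_sum mulrDr (conn_symE S v u) [(n S v + _)%N]addnC.
under eq_bigr do rewrite big_split /=.
rewrite big_split /= -sum_adj_sym -mulr2n -[X in _ * X]mulr_natl mulKf ?pnatr_eq0 //.
Qed.

Section Mag.
Implicit Types (g : R).

(** The magnetization: the probability that the cluster is hit by an independent
    set of vertices of density [1 - g]. *)
Definition mag p g := percE p (fun S => 1 - g ^+ n S o).

Lemma mag_ge0 p g : 0 <= p <= 1 -> 0 <= g <= 1 -> 0 <= mag p g.
Proof.
move=> p01 /andP[g0 g1]; apply: percE_ge0 => // S.
by rewrite subr_ge0 exprn_ile1.
Qed.

Lemma mag_le1 p g : 0 <= p <= 1 -> 0 <= g <= 1 -> mag p g <= 1.
Proof.
move=> p01 /andP[g0 g1]; rewrite -[leRHS](@percE_cst R G p); apply: percE_le => // S _.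
by rewrite lerBlDr lerDl exprn_ge0.
Qed.

Lemma mag_antitone p g g' : 0 <= p <= 1 -> 0 <= g -> g <= g' ->
  mag p g' <= mag p g.
Proof.
move=> p01 g0 gg; apply: percE_le => // S _; rewrite lerD2l lerN2.
by rewrite lerXn2r ?nnegrE // (le_trans g0).
Qed.

Lemma mag_mono_p p q g : 0 <= p -> p <= q -> q <= 1 -> 0 <= g <= 1 ->
  mag p g <= mag q g.
Proof.
move=> p0 pq q1 /andP[g0 g1]; apply: percE_mono_p => // S S' sS.
by rewrite lerD2l lerN2 ler_wiXn2l // card_mono.
Qed.

(** The Aizenman--Barsky inequality: a pivotal bond joins a cluster that is not
    hit to one that is. *)
Lemma mag_derive_le p g : 0 <= p <= 1 -> 0 <= g <= 1 ->
  (1 - p) * dpercE p (fun S => 1 - g ^+ n S o)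
  <= Omega%:R * percE p (fun S => kw g (n S o)) * mag p g.
Proof.
move=> p01 g01; case/andP: (g01) => g0 g1.
rewrite -(ler_pM2l card_gt0R) (derive_cluster p (fun m => 1 - g ^+ m)).
rewrite !mulrA -[leRHS]mulrA -sum_adj_const.
apply: ler_sum => u _; apply: ler_sum => v _.
have f0 m : 0 <= 1 - g ^+ m by rewrite subr_ge0 exprn_ile1.
have fm m k : (m <= k)%N -> 1 - g ^+ m <= 1 - g ^+ k.
  by move=> mk; rewrite lerD2l lerN2 ler_wiXn2l.
apply: le_trans (two_clusters_le o trG p01 u v (kw_ge0 g01) f0 fm).
apply: percE_le => // S _; rewrite /kw exprD.
move: (g ^+ n S u) (g ^+ n S v) (n S u)%:R => a b c.
by rewrite -[in leRHS]mulrA ler_wpM2l //; lra.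
Qed.

(** Along the characteristics of the Aizenman--Barsky inequality, raising [p] is
    paid for by lowering the density [1 - g]. *)
Lemma mag_characteristic (p1 p2 q c0 c1 m : R) :
  0 <= p1 -> p1 <= p2 -> p2 <= q -> q < 1 -> 0 <= c1 -> c1 <= c0 -> c0 <= 1 ->
  mag p1 (1 - c0) <= m -> Omega%:R * m * (p2 - p1) <= (1 - q) * (c0 - c1) ->
  mag p2 (1 - c1) <= m.
Proof.
move=> p10 p12 p2q q1 c10 c1c0 c01 hm hs.
have p1_01 : 0 <= p1 <= 1 by rewrite p10 (le_trans p12) // (le_trans p2q) // ltW.
have p2_01 : 0 <= p2 <= 1 by rewrite (le_trans p10 p12) (le_trans p2q) // ltW.
have m0 : 0 <= m by apply: le_trans (mag_ge0 p1_01 _) hm; lra.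
have q1' : 0 < 1 - q by rewrite subr_gt0.
pose k := Omega%:R * m / (1 - q).
have k0 : 0 <= k by rewrite divr_ge0 ?mulr_ge0 // ltW.
have kd : k * (p2 - p1) <= c0 - c1.
  by rewrite /k mulrAC ler_pdivrMr // [leRHS]mulrC.
pose gt (t : R) : R := 1 - c0 + k * (t - p1).
have gt01 t : p1 <= t <= p2 -> 0 <= gt t <= 1.
  move=> /andP[t1 t2]; have : k * (t - p1) <= k * (p2 - p1) by rewrite ler_wpM2l // lerD2r.
  have : 0 <= k * (t - p1) by rewrite mulr_ge0 // subr_ge0.
  rewrite /gt; lra.
suff : mag p2 (gt p2) <= m.
  apply: le_trans; apply: mag_antitone => //.
    by have /andP[] : 0 <= gt p2 <= 1 by apply: gt01; rewrite p12 lexx.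
  rewrite /gt; lra.
have Dg (t : R) : is_derive t 1 gt k.
  have D1 := is_deriveB (is_derive_id t (1 : R)) (is_derive_cst p1 t (1 : R)).
  have D2 := is_deriveM (is_derive_cst k t (1 : R)) D1.
  apply: is_derive_eq (is_deriveD (is_derive_cst (1 - c0) t (1 : R)) D2) _.
  by rewrite scaler0 addr0 subr0 add0r; rewrite /GRing.scale /= mulr1.
pose D t := percE t (fun S => (n S o)%:R * gt t ^+ (n S o).-1).
pose df t := dpercE t (fun S => 1 - gt t ^+ n S o) - k * D t.
have Dmag (t : R) : is_derive t 1 (fun s => mag s (gt s) - m) (df t).
  have DX S : is_derive t 1 (fun s => 1 - gt s ^+ n S o) (- (k * ((n S o)%:R * gt t ^+ (n S o).-1))).
    apply: is_derive_eq (is_deriveB (is_derive_cst (1 : R) t (1 : R)) (is_derive_exp (n S o) (Dg t))) _.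
    by rewrite sub0r /GRing.scale /=; congr (- _); rewrite mulrC.
  have D1 := is_derive_percE (is_derive_id t (1 : R)) DX.
  apply: is_derive_eq (is_deriveB D1 (is_derive_cst m t (1 : R))) _.
  rewrite subr0 mul1r /df /D -percEZ; congr (_ + _).
  have := @percEZ R G t (-1) (fun S => k * ((n S o)%:R * gt t ^+ (n S o).-1)).
  rewrite mulN1r => <-; by apply: percE_eq => S _; rewrite mulN1r.
rewrite -subr_le0.
apply: (@barrier R (fun s => mag s (gt s) - m) df (Omega%:R / (1 - q) * V) p1 p2) => //.
  move=> t /andP[t1 t2]; rewrite subr_gt0 => mt.
  have t01 : 0 <= t <= 1.
    by rewrite (le_trans p10 (ltW t1)) (le_trans (ltW t2)) //; case/andP: p2_01.
  have g01 : 0 <= gt t <= 1 by apply: gt01; rewrite !ltW.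
  case/andP: (g01) => g0 g1.
  have D0 : 0 <= D t by apply: percE_ge0 => // S; rewrite mulr_ge0 ?exprn_ge0.
  have DV : D t <= V.
    rewrite -[leRHS](@percE_cst R G t); apply: percE_le => // S _.
    by rewrite -[leRHS]mulr1 ler_pM ?exprn_ge0 ?exprn_ile1 // ler_nat max_card.
  have kwD : percE t (fun S => kw (gt t) (n S o)) <= D t.
    apply: percE_le => // S _; rewrite /kw ler_wpM2l //.
    by rewrite ler_wiXn2l // leq_pred.
  have t1q : 1 - q <= 1 - t by rewrite lerD2l lerN2 (le_trans (ltW t2)).
  have tlt1 : 0 < 1 - t by apply: lt_le_trans t1q.
  have M0 : 0 <= mag t (gt t) by apply: mag_ge0.
  have h1 : dpercE t (fun S => 1 - gt t ^+ n S o) <= Omega%:R / (1 - q) * D t * mag t (gt t).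
    rewrite -(ler_pM2l tlt1); apply: le_trans (mag_derive_le t01 g01) _.
    have h2 : Omega%:R * percE t (fun S => kw (gt t) (n S o)) * mag t (gt t)
       <= Omega%:R * D t * mag t (gt t) by rewrite ler_wpM2r // ler_wpM2l.
    apply: le_trans h2 _.
    have -> : (1 - t) * (Omega%:R / (1 - q) * D t * mag t (gt t))
       = ((1 - t) / (1 - q)) * (Omega%:R * D t * mag t (gt t)) by ring.
    rewrite ler_peMl ?mulr_ge0 // ler_pdivlMr // mul1r //.
  have -> : Omega%:R / (1 - q) * V * (mag t (gt t) - m)
     = (Omega%:R / (1 - q) * (mag t (gt t) - m)) * V by ring.
  apply: (@le_trans _ _ ((Omega%:R / (1 - q) * (mag t (gt t) - m)) * D t)).
    rewrite /df /k; move: h1; lra.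
  by rewrite ler_wpM2l // mulr_ge0 ?subr_ge0 ?divr_ge0 // ltW.
by rewrite subr_le0 /gt subrr mulr0 addr0.
Qed.

End Mag.

(** ** The susceptibility *)

(** The mean-field inequalities for the derivative of [chi]: the clusters of the two
    ends of a pivotal bond are negatively correlated, and nearly independent when
    the triangle between them is small. *)
Lemma chi_derive_le p : 0 <= p <= 1 ->
  (1 - p) * dpercE p (fun S => (n S o)%:R) <= Omega%:R * chi o p ^+ 2.
Proof.
move=> p01; rewrite -(ler_pM2l card_gt0R) (derive_cluster p (fun m => m%:R)).
rewrite mulrA -sum_adj_const; apply: ler_sum => u _; apply: ler_sum => v _.
have fm m k : (m <= k)%N -> m%:R <= k%:R :> R by rewrite ler_nat.
apply: le_trans (two_clusters_le o trG p01 u v (@ler0n R) (@ler0n R) fm).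
by apply: percE_le => // S _; rewrite natrD addrAC subrr add0r.
Qed.

Lemma chi_derive_ge p a0 : 0 <= p <= 2^-1 ->
  (forall u v, adj u v -> triangle p u v <= a0) ->
  Omega%:R * ((1 - a0) * chi o p ^+ 2) <= (1 - p) * dpercE p (fun S => (n S o)%:R).
Proof.
move=> p2 tri; rewrite -(ler_pM2l card_gt0R) (derive_cluster p (fun m => m%:R)).
rewrite [leLHS]mulrA -sum_adj_const; apply: ler_sum => u _; apply: ler_sum => v uv.
have p01 := half_le1 p2.
apply: (@le_trans _ _ (chi o p ^+ 2 * (1 - triangle p u v))).
  by rewrite mulrC ler_wpM2l ?exprn_ge0 ?chi_ge0 // lerD2l lerN2 tri.
apply: le_trans (two_clusters_lower o trG p2 u v) _.
by apply: percE_le => // S _; rewrite natrD addrAC subrr add0r.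
Qed.

Lemma chi_gt0 p : 0 <= p <= 1 -> 0 < chi o p.
Proof.
move=> p01; apply: lt_le_trans ltr01 _.
rewrite -[leLHS](@percE_cst R G p); apply: percE_le => // S _.
by rewrite ler1n card_cluster_gt0.
Qed.

Lemma chi_mono p q : 0 <= p -> p <= q -> q <= 1 -> chi o p <= chi o q.
Proof.
move=> *; apply: percE_mono_p => // S S' sS.
by rewrite ler_nat card_mono.
Qed.

Lemma tau_mono p q x y : 0 <= p -> p <= q -> q <= 1 -> tau p x y <= tau q x y.
Proof.
move=> *; rewrite !tauE; apply: percE_mono_p => // S S' sS.
by rewrite ler_nat; have := @conn_mono G x y _ _ sS; case: connected_in => // ->.
Qed.

Lemma triangle_mono p q x y : 0 <= p -> p <= q -> q <= 1 ->
  triangle p x y <= triangle q x y.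
Proof.
move=> p0 pq q1; have p01 : 0 <= p <= 1 by rewrite p0 (le_trans pq).
apply: ler_sum => u _; apply: ler_sum => v _.
by rewrite !ler_pM ?mulr_ge0 ?tau_ge0 ?tau_mono.
Qed.

Lemma inv_chi_le p q : 0 <= p -> p <= q -> q < 1 ->
  (chi o p)^-1 <= (chi o q)^-1 + Omega%:R * (q - p) / (1 - q).
Proof.
move=> p0 pq q1; set K := Omega%:R / (1 - q).
have q1' : 0 < 1 - q by rewrite subr_gt0.
pose f t := - (chi o t)^-1 - K * t.
pose df t := (chi o t) ^- 2 * dpercE t (fun S => (n S o)%:R) - K.
have : f q <= f p.
  apply: (@derive_le0_le R f df) => //.
    move=> t /andP[pt tq]; have t01 : 0 <= t <= 1 by rewrite (le_trans p0 pt) (le_trans tq) // ltW.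
    have D1 := is_deriveV (lt0r_neq0 (chi_gt0 t01)) (is_derive_percE1 (fun S => (n S o)%:R) t).
    have D2 := is_deriveM (is_derive_cst K t (1 : R)) (is_derive_id t (1 : R)).
    apply: is_derive_eq (is_deriveB (is_deriveN D1) D2) _.
    rewrite scaler0 addr0 /df /GRing.scale /= mulr1 mulNr opprK //.
  move=> t /andP[pt tq]; have t01 : 0 <= t <= 1.
    by rewrite (le_trans p0 (ltW pt)) (le_trans (ltW tq)) // ltW.
  have c0 := chi_gt0 t01; have t1 : 0 < 1 - t by rewrite subr_gt0 (lt_trans tq).
  rewrite /df subr_le0 ler_pdivrMl ?exprn_gt0 // -(ler_pM2l t1).
  apply: le_trans (chi_derive_le t01) _.
  rewrite /K; have -> : (1 - t) * (chi o t ^+ 2 * (Omega%:R / (1 - q))) =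
    ((1 - t) / (1 - q)) * (Omega%:R * chi o t ^+ 2) by ring.
  rewrite ler_peMl ?mulr_ge0 ?exprn_ge0 ?(ltW c0) // ler_pdivlMr // mul1r.
  by rewrite lerD2l lerN2 ltW.
have -> : Omega%:R * (q - p) / (1 - q) = K * (q - p) by rewrite /K; ring.
rewrite /f; lra.
Qed.

Lemma inv_chi_ge p q a0 : 0 <= p -> p <= q -> q <= 2^-1 -> a0 <= 1 ->
  (forall x y : G, x != y -> triangle q x y <= a0) ->
  (1 - a0) * Omega%:R * (q - p) <= (chi o p)^-1 - (chi o q)^-1.
Proof.
move=> p0 pq q2 a01 tri; set K := (1 - a0) * Omega%:R.
have q1 : q <= 1 by lra.
pose f t := (chi o t)^-1 + K * t.
pose df t := - ((chi o t) ^- 2 * dpercE t (fun S => (n S o)%:R)) + K.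
have : f q <= f p.
  apply: (@derive_le0_le R f df) => //.
    move=> t /andP[pt tq]; have t01 : 0 <= t <= 1 by rewrite (le_trans p0 pt) (le_trans tq).
    have D1 := is_deriveV (lt0r_neq0 (chi_gt0 t01)) (is_derive_percE1 (fun S => (n S o)%:R) t).
    have D2 := is_deriveM (is_derive_cst K t (1 : R)) (is_derive_id t (1 : R)).
    apply: is_derive_eq (is_deriveD D1 D2) _.
    by rewrite scaler0 addr0 /df /GRing.scale /= mulr1 mulNr.
  move=> t /andP[pt tq]; have t0 : 0 <= t by rewrite (le_trans p0) // ltW.
  have t2 : 0 <= t <= 2^-1 by rewrite t0 (le_trans (ltW tq)).
  have t01 := half_le1 t2; have c0 := chi_gt0 t01.
  have trit u v : adj u v -> triangle t u v <= a0.
    move=> uv; apply: le_trans (triangle_mono u v t0 (ltW tq) q1) (tri _ _ _).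
    by apply: contraTneq uv => ->; rewrite adj_irrefl.
  rewrite /df addrC subr_le0 ler_pdivlMl ?exprn_gt0 //.
  have := chi_derive_ge t2 trit; set d := dpercE _ _ => h.
  have d0 : 0 <= d.
    have : 0 <= (1 - t) * d.
      by apply: le_trans h; rewrite !mulr_ge0 ?exprn_ge0 ?(ltW c0) // subr_ge0.
    by rewrite pmulr_rge0 //; lra.
  apply: le_trans (_ : (1 - t) * d <= d).
    by rewrite mulrC /K -mulrA mulrCA.
  by rewrite ler_piMl //; lra.
rewrite /f; lra.
Qed.

Lemma chi0 : chi o (0 : R) = 1.
Proof.
rewrite /chi percEE.
have -> l (phi : config G -> R) : bern 0 l phi = phi set0.
  by elim: l phi => //= b l IH phi; rewrite subr0 mul1r mul0r addr0.
have -> : cluster set0 o = [set o] :> {set G}; last by rewrite cards1.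
apply/eqP; rewrite eqEsubset sub1set cluster_refl andbT; apply/subsetP => y.
rewrite mem_cluster; apply: conn_closed; last by rewrite inE.
by move=> u v; rewrite in_set0.
Qed.

Lemma chi_ivt p (x : R) : 0 <= p <= 1 -> 1 <= x -> x <= chi o p ->
  exists2 q, 0 <= q <= p & chi o q = x.
Proof.
move=> /andP[p0 p1] x1 xp.
have [||q] := @IVT R (chi o) 0 p x p0.
- apply: derivable_within_continuous => t _.
  by case: (is_derive_percE1 (fun S => (n S o)%:R) t).
- by rewrite chi0 ge_min le_max x1 xp orbT.
by rewrite in_itv /= => h e; exists q.
Qed.

End PercolationODE.

(** * Elementary inequalities for the hitting probability of a set of given size *)

Section Hitting.
Variables (R : realType) (c : R).
Hypothesis c01 : 0 <= c <= 1.
Let c0 : 0 <= c. Proof. by case/andP: c01. Qed.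
Let c1 : c <= 1. Proof. by case/andP: c01. Qed.
Let g := 1 - c.
Let g0 : 0 <= g. Proof. by rewrite subr_ge0. Qed.
Let g1 : g <= 1. Proof. by rewrite /g; move: c0; lra. Qed.
Implicit Types (m k : nat).

Lemma hit_ge0 m : 0 <= 1 - g ^+ m.
Proof. by rewrite subr_ge0 exprn_ile1. Qed.

Lemma hit_le m : 1 - g ^+ m <= m%:R * c.
Proof.
elim: m => [|m IH]; first by rewrite expr0 mul0r subrr.
rewrite exprS -natr1 /g -/g.
have h : c * g ^+ m <= c by rewrite ler_piMr // exprn_ile1.
have -> : 1 - (1 - c) * g ^+ m = (1 - g ^+ m) + c * g ^+ m by ring.
rewrite mulrDl mul1r lerD //.
Qed.

Lemma miss_le m : g ^+ m * (1 + m%:R * c) <= 1.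
Proof.
elim: m => [|m IH]; first by rewrite expr0 mul1r mul0r addr0.
apply: le_trans IH; rewrite exprSr -mulrA ler_wpM2l ?exprn_ge0 //.
rewrite -natr1 /g.
have : 0 <= c ^+ 2 * (m%:R + 1) by rewrite mulr_ge0 ?exprn_ge0 // addr_ge0.
move: (m%:R : R) => M; lra.
Qed.

Lemma kw_hit_le m : c * kw g m <= 1 - g ^+ m.
Proof.
have := miss_le m; rewrite /kw; move: (g ^+ m) => x; move: (m%:R : R) => M; lra.
Qed.

Lemma kw2_hit_le m : c ^+ 2 * (m%:R ^+ 2 * g ^+ m) <= 2 * (1 - g ^+ m).
Proof.
suff : g ^+ m * ((m%:R * c) ^+ 2 + 2) <= 2.
  move: (g ^+ m) => x; move: (m%:R : R) => M; lra.
elim: m => [|m IH]; first by rewrite expr0 mul0r expr0n /= add0r mul1r.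
apply: le_trans IH; rewrite exprSr -mulrA ler_wpM2l ?exprn_ge0 //.
rewrite -natr1 /g -subr_ge0; move: (m%:R : R) (ler0n R m) => M M0.
have -> : (M * c) ^+ 2 + 2 - (1 - c) * (((M + 1) * c) ^+ 2 + 2)
   = c * (((M + 1) * c - 1) ^+ 2 + 1 + c) by ring.
by rewrite mulr_ge0 // !addr_ge0 // sqr_ge0.
Qed.

(** The second-order loss in the union bound [hit_le]. *)
Lemma hit_deficit m : c * ((m%:R - 1) * (1 - g ^+ m)) <= 2 * (m%:R * c - (1 - g ^+ m)).
Proof.
elim: m => [|m IH]; first by rewrite expr0 subrr !mulr0 mul0r subrr mulr0.
have := mulr_ge0 c0 (mulr_ge0 c0 (mulr_ge0 (ler0n R m) (exprn_ge0 m g0))).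
have := ler_wpM2l c0 (kw_hit_le m).
move: IH; rewrite exprS -[m.+1%:R]natr1 /kw.
move: (g ^+ m) => x; move: (m%:R : R) => M; rewrite /g; lra.
Qed.

Lemma hit_half_lower m : m%:R * c <= 1 -> m%:R * c <= 2 * (1 - g ^+ m).
Proof.
have := miss_le m; have : 0 <= m%:R * c by rewrite mulr_ge0.
have : 0 <= g ^+ m by rewrite exprn_ge0.
move: (g ^+ m) => x; move: (m%:R * c) => y x0 y0 h y1.
have : x * (1 + y) * (2 - y) <= 1 * (2 - y) by apply: ler_wpM2r => //; lra.
have : 0 <= x * (y * (1 - y)) by rewrite !mulr_ge0 // subr_ge0.
lra.
Qed.

Lemma hit_ge_half m : 1 <= m%:R * c -> 1 <= 2 * (1 - g ^+ m).
Proof.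
have := miss_le m; have : 0 <= g ^+ m by rewrite exprn_ge0.
move: (g ^+ m) => x; move: (m%:R * c) => y x0 h y1.
have : x * 2 <= x * (1 + y) by apply: ler_wpM2l => //; lra.
lra.
Qed.

End Hitting.

(** * Number of pairs of hit vertices *)

Section HitPairs.
Variables (R : realType) (G : sgraph) (o : G) (Omega : nat).
Hypothesis trG : vertex_transitive G.
Hypothesis degG : forall x : G, degree x = Omega.
Variables (p g : R).
Hypothesis p01 : 0 <= p <= 1.
Hypothesis g01 : 0 <= g <= 1.
Let g0 : 0 <= g. Proof. by case/andP: g01. Qed.
Let g1 : g <= 1. Proof. by case/andP: g01. Qed.

Local Notation V := (#|G|%:R : R).
Local Notation n S x := #|cluster S x|.

Definition hits (S : config G) : R := \sum_x (1 - g ^+ n S x).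

Let f (m : nat) : R := 1 - g ^+ m.
Let f_ge0 m : 0 <= f m. Proof. by rewrite subr_ge0 exprn_ile1. Qed.
Let f_le1 m : f m <= 1. Proof. by rewrite lerBlDr lerDl exprn_ge0. Qed.
Let f_mono m k : (m <= k)%N -> f m <= f k.
Proof. by move=> mk; rewrite lerD2l lerN2 ler_wiXn2l. Qed.

Let hits_ge0 S : 0 <= hits S.
Proof. by apply: sumr_ge0 => x _; apply: f_ge0. Qed.

Let hits_mono : monotone hits.
Proof. by move=> S S' sS; apply: ler_sum => x _; apply/f_mono/card_mono. Qed.

Lemma hits_split S u : hits S <= (n S u)%:R + hits (off S (cluster S u)).
Proof.
rewrite card_clusterE -big_split /=; apply: ler_sum => x _.
case: (boolP (connected_in S u x)) => [_|/cluster_off ->].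
  by apply: le_trans (f_le1 _) _; rewrite lerDl f_ge0.
by rewrite add0r.
Qed.

Lemma hit_pair_vertex v :
  V * percE p (fun S => f (n S v) * hits S) = percE p (fun S => hits S ^+ 2).
Proof.
rewrite (@percE_eq _ _ p (fun S => hits S ^+ 2) (fun S => \sum_v f (n S v) * hits S)); last first.
  by move=> S _; rewrite expr2 -mulr_suml.
rewrite percE_sum (eq_bigr (fun=> percE p (fun S => f (n S v) * hits S))).
  by rewrite sumr_const -[RHS]mulr_natl.
move=> w _; apply: (percE_vertex trG p w v (H := fun S x => f (n S x) * hits S)).
move=> s S z; rewrite card_cluster_move; congr (_ * _).
rewrite /hits (reindex_inj (@perm_inj _ s)) /=; apply: eq_bigr => x _.
by rewrite card_cluster_move.
Qed.

(* what the bond [uv] adds to [hits] when the cluster of [v] is hit and that of [u] is not *)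
Let A (S : config G) u v : R := (~~ connected_in S u v)%:R * ((n S u)%:R * (g ^+ n S u * f (n S v))).

Lemma hits_add S u v : hits ([set u; v] |: S) ^+ 2 - hits S ^+ 2
  <= (2 * hits S * A S u v + 2 * A S u v ^+ 2) + (2 * hits S * A S v u + 2 * A S v u ^+ 2).
Proof.
have e : hits ([set u; v] |: S) = hits S + (A S u v + A S v u).
  apply/eqP; rewrite addrC -subr_eq /hits (merge_sum f) /A (conn_symE S v u) /f exprD.
  apply/eqP; move: (g ^+ n S u) (g ^+ n S v) ((n S u)%:R : R) ((n S v)%:R : R) => x y a b.
  by move: (_%:R : R) => z; ring.
rewrite {}e; move: (hits S) (A S u v) (A S v u) => y a b.
have := sqr_ge0 (a - b); rewrite !expr2; lra.
Qed.

(** Only a bond between a hit and an unhit cluster changes the number of pairs of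
    hit vertices; merging two hit clusters does not.  Hence this number, unlike
    the susceptibility, satisfies a linear differential inequality. *)
Lemma hit_pairs_derive_le :
  (1 - p) * dpercE p (fun S => hits S ^+ 2)
  <= Omega%:R * (2 * percE p (fun S => kw g (n S o)) * percE p (fun S => hits S ^+ 2)
     + 4 * V * percE p (fun S => (n S o)%:R ^+ 2 * g ^+ n S o) * mag o p g).
Proof.
set K := percE p (fun S => kw g _); set Q := percE p (fun S => hits S ^+ 2).
set K2 := percE p (fun S => _ * _).
have V0 : 0 < V by apply: card_gt0R o.
pose T u v := percE p (fun S => 2 * hits S * A S u v + 2 * A S u v ^+ 2).
apply: (@le_trans _ _ (\sum_u \sum_(v | adj u v) T u v)).
  rewrite russo_percE -ler_pdivlMl ?invr_gt0 ?ltr0n // invrK mulr_natl mulr2n.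
  rewrite {2}(sum_adj_sym T) -big_split /=; apply: ler_sum => u _.
  rewrite -big_split /=; apply: ler_sum => v _; rewrite /T -percED.
  by apply: percE_le => // S _; apply: hits_add.
have -> : Omega%:R * (2 * K * Q + 4 * V * K2 * mag o p g) =
    V * Omega%:R * (2 * K * (Q / V) + 4 * (K2 * mag o p g)).
  by move: (lt0r_neq0 V0) => Vn; field.
rewrite -(sum_adj_const degG); apply: ler_sum => u _; apply: ler_sum => v _.
pose L S := 2 * (kw g #|cluster S u| * (f (n (off S (cluster S u)) v) * hits (off S (cluster S u))))
   + 4 * ((~~ connected_in S u v)%:R * ((n S u)%:R ^+ 2 * g ^+ n S u * f (n S v))).
apply: (@le_trans _ _ (percE p L)).
  apply: percE_le => // S _; rewrite /L /A.
  case: (boolP (connected_in S u v)) => [_|/cluster_off e].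
    rewrite !mul0r expr0n /= !mulr0 !addr0; by rewrite mulr_ge0 // !mulr_ge0 ?exprn_ge0.
  rewrite e !mul1r /kw.
  have hs := hits_split S u.
  have gg : 0 <= g ^+ n S u by rewrite exprn_ge0.
  have gl : g ^+ n S u <= 1 by rewrite exprn_ile1.
  have fg := f_ge0 (n S v); have fl := f_le1 (n S v).
  move: hs gg gl fg fl; move: (hits S) (hits (off S (cluster S u))) (g ^+ n S u) (f (n S v)) => Y Y' x y.
  have := ler0n R (n S u); move: ((n S u)%:R : R) => a a0 hs x0 x1 y0 y1.
  have xy0 : 0 <= x * y by rewrite mulr_ge0.
  have axy0 : 0 <= a * (x * y) by rewrite mulr_ge0.
  have h1 : Y * (a * (x * y)) <= (a + Y') * (a * (x * y)) by rewrite ler_wpM2r.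
  have h2 : (a * (x * y)) * (a * (x * y)) <= (a * (x * y)) * a.
    rewrite ler_wpM2l // ler_piMr // mulr_ile1 //.
  rewrite !expr2; lra.
rewrite /L percED !percEZ lerD //.
  rewrite -mulrA ler_wpM2l //.
  have F0 (B : {set G}) : 0 <= kw g #|B| by apply: kw_ge0.
  have mH : monotone (fun S => f (n S v) * hits S).
    move=> S S' sS; apply: ler_pM; first exact: f_ge0.
    - exact: hits_ge0.
    - exact/f_mono/card_mono.
    - exact: hits_mono.
  apply: le_trans (@explore_mono_le R G p p01 u (fun B => kw g #|B|) _ F0 mH) _.
  rewrite (percE_card o trG p (kw g) u) -/K /Q -(hit_pair_vertex v).
  by rewrite mulrAC divff ?mul1r // lt0r_neq0.
rewrite ler_wpM2l //.
have F0 m : 0 <= m%:R ^+ 2 * g ^+ m :> R by rewrite mulr_ge0 ?exprn_ge0.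
exact: (two_clusters_le o trG p01 u v F0 f_ge0 f_mono).
Qed.

(** A pair of hit vertices is either in one cluster, which [chi] counts, or in two
    clusters, which are negatively correlated. *)
Lemma hit_pairs_le_chi :
  percE p (fun S => hits S ^+ 2) <= V * chi o p + (V * mag o p g) ^+ 2.
Proof.
apply: (@le_trans _ _ (\sum_x \sum_y percE p (fun S => (connected_in S x y)%:R
    + (~~ connected_in S x y)%:R * (f (n S x) * f (n S y))))).
  under eq_bigr do rewrite -percE_sum.
  rewrite -percE_sum; apply: percE_le => // S _.
  rewrite /hits expr2 mulr_suml; apply: ler_sum => x _; rewrite mulr_sumr.
  apply: ler_sum => y _; case: connected_in; last by rewrite mul1r add0r.
  by rewrite mul0r addr0 mulr_ile1 //; [exact: f_ge0|exact: f_ge0|exact: f_le1|exact: f_le1].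
have -> : V * chi o p + (V * mag o p g) ^+ 2
   = \sum_(x : G) (chi o p + \sum_(y : G) mag o p g ^+ 2).
  rewrite !sumr_const -[RHS]mulr_natl -[mag o p g ^+ 2 *+ _]mulr_natl.
  by rewrite exprMn expr2; ring.
apply: ler_sum => x _; rewrite -(sum_tau o trG p x) -big_split /=.
apply: ler_sum => y _; rewrite percED tauE lerD2l expr2.
exact: (two_clusters_le o trG p01 x y f_ge0 f_ge0 f_mono).
Qed.

(** Let two independent sets of density [1 - g] fall on the cluster of [o]: if one of
    them misses it, its size is counted by [kw]; otherwise all pairs of vertices of
    the cluster are pairs of hit vertices. *)
Lemma chi_le_hit_pairs :
  V * chi o p <= V * (2 * percE p (fun S => kw g (n S o))) + percE p (fun S => hits S ^+ 2).
Proof.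
apply: (@le_trans _ _ (V * percE p (fun S => 2 * kw g (n S o) + (n S o)%:R * f (n S o) ^+ 2))).
  rewrite ler_wpM2l //; apply: percE_le => // S _; rewrite /kw /f.
  have : 0 <= (n S o)%:R * (g ^+ n S o) ^+ 2 by rewrite mulr_ge0 // sqr_ge0.
  move: (g ^+ n S o) ((n S o)%:R : R) => x a; rewrite !expr2; lra.
rewrite percED percEZ mulrDr lerD2l.
rewrite -(sum_vertices o trG p (fun m => m%:R * f m ^+ 2)); apply: percE_le => // S _.
rewrite /hits [leRHS]expr2 mulr_suml; apply: ler_sum => x _.
rewrite card_clusterE mulr_suml mulr_sumr; apply: ler_sum => y _.
case: (boolP (connected_in S x y)) => [/cluster_eq <-|_]; first by rewrite mul1r expr2.
by rewrite mul0r mulr_ge0 // f_ge0.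
Qed.

End HitPairs.

(** * Arithmetic of the three-branch estimate *)

Section Arithmetic.
Variable R : realType.
Implicit Types (X c p : R).

Lemma falling_lower (O p : R) : p <= 1000^-1 -> 97 / 100 <= O * p -> 0 <= p ->
  9 / 10 <= O * (O - 1) * (O - 2) * p ^+ 3.
Proof.
move=> p1; have -> : O * (O - 1) * (O - 2) * p ^+ 3 =
  (O * p) * ((O * p - p) * (O * p - 2 * p)) by ring.
move: (O * p) => y y1 p0.
have h1 : 96 / 100 <= y - p by lra.
have h2 : 967 / 1000 <= y - 2 * p by lra.
have n0 (a b : nat) : 0 <= a%:R / b%:R :> R by rewrite divr_ge0.
have h3 := ler_pM (n0 96 100) (n0 967 1000) h1 h2.
have := ler_pM (n0 97 100) (mulr_ge0 (n0 96 100) (n0 967 1000)) y1 h3.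
by apply: le_trans; clear; lra.
Qed.

Lemma falling_pow_lower (x y : R) : 24 / 100 <= x -> 9 / 10 <= y -> 216 / 1000 <= y * x.
Proof.
move=> hx hy; have : 9 / 10 * (24 / 100) <= y * x by apply: ler_pM => //; rewrite divr_ge0.
by apply: le_trans; clear; lra.
Qed.

Lemma degree_lower (O p : R) : 97 / 100 <= O * p -> p <= 1000^-1 -> 0 <= O -> 2 < O.
Proof.
move=> Op p1 O0; have : O * p <= O * 1000^-1 by rewrite ler_wpM2l.
by move: Op; clear; lra.
Qed.

Lemma cubic_lower (X eta a0 : R) : 0 <= X -> a0 <= 1000^-1 -> X / 2 <= eta ->
  119 / 1000 * X ^+ 3 <= eta ^+ 3 - 6 * a0 * X ^+ 3.
Proof.
move=> X0 a1 eta2; have X3 : 0 <= X ^+ 3 by rewrite exprn_ge0.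
have h1 : X ^+ 3 / 8 <= eta ^+ 3.
  have -> : X ^+ 3 / 8 = (X / 2) ^+ 3 by field.
  have h : 0 <= X / 2 by rewrite divr_ge0.
  by rewrite lerXn2r ?nnegrE // (le_trans h).
have h2 : a0 * X ^+ 3 <= 1000^-1 * X ^+ 3 by rewrite ler_wpM2r.
move: h1 h2; clear; move: (X ^+ 3) (eta ^+ 3) => x e; lra.
Qed.

Lemma inv_sqr_le (X : R) : 50 <= X -> 0 < X ^- 2 <= 2500^-1.
Proof.
move=> X50; have X0 : 0 < X by lra.
rewrite invr_gt0 exprn_gt0 //= lef_pV2 ?posrE ?exprn_gt0 //.
have -> : 2500 = 50 * 50 :> R by ring.
by rewrite expr2 ler_pM.
Qed.

Lemma second_moment_arith (X c K B N2 : R) : 0 <= X -> 0 < c -> c <= 2500^-1 ->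
  c * X ^+ 2 = 1 -> 216 / 1000 <= K -> 119 / 1000 * X ^+ 3 <= B ->
  (1 - c) * (K * B) <= N2 -> X / 50 <= c * N2.
Proof.
move=> X0 c0 c1 cX hK hB hN.
have X3 : 0 <= 119 / 1000 * X ^+ 3 by rewrite mulr_ge0 ?exprn_ge0 // divr_ge0.
have k0 : (0 : R) <= 216 / 1000 by rewrite divr_ge0.
have h1 := ler_pM k0 X3 hK hB.
have h2 : 999 / 1000 * (216 / 1000 * (119 / 1000 * X ^+ 3)) <= N2.
  apply: le_trans hN; apply: ler_pM => //; first by rewrite divr_ge0.
    by rewrite mulr_ge0.
  by move: c1; clear; lra.
have h3 : c * (999 / 1000 * (216 / 1000 * (119 / 1000 * X ^+ 3))) <= c * N2.
  by rewrite ler_wpM2l // ltW.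
apply: le_trans h3; have -> : c * (999 / 1000 * (216 / 1000 * (119 / 1000 * X ^+ 3)))
  = (c * X ^+ 2) * (999 / 1000 * (216 / 1000 * (119 / 1000 * X))) by ring.
rewrite cX; move: X0; clear; lra.
Qed.

Lemma deficit_arith (X c D2 M : R) : 0 < X -> 0 < c -> c <= 2500^-1 ->
  X / 50 <= D2 -> M <= c * X -> c * (D2 - M) <= 2 * (c * X - M) ->
  M <= 991 / 1000 * (c * X).
Proof.
move=> X0 c0 c1 hD hM h.
have h1 : c * (X / 50 - c * X) <= c * (D2 - M).
  by rewrite ler_wpM2l ?(ltW c0) // lerB.
have h2 : c * (c * X) <= 2500^-1 * (c * X).
  by rewrite ler_wpM2r // mulr_ge0 // ltW.
have h3 : 0 <= c * X by rewrite mulr_ge0 // ltW.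
move: h h1 h2 h3; clear; lra.
Qed.

Lemma subcritical_arith (Xi p y a0 : R) : 0 <= Xi -> Xi <= 50^-1 -> 0 <= p ->
  p <= 1000^-1 -> a0 <= 1000^-1 -> 1 <= Xi + y / (1 - p) -> (1 - a0) * y <= 1 - Xi ->
  97 / 100 <= y /\ y <= 101 / 100.
Proof.
move=> Xi0 Xi1 p0 p1 a1 h1 h2.
have q0 : 0 < 1 - p by lra.
have h3 : (1 - Xi) * (1 - p) <= y by rewrite -ler_pdivlMr //; lra.
have h4 : 49 / 50 * (999 / 1000) <= (1 - Xi) * (1 - p).
  by apply: ler_pM; rewrite ?divr_ge0 //; [move: Xi1|move: p1]; clear; lra.
have y1 : 97 / 100 <= y by move: h3 h4; clear; lra.
split=> //; have h5 : 999 / 1000 * y <= (1 - a0) * y.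
  apply: ler_wpM2r; first by apply: le_trans y1; rewrite divr_ge0.
  by move: a1; clear; lra.
by move: h2 h5 Xi0; clear; lra.
Qed.

Lemma extrapolation_arith (s y e a0 : R) : 0 < s -> 0 <= y -> 0 <= e -> a0 <= 1000^-1 ->
  (1 - a0) * y <= 18 * s - e ->
  y * (991 / 1000 * (18 * s)) <= (1 - 1000^-1) * (324 * s ^+ 2 - s ^+ 2).
Proof.
move=> s0 y0 e0 a1 h.
have h1 : 999 / 1000 * y <= (1 - a0) * y.
  by apply: ler_wpM2r => //; move: a1; clear; lra.
have h2 : 999 / 1000 * y <= 18 * s by move: h h1 e0; clear; lra.
have h3 : (999 / 1000 * y) * s <= (18 * s) * s by rewrite ler_wpM2r // ltW.
by rewrite expr2; move: h3 (mulr_gt0 s0 s0); clear; lra.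
Qed.

Lemma deficit_vs_critical (s : R) : 0 < s -> 991 / 1000 * (18 * s) <= 1000 * s.
Proof. lra. Qed.

Lemma small_sqr (s : R) : 0 < s -> 1000 * s < 1 -> 324 * s ^+ 2 <= 1.
Proof.
move=> s0 s1; have : s * (1000 * s) <= s * 1 by rewrite ler_wpM2l // ltW.
by rewrite expr2; move: s1 (mulr_gt0 s0 s0); clear; lra.
Qed.

End Arithmetic.

(** * The magnetization at criticality *)

Section Critical.
Variables (R : realType) (G : sgraph) (o : G) (Omega : nat).
Hypothesis trG : vertex_transitive G.
Hypothesis degG : forall x : G, degree x = Omega.
Implicit Types (p q s : R) (S : config G) (u v x y : G).

Local Notation V := (#|G|%:R : R).
Local Notation n S x := #|cluster S x|.

Lemma percE_bond p (b : {set G}) : b \in bonds G -> percE p (fun S => (b \in S)%:R) = p.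
Proof.
move=> bB; pose w (c : {set G}) (i : bool) : R := if c == b then i%:R else 1.
rewrite (@percE_eq _ _ _ _ (fun S => \prod_(c <- enum (bonds G)) w c (c \in S))); last first.
  move=> S _; rewrite (bigD1_seq b) ?mem_enum ?enum_uniq //= /w eqxx.
  by rewrite big1 ?mulr1 // => c /negbTE ->.
rewrite percEE bern_prod ?enum_uniq // (bigD1_seq b) ?mem_enum ?enum_uniq //=.
rewrite /w eqxx big1 => [|c /negbTE ->]; last by ring.
by rewrite !mulr1 mulr0 addr0.
Qed.

Lemma tau_adj_ge p u v : 0 <= p <= 1 -> adj u v -> p <= tau p u v.
Proof.
move=> p01 uv; have bB : [set u; v] \in bonds G by apply/imsetP; exists (u, v); rewrite ?inE.
rewrite -[leLHS](percE_bond p bB) tauE; apply: percE_le => // S _.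
by rewrite ler_nat; case: (boolP (_ \in S)) => // /conn1 ->.
Qed.

Lemma pow_lower p : 0 <= p -> p <= 1000^-1 -> Omega%:R * p <= 101 / 100 ->
  24 / 100 <= (1 - p) ^+ Omega.
Proof.
move=> p0 p1 Op; have p01 : 0 <= p <= 1 by rewrite p0 /=; lra.
pose m := (Omega./2).+1.
have hm : (Omega <= m * 2)%N.
  by rewrite /m -[leqLHS]odd_double_half -muln2 mulSn leq_add2r; case: odd.
have m2 : m%:R * 2 <= Omega%:R + 2 :> R.
  rewrite -natrM -natrD ler_nat /m mulSn addnC leq_add2r muln2.
  by rewrite -[leqRHS]odd_double_half leq_addl.
have mp : 2 * (m%:R * p) <= Omega%:R * p + 2 * p.
  by rewrite mulrA -mulrDl ler_wpM2r // mulrC.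
have h := hit_le p01 m.
apply: (@le_trans _ _ ((1 - p) ^+ (m * 2))); last first.
  by apply: ler_wiXn2l => //; lra.
rewrite exprM.
have h2 : 493 / 1000 <= (1 - p) ^+ m by lra.
apply: (@le_trans _ _ ((493 / 1000) ^+ 2)); first by rewrite expr2; lra.
by rewrite lerXn2r ?nnegrE //; lra.
Qed.

(** Since the second moment is of order [chi ^ 3], a definite proportion of [chi]
    comes from clusters of size comparable with [chi ^ 2], so that a set of density
    [chi ^ -2] hits noticeably less often than the union bound [1 / chi] says. *)
Lemma mag_deficit p (a0 : R) : 0 <= p -> p <= 1000^-1 -> a0 <= 1000^-1 ->
  (forall x y : G, x != y -> triangle p x y <= a0) ->
  50 <= chi o p -> 97 / 100 <= Omega%:R * p -> Omega%:R * p <= 101 / 100 ->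
  mag o p (1 - (chi o p) ^- 2) <= 991 / 1000 / chi o p.
Proof.
move=> p0 p1 a1 tri; set X := chi o p => X50 Op1 Op2.
have p2 : 0 <= p <= 2^-1 by rewrite p0 /=; lra.
have p01 := half_le1 p2.
have X0 : 0 < X by lra.
have /andP[c0 c1] := inv_sqr_le X50; set c := X ^- 2 in c0 c1 *.
have cX2 : c * X ^+ 2 = 1 by rewrite /c mulVf // expf_neq0 // lt0r_neq0.
have c01 : 0 <= c <= 1 by rewrite ltW //=; lra.
set g := 1 - c; have g01 : 0 <= g <= 1 by rewrite /g; lra.
set M := mag o p g.
pose eta := percE p (fun S => kw g (n S o)).
pose N2 := percE p (fun S => (n S o)%:R ^+ 2 * g ^+ n S o).
pose D2 := percE p (fun S => (n S o)%:R * (1 - g ^+ n S o)).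
have D2E : D2 = X - eta.
  by rewrite /D2 /X /chi -percEB; apply: percE_eq => S _; rewrite /kw mulrBr mulr1.
have hN2 : c * N2 <= D2.
  rewrite -percEZ; apply: percE_le => // S _; have := kw_hit_le c01 (n S o).
  rewrite -/g /kw => h; rewrite expr2 -mulrA mulrCA ler_wpM2l //.
have MX : M <= c * X.
  by rewrite -percEZ; apply: percE_le => // S _; rewrite mulrC; apply: hit_le.
have hD : c * (D2 - M) <= 2 * (c * X - M).
  rewrite -percEB -percEZ -percEZ -percEB -percEZ; apply: percE_le => // S _.
  have := hit_deficit c01 (n S o); rewrite -/g; clear.
  by move: (g ^+ n S o) ((n S o)%:R : R) => x m; rewrite mulrBl mul1r [m * c]mulrC.
have D2X : X / 50 <= D2.
  have [eta2|/ltW eta2] := leP eta (X / 2).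
    by rewrite D2E; move: eta2 X0; clear; lra.
  have O2 : (2 < Omega)%N.
    by rewrite -(ltr_nat R); apply: degree_lower Op1 p1 _.
  have hs := second_moment_lower o trG degG p2 g01 O2 tri.
  apply: le_trans hN2; apply: (@second_moment_arith R X c (Omega%:R * (Omega%:R - 1) *
    (Omega%:R - 2) * p ^+ 3 * (1 - p) ^+ Omega) (eta ^+ 3 - 6 * a0 * X ^+ 3)) => //.
  - exact: ltW.
  - exact: falling_pow_lower (pow_lower p0 p1 Op2) (falling_lower p1 Op1 p0).
  - by apply: cubic_lower => //; apply: ltW.
  by move: hs; rewrite -/g -/X -/eta -/N2 !mulrA.
have -> : 991 / 1000 / X = 991 / 1000 * (c * X).
  by rewrite /c; move: (lt0r_neq0 X0) => Xn; field.
exact: deficit_arith D2X MX hD.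
Qed.

Section AtCritical.
Variables (pc a0 : R).
Hypothesis pc0 : 0 <= pc.
Hypothesis pc1 : pc <= 1000^-1.
Hypothesis a01 : a0 <= 1000^-1.
Hypothesis tri : forall x y : G, x != y -> triangle pc x y <= a0.

(** A subcritical [p] with [chi p = X] is at distance at most about
    [1 / (Omega * X)] below [pc]; the deficit of the magnetization at [p] pays for
    extrapolating it to [pc] along a characteristic. *)
Lemma mag_critical s : 0 <= s -> s <= 1 -> mag o pc (1 - s ^+ 2) <= 1000 * s.
Proof.
move=> s0 s1; have pcb := pc1; have a0b := a01; have pcn := pc0.
have pc01 : 0 <= pc <= 1 by rewrite pc0 /=; lra.
have s2 : 0 <= s ^+ 2 <= 1 by rewrite exprn_ge0 // exprn_ile1.
have s2' : 0 <= 1 - s ^+ 2 <= 1 by lra.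
have [hs|hs] := leP 1 (1000 * s).
  by apply: le_trans hs; apply: mag_le1.
have hX : s ^+ 2 * chi o pc <= s / 18 -> mag o pc (1 - s ^+ 2) <= 1000 * s.
  move=> h; apply: (@le_trans _ _ (s ^+ 2 * chi o pc)); last by lra.
  by rewrite -percEZ; apply: percE_le => // S _; rewrite mulrC; apply: hit_le.
move: s0; rewrite le_eqVlt => /predU1P[s0|s0].
  by apply: hX; rewrite -s0 expr0n /= !mul0r.
have [hXc|hXc] := leP (chi o pc) (18 * s)^-1.
  apply: hX; rewrite expr2 -mulrA ler_wpM2l ?(ltW s0) //.
  apply: (@le_trans _ _ (s * (18 * s)^-1)); first by rewrite ler_wpM2l // ltW.
  by rewrite invfM mulrCA divff ?mulr1 // lt0r_neq0.
(* [18] is large enough for [991 / 1000 * 18 ^ 2 < 18 ^ 2 - 1]: the density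
   [(18 * s) ^ 2] at [p] exceeds [s ^ 2] by more than the extrapolation costs. *)
set X := (18 * s)^-1 in hXc.
have s18 : 0 < 18 * s by lra.
have Xs : X * (18 * s) = 1 by rewrite /X mulVf // lt0r_neq0.
have X50 : 50 <= X.
  rewrite -(ler_pM2r s18) Xs; lra.
have X1 : 1 <= X by lra.
have [p /andP[pp0 ppc] pX] := chi_ivt pc01 X1 (ltW hXc).
have tri' x y : x != y -> triangle p x y <= a0.
  move=> xy; apply: le_trans (tri xy); apply: triangle_mono => //; lra.
have X0 : 0 < X by lra.
have XV : X^-1 <= 50^-1 by rewrite lef_pV2 ?posrE.
have XV0 : 0 < X^-1 by rewrite invr_gt0.
have p1 := le_trans ppc pcb; have p2 : p <= 2^-1 by move: p1; lra.
have pcl : pc <= 2^-1 by lra.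
have a1 : a0 <= 1 by lra.
have p11 : p < 1 by lra.
have h1 := inv_chi_le o trG degG (lexx 0) pp0 p11.
have h2 := inv_chi_ge o trG degG (lexx 0) pp0 p2 a1 tri'.
have h3 := inv_chi_ge o trG degG pp0 ppc pcl a1 tri.
rewrite !subr0 pX chi0 invr1 in h1 h2 h3; rewrite -!mulrA in h2 h3.
have [Op1 Op2] := subcritical_arith (ltW XV0) XV pp0 p1 a0b h1 h2.
have := @mag_deficit p a0 pp0 p1 a0b tri'; rewrite pX.
move=> /(_ X50 Op1 Op2) hm.
have Xi : X^-1 = 18 * s by rewrite /X invrK.
have X2 : X ^- 2 = 324 * s ^+ 2 by rewrite -exprVn Xi; ring.
have chi_inv0 : 0 <= (chi o pc)^-1 by rewrite invr_ge0 ltW // (lt_trans X0).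
have d0 : 0 <= Omega%:R * (pc - p) by rewrite mulr_ge0 // subr_ge0.
have ss : 0 <= s ^+ 2 by rewrite exprn_ge0 // ltW.
have p1lt : 1000^-1 < 1 :> R by rewrite invf_lt1 // ltr1n.
have s324 : s ^+ 2 <= 324 * s ^+ 2 by rewrite ler_peMl // ler1n.
rewrite X2 in hm.
have hK : Omega%:R * (991 / 1000 / X) * (pc - p) <= (1 - 1000^-1) * (324 * s ^+ 2 - s ^+ 2).
  rewrite Xi in h3 *; rewrite mulrAC; exact: extrapolation_arith s0 d0 chi_inv0 a0b h3.
apply: le_trans (mag_characteristic trG degG pp0 ppc pcb p1lt ss s324 (small_sqr s0 hs) hm hK) _.
by rewrite Xi; exact: deficit_vs_critical.
Qed.

End AtCritical.

(** * Tails of the cluster size *)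

Lemma P_geE p k : P_ge o k p = percE p (fun S => (k <= n S o)%N%:R).
Proof. by rewrite /P_ge percPE. Qed.

Lemma P_ge_mono p q k : 0 <= p -> p <= q -> q <= 1 -> P_ge o k p <= P_ge o k q.
Proof.
move=> *; rewrite !P_geE; apply: percE_mono_p => // S S' sS.
by rewrite ler_nat; case: (leqP k) => // /leq_trans /(_ (card_mono o sS)) ->.
Qed.

Lemma P_ge_le1 p k : 0 <= p <= 1 -> P_ge o k p <= 1.
Proof.
move=> p01; rewrite P_geE -[leRHS](@percE_cst R G p); apply: percE_le => // S _.
by rewrite lern1 leq_b1.
Qed.

(** A set of density [1 / k] hits a cluster of size [k] with probability at least
    one half. *)
Lemma P_ge_le_mag p k : 0 <= p <= 1 -> (0 < k)%N ->
  P_ge o k p <= 2 * mag o p (1 - k%:R^-1).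
Proof.
move=> p01 k0; have kR : 0 < k%:R :> R by rewrite ltr0n.
have c01 : 0 <= (k%:R^-1 : R) <= 1 by rewrite invr_ge0 ltW //= invf_le1 // ler1n.
rewrite P_geE -percEZ; apply: percE_le => // S _; case: leqP => [kn|_].
  by apply: hit_ge_half => //; rewrite ler_pdivlMr // mul1r ler_nat.
by rewrite mulr_ge0 //; apply: hit_ge0.
Qed.

(** If [chi] is a large multiple of [sqrt k], clusters smaller than [k] contribute
    at most half of it, and the second-moment method bounds the rest. *)
Lemma P_ge_lower p k (r : R) : 0 <= p <= 2^-1 -> 0 < r -> r ^+ 2 = k%:R ->
  mag o p (1 - k%:R^-1) <= 1000 / r -> chi o p = 4000 * r ->
  (16000 * r)^-1 <= P_ge o k p.
Proof.
move=> p2 r0 rk hm hX; have p01 := half_le1 p2.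
have kR : 0 < k%:R :> R by rewrite -rk exprn_gt0.
have k0 : (0 < k)%N by rewrite -(ltr_nat R).
have c01 : 0 <= (k%:R^-1 : R) <= 1 by rewrite invr_ge0 ltW //= invf_le1 // ler1n.
set X := chi o p in hX *; have X0 : 0 < X by rewrite hX mulr_gt0.
pose P := P_ge o k p.
have key : X <= 2 * k%:R * mag o p (1 - k%:R^-1) + (4 * X ^+ 2)^-1 * X ^+ 3 + X ^+ 2 * P.
  have h2 := second_moment_le o trG p2.
  apply: (@le_trans _ _ (2 * k%:R * mag o p (1 - k%:R^-1)
    + (4 * X ^+ 2)^-1 * percE p (fun S => (n S o)%:R ^+ 2) + X ^+ 2 * P)); last first.
    by rewrite lerD2r lerD2l ler_wpM2l // invr_ge0 mulr_ge0 // exprn_ge0 // ltW.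
  rewrite /P P_geE /mag -!percEZ -!percED {1}/X /chi; apply: percE_le => // S _.
  have f0 : (0 : R) <= 1 - (1 - k%:R^-1) ^+ n S o.
    exact: hit_ge0.
  case: leqP => [kn|nk]; last first.
    rewrite mulr0 addr0; apply: (@le_trans _ _ (2 * k%:R * (1 - (1 - k%:R^-1) ^+ n S o))).
      have := @hit_half_lower R k%:R^-1 c01 (n S o).
      rewrite ler_pdivrMr // mul1r ler_nat => /(_ (ltnW nk)).
      by rewrite ler_pdivrMr // mulrAC.
    by rewrite lerDl mulr_ge0 ?sqr_ge0 // invr_ge0 mulr_ge0 // exprn_ge0 // ltW.
  rewrite mulr1.
  apply: (@le_trans _ _ ((4 * X ^+ 2)^-1 * (n S o)%:R ^+ 2 + X ^+ 2)); last first.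
    by rewrite lerD2r lerDr mulr_ge0 // mulr_ge0.
  move: ((n S o)%:R : R) => a; have X2 : 0 < X ^+ 2 by rewrite exprn_gt0.
  rewrite -subr_ge0; have -> : (4 * X ^+ 2)^-1 * a ^+ 2 + X ^+ 2 - a
     = (4 * X ^+ 2)^-1 * (a - 2 * X ^+ 2) ^+ 2.
    by move: (lt0r_neq0 X0) => Xn; field.
  by rewrite mulr_ge0 ?sqr_ge0 // invr_ge0 mulr_ge0 // ltW.
have e1 : (4 * X ^+ 2)^-1 * X ^+ 3 = X / 4.
  by move: (lt0r_neq0 X0) => Xn; field.
have h1 : 2 * k%:R * mag o p (1 - k%:R^-1) <= X / 2.
  apply: (@le_trans _ _ (2 * k%:R * (1000 / r))).
    by rewrite ler_wpM2l // mulr_ge0 // ltW.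
  rewrite -rk hX; have -> : 2 * r ^+ 2 * (1000 / r) = 2000 * r.
    by move: (lt0r_neq0 r0) => rn; field.
  lra.
have : X / 4 <= X ^+ 2 * P by rewrite e1 in key; lra.
rewrite expr2 -mulrA ler_pM2l // mulrC.
have -> : 16000 * r = 4 * X by rewrite hX; lra.
by rewrite invfM -/P ler_pdivrMr.
Qed.

(** Second-moment method for the number of vertices in clusters of size at least [k]:
    vertices in different clusters are negatively correlated, those in the same
    cluster contribute [chi]. *)
Lemma small_max_cluster p k : 0 <= p <= 1 -> 0 < P_ge o k p ->
  percE p (fun S => (max_cluster_size S < k)%N%:R) <= chi o p / (V * P_ge o k p ^+ 2).
Proof.
move=> p01 P0; have V0 : 0 < V by apply: card_gt0R o.
set P := P_ge o k p in P0 *; pose F (m : nat) : R := (k <= m)%N%:R.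
pose Z S := \sum_x F (n S x).
have EZ : percE p Z = V * P by rewrite (sum_vertices o trG p F) -P_geE.
have F0 m : 0 <= F m by [].
have Fm m m' : (m <= m')%N -> F m <= F m'.
  by move=> mm; rewrite ler_nat; case: (leqP k) => // /leq_trans /(_ mm) ->.
have EZ2 : percE p (fun S => Z S ^+ 2) <= V * chi o p + (V * P) ^+ 2.
  apply: (@le_trans _ _ (\sum_x \sum_y percE p (fun S => (connected_in S x y)%:R
      + (~~ connected_in S x y)%:R * (F (n S x) * F (n S y))))).
    under eq_bigr do rewrite -percE_sum.
    rewrite -percE_sum; apply: percE_le => // S _.
    rewrite /Z expr2 mulr_suml; apply: ler_sum => x _; rewrite mulr_sumr.
    apply: ler_sum => y _; case: connected_in; last by rewrite mul1r add0r.
    by rewrite mul0r addr0 -natrM lern1 mulnb leq_b1.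
  have -> : V * chi o p + (V * P) ^+ 2 = \sum_(x : G) (chi o p + \sum_(y : G) P ^+ 2).
    rewrite !sumr_const -[RHS]mulr_natl -[P ^+ 2 *+ _]mulr_natl.
    by rewrite exprMn expr2; ring.
  apply: ler_sum => x _; rewrite -(sum_tau o trG p x) -big_split /=.
  apply: ler_sum => y _; rewrite percED tauE lerD2l expr2 /P P_geE.
  exact: (two_clusters_le o trG p01 x y F0 F0 Fm).
have : (V * P) ^+ 2 * percE p (fun S => (max_cluster_size S < k)%N%:R) <= V * chi o p.
  apply: (@le_trans _ _ (percE p (fun S => (Z S ^+ 2 + (V * P) ^+ 2) - 2 * (V * P) * Z S))); last first.
    rewrite percEB percED percE_cst percEZ EZ; move: EZ2; rewrite expr2; lra.
  rewrite -percEZ; apply: percE_le => // S _.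
  have -> : Z S ^+ 2 + (V * P) ^+ 2 - 2 * (V * P) * Z S = (Z S - V * P) ^+ 2 by ring.
  case: ltnP => [hk|_]; last by rewrite mulr0 sqr_ge0.
  have -> : Z S = 0.
    apply: big1 => x _; rewrite /F leqNgt; case: ltnP => // kx; move: hk.
    by rewrite ltnNge (leq_trans kx) //; apply: (leq_bigmax x).
  by rewrite sub0r sqrrN mulr1.
have VP2 : 0 < V * P ^+ 2 by rewrite mulr_gt0 // exprn_gt0.
move=> h; rewrite ler_pdivlMr // -(ler_pM2l V0); apply: le_trans h.
by rewrite le_eqVlt; apply/orP; left; apply/eqP; ring.
Qed.

Lemma max_cluster_sqr S : (max_cluster_size S)%:R ^+ 2 <= \sum_x (n S x)%:R :> R.
Proof.
have [x ->] : exists x, max_cluster_size S = n S x.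
  have G0 : (0 < #|G|)%N by apply/card_gt0P; exists o.
  by have [x e] := bigop.eq_bigmax (fun x => n S x) G0; exists x.
rewrite expr2 {1}card_clusterE mulr_suml; apply: ler_sum => y _.
case: (boolP (connected_in S x y)) => [/cluster_eq ->|_]; first by rewrite mul1r.
by rewrite mul0r.
Qed.

Lemma max_cluster_moment p : 0 <= p <= 1 ->
  percE p (fun S : config G => (max_cluster_size S)%:R ^+ 2) <= V * chi o p.
Proof.
move=> p01; rewrite -(sum_vertices o trG p (fun m => m%:R)).
by apply: percE_le => // S _; apply: max_cluster_sqr.
Qed.

End Critical.

(** * The scaling window *)

Lemma characteristic_arith (R : realFieldType) (s z : R) :
  s * z <= s * (4000^-1 * s) -> 0 < s * s ->
  2000 * (s * z) <= (1 - 2^-1) * (2 * s * (2 * s) - s * s).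
Proof. lra. Qed.

Lemma hit_pairs_arith (R : realFieldType) (d O w Q v : R) :
  2^-1 * d <= O * (2 * w * Q + 4 * v * (2 * (w * w))) ->
  d <= 4 * O * w * (Q + 4 * v * w).
Proof. lra. Qed.

Section Window.
Variables (R : realType) (G : sgraph) (o : G) (Omega : nat).
Hypothesis trG : vertex_transitive G.
Hypothesis degG : forall x : G, degree x = Omega.
Variables (pc a0 lambda Lambda v : R).
Hypothesis Omega_gt0 : (0 < Omega)%N.
Hypothesis pc0 : 0 <= pc.
Hypothesis pc1 : pc <= 1000^-1.
Hypothesis a01 : a0 <= 1000^-1.
Hypothesis tri : triangle_condition G pc a0.
Hypothesis lambda0 : 0 < lambda.
Hypothesis Lambda0 : 0 <= Lambda.
Hypothesis v0 : 0 < v.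
Hypothesis Vv : #|G|%:R = v ^+ 3.
Hypothesis chi_pc : chi o pc = lambda * v.

Local Notation V := (#|G|%:R : R).
Local Notation n S x := #|cluster S x|.

Let tri' (x y : G) : x != y -> triangle pc x y <= a0.
Proof. by move=> xy; have := tri x y; rewrite (negbTE xy) add0r. Qed.

Let pc01 : 0 <= pc <= 1.
Proof. by rewrite pc0 (le_trans pc1) // invf_le1 // ler1n. Qed.

Let pc2 : 0 <= pc <= 2^-1.
Proof. by rewrite pc0 (le_trans pc1) // lef_pV2 ?posrE // ler_nat. Qed.

(** The triangle sums to [chi ^ 3], so the triangle condition bounds [chi] by the
    cube root of the volume, whatever [lambda] is. *)
Lemma chi_critical_le : chi o pc <= 2 * v.
Proof.
have h : chi o pc ^+ 3 <= 1 + a0 * V.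
  rewrite -(sum_triangle o trG pc o).
  apply: (@le_trans _ _ (\sum_(y : G) ((o == y)%:R + a0))).
    by apply: ler_sum => y _; apply: tri.
  rewrite big_split /= sumr_const -[a0 *+ _]mulr_natr lerD2r (bigD1 o) //= eqxx big1 ?addr0 //.
  by move=> y; rewrite eq_sym => /negbTE ->.
have V1 : 1 <= V by rewrite ler1n; apply/card_gt0P; exists o.
have h2 : chi o pc ^+ 3 <= (2 * v) ^+ 3.
  rewrite exprMn -Vv; apply: (le_trans h).
  have aV : a0 * V <= V.
    by rewrite ler_piMl // (le_trans a01) // invf_le1 ?ler1n // ltr0n.
  apply: (@le_trans _ _ (V *+ 2)); first by rewrite mulr2n lerD.
  by rewrite -[leLHS]mulr_natl ler_wpM2r // -natrX ler_nat.
rewrite leNgt; apply/negP => h3; move: h2; rewrite leNgt => /negP; apply.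
have v2 : 0 <= 2 * v by rewrite mulr_ge0 // ltW.
by rewrite ltr_pXn2r // nnegrE (le_trans v2) // ltW.
Qed.

(** Going down from [pc], [1 / chi] grows with slope at most [Omega / (1 - pc)]. *)
Lemma chi_lower p : 0 <= p -> p <= 1 -> Omega%:R * (pc - p) <= Lambda / v ->
  (lambda^-1 + 2 * Lambda)^-1 * v <= chi o p.
Proof.
move=> p0 p1 hp; have p01 : 0 <= p <= 1 by rewrite p0.
have L0 : 0 < lambda^-1 + 2 * Lambda by rewrite ltr_wpDr ?invr_gt0 // mulr_ge0.
have c0 : 0 < chi o p by apply: chi_gt0.
suff h : (chi o p)^-1 <= (lambda^-1 + 2 * Lambda) / v.
  rewrite ler_pdivrMl //; move: h.
  by rewrite ler_pdivlMr // mulrC ler_pdivrMr // mulrC.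
have cpc : (chi o pc)^-1 = lambda^-1 / v by rewrite chi_pc invfM.
have Lv : 0 <= Lambda / v by rewrite divr_ge0 // ltW.
rewrite mulrDl -mulrA -cpc.
have [ppc|/ltW pcp] := leP p pc; last first.
  apply: (@le_trans _ _ (chi o pc)^-1); last by rewrite lerDl mulr_ge0.
  by rewrite lef_pV2 ?posrE ?chi_gt0 // chi_mono.
have pc1' : pc < 1 by apply: le_lt_trans pc1 _; rewrite invf_lt1 // ltr1n.
apply: le_trans (inv_chi_le o trG degG p0 ppc pc1') _; rewrite lerD2l.
rewrite ler_pdivrMr ?subr_gt0 //; apply: (le_trans hp).
have := pc2; move: (Lambda / v) Lv => y y0 /andP[_ pch].
have : y * pc <= y * 2^-1 by rewrite ler_wpM2l.
lra.
Qed.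

(** Within the window, the passage from [pc] to [t] along a characteristic lowers the
    density only from [4 * s ^+ 2] to [s ^+ 2]. *)
Lemma mag_window t (s : R) : 0 <= t -> Omega%:R * (t - pc) <= Lambda / v ->
  0 < s -> 2 * s <= 1 -> 4000 * (Lambda + 1) <= s * v ->
  t <= 2^-1 /\ mag o t (1 - s ^+ 2) <= 2000 * s.
Proof.
move=> t0 ht s0 s1 sv.
have [tpc|/ltW pct] := leP t pc.
  have tm : t <= 2^-1 by case/andP: pc2 => _ h; apply: le_trans h.
  split=> //; have s1' : s <= 1 by lra.
  have s2 : 0 <= 1 - s ^+ 2 <= 1.
    by rewrite subr_ge0 exprn_ile1 ?(ltW s0) //= lerBlDr lerDl exprn_ge0 // ltW.
  apply: le_trans (mag_mono_p o t0 tpc (proj2 (andP pc01)) s2) _.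
  apply: le_trans (mag_critical o trG degG pc0 pc1 a01 tri' (ltW s0) s1') _.
  by rewrite ler_wpM2r ?(ltW s0) // ler_nat.
have Lv : Lambda / v <= 4000^-1 * s.
  rewrite ler_pdivrMr // -mulrA ler_pdivlMl //; apply: le_trans sv.
  by rewrite ler_wpM2l // lerDl.
have O1 : t - pc <= Omega%:R * (t - pc).
  by rewrite ler_peMl ?subr_ge0 // ler1n.
have th : t <= 2^-1.
  have := pc1; move: O1 ht Lv s1; move: (Lambda / v) (Omega%:R * _) => y z; lra.
split=> //.
have s2 : s ^+ 2 <= (2 * s) ^+ 2.
  by rewrite lerXn2r ?nnegrE ?mulr_ge0 ?(ltW s0) // ler_peMl ?(ltW s0) // ler1n.
have s2' : (2 * s) ^+ 2 <= 1 by rewrite exprn_ile1 // mulr_ge0 // ltW.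
have h1 : (2^-1 : R) < 1 by rewrite invf_lt1 // ltr1n.
have hm := mag_critical o trG degG pc0 pc1 a01 tri' (_ : 0 <= 2 * s) s1.
have {}hm : mag o pc (1 - (2 * s) ^+ 2) <= 2000 * s.
  apply: le_trans (hm _) _; first by rewrite mulr_ge0 // ltW.
  by rewrite mulrA -natrM.
have s20 : 0 <= s ^+ 2 by rewrite exprn_ge0 // ltW.
apply: (mag_characteristic trG degG pc0 pct th h1 s20 s2 s2' hm).
have h2 : Omega%:R * (t - pc) <= 4000^-1 * s by apply: le_trans ht Lv.
have h3 : s * (Omega%:R * (t - pc)) <= s * (4000^-1 * s) by rewrite ler_wpM2l // ltW.
have h4 := mulr_gt0 s0 s0.
have -> : Omega%:R * (2000 * s) * (t - pc) = 2000 * (s * (Omega%:R * (t - pc))) by ring.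
rewrite !expr2.
exact: characteristic_arith.
Qed.

Lemma P_ge_upper p k (r : R) : 0 <= p -> p <= 1 -> Omega%:R * (p - pc) <= Lambda / v ->
  0 < r -> r ^+ 2 = k%:R -> 4000 * (Lambda + 1) * r <= v ->
  P_ge o k p <= 4000 / r.
Proof.
move=> p0 p1 hp r0 rk hr; have p01 : 0 <= p <= 1 by rewrite p0.
have [r2|r2] := ltP r 2.
  apply: le_trans (P_ge_le1 o k p01) _; rewrite ler_pdivlMr // mul1r.
  by apply: le_trans (ltW r2) _; rewrite ler_nat.
have k0 : (0 < k)%N by rewrite -(ltr_nat R) -rk exprn_gt0.
apply: le_trans (P_ge_le_mag o p01 k0) _.
have rV : r ^- 1 = r^-1 by rewrite expr1.
have s1 : 2 * r^-1 <= 1 by rewrite ler_pdivrMr // mul1r.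
have sv : 4000 * (Lambda + 1) <= r^-1 * v by rewrite ler_pdivlMl // mulrC.
have r0' : 0 < r^-1 by rewrite invr_gt0.
have [_] := mag_window p0 hp r0' s1 sv.
rewrite -rk -exprVn => h.
have -> : 4000 / r = 2 * (2000 * r^-1) by rewrite mulrA -natrM.
by rewrite ler_wpM2l.
Qed.

(** By monotonicity it is enough to lower [p] to the point [q] where [chi] is
    [4000 * r]; there the magnetization is at most its critical value. *)
Lemma P_ge_window_lower p k (r : R) : 0 <= p -> p <= 1 ->
  Omega%:R * (pc - p) <= Lambda / v -> (0 < k)%N ->
  0 < r -> r ^+ 2 = k%:R -> 4000 * r <= (lambda^-1 + 2 * Lambda)^-1 * v ->
  (16000 * r)^-1 <= P_ge o k p.
Proof.
move=> p0 p1 hp k0 r0 rk hr.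
pose p' := Num.min p pc.
have p'0 : 0 <= p' by rewrite le_min p0 pc0.
have p'p : p' <= p by rewrite ge_min lexx.
have p'pc : p' <= pc by rewrite ge_min lexx orbT.
have p'1 : p' <= 1 := le_trans p'p p1.
have hp' : Omega%:R * (pc - p') <= Lambda / v.
  have [ppc|/ltW pcp] := leP p pc; first by rewrite /p' min_l.
  by rewrite /p' min_r // subrr mulr0 divr_ge0 // ltW.
have r1 : 1 <= r.
  rewrite -(@ler_pXn2r _ 2) ?nnegrE ?(ltW r0) // expr1n rk ler1n //.
have X1 : 1 <= 4000 * r.
  by apply: (le_trans r1); rewrite ler_peMl ?(ltW r0) // ler1n.
have p'01 : 0 <= p' <= 1 by rewrite p'0.
have [q /andP[q0 qp'] qX] := chi_ivt p'01 X1 (le_trans hr (chi_lower p'0 p'1 hp')).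
have q2 : 0 <= q <= 2^-1.
  by rewrite q0 (le_trans qp') // (le_trans p'pc) //; case/andP: pc2.
apply: le_trans (P_ge_mono o k q0 (le_trans qp' p'p) p1).
apply: P_ge_lower => //.
have rV1 : r^-1 <= 1 by rewrite invf_le1.
have rV0 : 0 <= r^-1 by rewrite invr_ge0 ltW.
have hm := mag_critical o trG degG pc0 pc1 a01 tri' rV0 rV1.
rewrite exprVn rk in hm; apply: le_trans hm.
apply: mag_mono_p => //; first exact: le_trans qp' p'pc.
  by case/andP: pc01.
have kV : (k%:R^-1 : R) <= 1 by rewrite invf_le1 ?ltr0n // ler1n.
by rewrite subr_ge0 kV lerBlDr lerDl invr_ge0 ler0n.
Qed.

(** The exponential is the growth over the window of the number of pairs of hit
    vertices, for a set of density [(4000 * (Lambda + 1) / v) ^ 2]. *)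
Definition window_chi_bound : R :=
  1 + (4 + 1000 ^+ 2 * (4000 * (Lambda + 1)) ^+ 2) * expR (2 * Lambda).

Let kappa := 4000 * (Lambda + 1).
Let kappa_ge : 4000 <= kappa.
Proof. by rewrite ler_peMr // lerDr. Qed.
Let kappa0 : 0 < kappa. Proof. exact: lt_le_trans kappa_ge. Qed.
Let exp1 : 1 <= expR (2 * Lambda).
Proof. by rewrite -[leLHS]expR0 ler_expR mulr_ge0. Qed.

Let chi_upper_small p : 0 <= p <= 1 -> v <= 2 * kappa -> chi o p <= window_chi_bound * v.
Proof.
move=> p01 vk; apply: (@le_trans _ _ V).
  rewrite -[leRHS](@percE_cst R G p); apply: percE_le => // S _.
  by rewrite ler_nat max_card.
rewrite Vv exprSr ler_wpM2r ?(ltW v0) //.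
have k2 : 0 <= kappa ^+ 2 by rewrite exprn_ge0 // ltW.
apply: (@le_trans _ _ ((2 * kappa) ^+ 2)).
  by rewrite lerXn2r // nnegrE ?(ltW v0) // mulr_ge0 // ltW.
rewrite /window_chi_bound -/kappa exprMn.
apply: (@le_trans _ _ ((4 + 1000 ^+ 2 * kappa ^+ 2) * 1)).
  rewrite mulr1; have : 2 ^+ 2 * kappa ^+ 2 <= 1000 ^+ 2 * kappa ^+ 2.
    by rewrite ler_wpM2r // lerXn2r ?nnegrE // ler_nat.
  by move=> h; apply: le_trans h _; rewrite lerDr.
apply: (@le_trans _ _ ((4 + 1000 ^+ 2 * kappa ^+ 2) * expR (2 * Lambda))); last by rewrite lerDr.
by rewrite ler_wpM2l // addr_ge0 // mulr_ge0 // exprn_ge0.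
Qed.

(* The inequality for the derivative of [chi] itself is quadratic, and its solution
   may explode within the window; that for pairs of hit vertices is linear. *)
Let chi_upper_large p : pc <= p -> Omega%:R * (p - pc) <= Lambda / v ->
  2 * kappa <= v -> chi o p <= window_chi_bound * v.
Proof.
move=> pcp hp vk; pose s := kappa / v.
have s0 : 0 < s by rewrite divr_gt0.
have s1 : 2 * s <= 1 by rewrite mulrA ler_pdivrMr // mul1r.
have sv : kappa <= s * v by rewrite /s mulfVK // lt0r_neq0.
have vs : v * s = kappa by rewrite /s mulrC mulfVK // lt0r_neq0.
pose g := 1 - s ^+ 2.
have s2 : 0 <= s ^+ 2 <= 1.
  rewrite exprn_ge0 ?(ltW s0) //= exprn_ile1 ?(ltW s0) //.
  by apply: le_trans s1; rewrite ler_peMl ?(ltW s0) // ler1n.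
have s2p : 0 < s ^+ 2 by rewrite exprn_gt0.
have g01 : 0 <= g <= 1 by rewrite /g; move: s2; lra.
pose w := 2000 / s.
have w0 : 0 < w by rewrite divr_gt0.
have w2 : 2 * w <= v.
  by rewrite /w mulrA ler_pdivrMr // vs -natrM.
have V0 : 0 < V by rewrite Vv exprn_gt0.
(* clusters that are not hit have mean size of order [w] *)
have bounds t : pc <= t <= p -> [/\ 0 <= t <= 2^-1,
    percE t (fun S => kw g (n S o)) <= w &
    percE t (fun S => (n S o)%:R ^+ 2 * g ^+ n S o) * mag o t g <= 2 * w ^+ 2].
  move=> /andP[pct tp]; have t0 : 0 <= t by apply: le_trans pct.
  have ht : Omega%:R * (t - pc) <= Lambda / v.
    by apply: le_trans hp; rewrite ler_wpM2l // lerD2r.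
  have [th mt] := mag_window t0 ht s0 s1 sv; rewrite -/g in mt.
  have t2 : 0 <= t <= 2^-1 by rewrite t0.
  have t01 := half_le1 t2.
  have M0 : 0 <= mag o t g by apply: mag_ge0.
  have h1 : s ^+ 2 * percE t (fun S => kw g (n S o)) <= mag o t g.
    by rewrite -percEZ; apply: percE_le => // S _; apply: kw_hit_le.
  have h2 : (s ^+ 2) ^+ 2 * percE t (fun S => (n S o)%:R ^+ 2 * g ^+ n S o) <= 2 * mag o t g.
    by rewrite -!percEZ; apply: percE_le => // S _; apply: kw2_hit_le.
  have ws : w * s ^+ 2 = 2000 * s.
    by rewrite /w expr2 mulrA mulfVK // lt0r_neq0.
  split=> //.
    rewrite -(ler_pM2l s2p); apply: (le_trans h1); apply: (le_trans mt).
    by rewrite [leRHS]mulrC ws.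
  have s4 : 0 < (s ^+ 2) ^+ 2 by rewrite exprn_gt0.
  rewrite -(ler_pM2l s4) mulrA.
  apply: (@le_trans _ _ (2 * mag o t g * mag o t g)); first by rewrite ler_wpM2r.
  have -> : (s ^+ 2) ^+ 2 * (2 * w ^+ 2) = 2 * (w * s ^+ 2) * (w * s ^+ 2) by ring.
  by rewrite ws -[leLHS]mulrA -[leRHS]mulrA ler_wpM2l // ler_pM.
have pp : pc <= p <= p by rewrite pcp lexx.
have [p2 kwp _] := bounds p pp; have p01 := half_le1 p2.
pose Q t := percE t (fun S : config G => hits g S ^+ 2).
have Q0 t : 0 <= t <= 1 -> 0 <= Q t.
  by move=> t01; apply: percE_ge0 => // S; apply: sqr_ge0.
have hQ : Q p + 4 * V * w <= (Q pc + 4 * V * w) * expR (4 * Omega%:R * w * (p - pc)).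
  apply: (@gronwall R Q (fun t => dpercE t (fun S : config G => hits g S ^+ 2))) => //.
  - by rewrite mulr_ge0 ?(ltW w0) // mulr_ge0 // ler0n.
  - by move=> t _; apply: is_derive_percE1.
  move=> t /andP[pct tp]; have ptp : pc <= t <= p by rewrite !ltW.
  have [t2 kwt N2t] := bounds t ptp; have t01 := half_le1 t2.
  have h := hit_pairs_derive_le o trG degG t01 g01.
  rewrite -/(Q t) in h; set d := dpercE _ _ in h *.
  have h1 : Omega%:R * (2 * percE t (fun S => kw g (n S o)) * Q t +
     4 * V * percE t (fun S => (n S o)%:R ^+ 2 * g ^+ n S o) * mag o t g)
     <= Omega%:R * (2 * w * Q t + 4 * V * (2 * w ^+ 2)).
    rewrite ler_wpM2l // lerD //; first by rewrite ler_wpM2r ?Q0 // ler_wpM2l.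
    by rewrite -[leLHS]mulrA ler_wpM2l // mulr_ge0 // ltW.
  have h2 := le_trans h h1.
  have [d0|d0] := leP d 0.
    apply: (le_trans d0); have w00 := ltW w0.
      by apply: mulr_ge0; rewrite ?addr_ge0 ?Q0 // mulr_ge0 // mulr_ge0 // ler0n.
  have h3 : 2^-1 * d <= (1 - t) * d.
    by rewrite ler_wpM2r ?(ltW d0) //; case/andP: t2; lra.
  apply: hit_pairs_arith; rewrite -expr2; exact: le_trans h3 h2.
have hexp : expR (4 * Omega%:R * w * (p - pc)) <= expR (2 * Lambda).
  rewrite ler_expR; have -> : 4 * Omega%:R * w * (p - pc) = (4 * w) * (Omega%:R * (p - pc)) by ring.
  apply: (@le_trans _ _ ((2 * v) * (Lambda / v))); last first.
    by rewrite mulrA -[2 * v * _]mulrA [v * _]mulrC mulrA mulfK // lt0r_neq0.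
  apply: ler_pM => //; first by rewrite mulr_ge0 // ltW.
    by rewrite mulr_ge0 // subr_ge0.
  have -> : 4 * w = 2 * (2 * w) by ring.
  by rewrite ler_wpM2l.
have hQc : Q pc <= V * (2 * v) + V * (1000 ^+ 2 * kappa ^+ 2 * v).
  apply: le_trans (hit_pairs_le_chi o trG pc01 g01) _; rewrite lerD //.
    by rewrite ler_wpM2l ?(ltW V0) // chi_critical_le.
  have s1' : s <= 1 by apply: le_trans s1; rewrite ler_peMl ?(ltW s0) // ler1n.
  have hm := mag_critical o trG degG pc0 pc1 a01 tri' (ltW s0) s1'.
  rewrite -/g in hm.
  have -> : V * (1000 ^+ 2 * kappa ^+ 2 * v) = (V * (1000 * s)) ^+ 2.
    by rewrite -vs Vv; ring.
  have V00 := ltW V0.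
  have m0 : 0 <= V * mag o pc g by rewrite mulr_ge0 // mag_ge0.
  have b0 : V * mag o pc g <= V * (1000 * s) by rewrite ler_wpM2l.
  by rewrite lerXn2r // nnegrE // (le_trans m0).
have := chi_le_hit_pairs o trG p01 g01; rewrite -/(Q p) => hX.
rewrite -(ler_pM2l V0); apply: (le_trans hX).
have e0 : 0 <= expR (2 * Lambda) by apply: le_trans exp1.
have Vw : 4 * V * w <= V * (2 * v).
  have -> : 4 * V * w = V * (2 * (2 * w)) by ring.
  by rewrite ler_wpM2l ?(ltW V0) // ler_wpM2l.
have hQp : Q p <= V * ((4 + 1000 ^+ 2 * kappa ^+ 2) * expR (2 * Lambda) * v).
  have h0 : 0 <= 4 * V * w by rewrite mulr_ge0 ?(ltW w0) // mulr_ge0.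
  apply: (@le_trans _ _ (Q p + 4 * V * w)); first by rewrite lerDl.
  apply: (le_trans hQ).
  apply: (@le_trans _ _ ((Q pc + 4 * V * w) * expR (2 * Lambda))).
    have q0 : 0 <= Q pc + 4 * V * w by rewrite addr_ge0 // Q0.
    by rewrite ler_wpM2l.
  have -> : V * ((4 + 1000 ^+ 2 * kappa ^+ 2) * expR (2 * Lambda) * v)
    = (V * (2 * v) + V * (1000 ^+ 2 * kappa ^+ 2 * v) + V * (2 * v)) * expR (2 * Lambda) by ring.
  by rewrite ler_wpM2r // lerD.
have hk : V * (2 * percE p (fun S => kw g (n S o))) <= V * v.
  rewrite ler_wpM2l ?(ltW V0) //; apply: le_trans w2.
  by rewrite ler_wpM2l.
have -> : V * (window_chi_bound * v) =
  V * v + V * ((4 + 1000 ^+ 2 * kappa ^+ 2) * expR (2 * Lambda) * v).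
  by rewrite /window_chi_bound -/kappa; ring.
exact: lerD.
Qed.

Lemma chi_upper p : 0 <= p -> p <= 1 -> Omega%:R * (p - pc) <= Lambda / v ->
  chi o p <= window_chi_bound * v.
Proof.
move=> p0 p1 hp; have p01 : 0 <= p <= 1 by rewrite p0.
have [vk|vk] := leP v (2 * kappa); first exact: chi_upper_small.
have [ppc|/ltW pcp] := leP p pc; last by apply: chi_upper_large => //; apply: ltW.
have pcp : pc <= pc by [].
apply: le_trans (_ : chi o pc <= _); first by apply: chi_mono => //; case/andP: pc01.
apply: chi_upper_large => //; last exact: ltW.
by rewrite subrr mulr0 divr_ge0 // ltW.
Qed.

Lemma window_chi_bound_ge1 : 1 <= window_chi_bound.
Proof.
rewrite /window_chi_bound lerDl mulr_ge0 ?expR_ge0 // addr_ge0 //.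
by rewrite mulr_ge0 ?exprn_ge0 // ltW.
Qed.

End Window.

(** * The largest cluster *)

Section LargestCluster.
Variables (R : realType) (G : sgraph) (o : G) (p v b1 b2 B : R).
Hypothesis trG : vertex_transitive G.
Hypothesis p01 : 0 <= p <= 1.
Hypothesis v0 : 0 < v.
Hypothesis Vv : #|G|%:R = v ^+ 3.
Hypothesis b10 : 0 < b1.
Hypothesis b20 : 0 < b2.
Hypothesis B1 : 1 <= B.
Hypothesis chi_le : chi o p <= B * v.
Hypothesis tail : forall k : nat, (1 <= k)%N -> k%:R <= b1 * v ^+ 2 ->
  b2 / Num.sqrt k%:R <= P_ge o k p.

Local Notation maxc S := ((max_cluster_size S)%:R : R).

Let B0 : 0 < B. Proof. exact: lt_le_trans B1. Qed.
Let v20 : 0 < v ^+ 2. Proof. exact: exprn_gt0. Qed.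

Lemma max_cluster_ge1 (S : config G) : 1 <= maxc S.
Proof. by rewrite ler1n (leq_trans (card_cluster_gt0 S o)) //; apply: (leq_bigmax o). Qed.

Let moment : percE p (fun S : config G => maxc S ^+ 2) <= B * v ^+ 2 * v ^+ 2.
Proof.
apply: le_trans (max_cluster_moment o trG p01) _; rewrite Vv.
have -> : B * v ^+ 2 * v ^+ 2 = v ^+ 3 * (B * v) by ring.
by rewrite ler_wpM2l // exprn_ge0 // ltW.
Qed.

Lemma mean_max_cluster_le :
  percE p (fun S : config G => maxc S) <= (1 + B) / 2 * v ^+ 2.
Proof.
apply: (@le_trans _ _ (percE p (fun S : config G =>
    (2 * v ^+ 2)^-1 * (maxc S ^+ 2 + v ^+ 2 * v ^+ 2)))).
  apply: percE_le => // S _; rewrite ler_pdivlMl ?mulr_gt0 //.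
  rewrite -subr_ge0; have -> : maxc S ^+ 2 + v ^+ 2 * v ^+ 2 - 2 * v ^+ 2 * maxc S =
    (maxc S - v ^+ 2) ^+ 2 by ring.
  exact: sqr_ge0.
rewrite percEZ percED percE_cst ler_pdivrMl ?mulr_gt0 //.
have -> : 2 * v ^+ 2 * ((1 + B) / 2 * v ^+ 2) = B * v ^+ 2 * v ^+ 2 + v ^+ 2 * v ^+ 2.
  by field.
by rewrite lerD2r.
Qed.

Lemma max_cluster_upper_tail omega : 1 <= omega ->
  percE p (fun S : config G => (omega * v ^+ 2 < maxc S)%R%:R) <= B / omega.
Proof.
move=> w1; have w0 : 0 < omega by apply: lt_le_trans w1.
have wv : 0 < omega * v ^+ 2 by rewrite mulr_gt0.
have h : (omega * v ^+ 2) ^+ 2 * percE p (fun S : config G => (omega * v ^+ 2 < maxc S)%R%:R)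
    <= B * v ^+ 2 * v ^+ 2.
  apply: le_trans moment; rewrite -percEZ; apply: percE_le => // S _.
  case: ltP => [h|_]; last by rewrite mulr0 sqr_ge0.
  by rewrite mulr1 lerXn2r ?nnegrE ?(ltW wv) ?ler0n ?(ltW h).
have q0 : 0 < (omega * v ^+ 2) ^+ 2 by rewrite exprn_gt0.
rewrite -(ler_pM2l q0); apply: (le_trans h).
have -> : (omega * v ^+ 2) ^+ 2 * (B / omega) = omega * (B * v ^+ 2 * v ^+ 2).
  by move: (lt0r_neq0 w0) => wn; field.
by rewrite ler_peMl // !mulr_ge0 // ltW.
Qed.

(** The second-moment bound is applied at the least integer [k] above
    [v ^+ 2 / omega], where the one-point tail is still of order [k ^ (-1/2)]. *)
Lemma max_cluster_lower_tail omega : 1 <= omega -> 2 / b1 <= omega ->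
  percE p (fun S : config G => (maxc S < omega^-1 * v ^+ 2)%R%:R) <= 2 * B / b2 ^+ 2 / omega.
Proof.
move=> w1 wb; have w0 : 0 < omega by apply: lt_le_trans w1.
set s := omega^-1 * v ^+ 2; have s0 : 0 < s by rewrite mulr_gt0 // invr_gt0.
have rhs0 : 0 <= 2 * B / b2 ^+ 2 / omega.
  by rewrite !mulr_ge0 ?invr_ge0 ?exprn_ge0 // ltW.
have [s1|s1] := leP s 1.
  rewrite (_ : percE _ _ = 0) // /percE big1 // => S _.
  by rewrite ltNge (le_trans s1) ?mulr0 // max_cluster_ge1.
pose k := (Num.trunc s).+1.
have sk : s < k%:R by rewrite -truncn_lt_nat ?(ltW s0).
have ks : k%:R <= 2 * s.
  have : (Num.trunc s)%:R <= s by rewrite truncn_le ltW.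
  rewrite /k -addn1 natrD; lra.
have kR : 0 < k%:R :> R by rewrite ltr0n.
have kb : k%:R <= b1 * v ^+ 2.
  apply: (le_trans ks); rewrite /s mulrA ler_wpM2r ?(ltW v20) //.
  by rewrite ler_pdivrMr // mulrC -ler_pdivrMr.
have P1 := tail (ltn0Sn _) kb; rewrite -/k in P1.
have sk0 : 0 < Num.sqrt k%:R :> R by rewrite sqrtr_gt0.
have bk0 : 0 < b2 / Num.sqrt k%:R by rewrite divr_gt0.
have P0 : 0 < P_ge o k p by apply: lt_le_trans P1.
apply: (@le_trans _ _ (percE p (fun S : config G => (max_cluster_size S < k)%N%:R))).
  apply: percE_le => // S _; case: ltP => // h.
  by rewrite (_ : (_ < k)%N) // -(ltr_nat R) (lt_trans h).
apply: le_trans (small_max_cluster trG p01 P0) _.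
have P2 : b2 ^+ 2 / k%:R <= P_ge o k p ^+ 2.
  rewrite -(sqr_sqrtr (ltW kR)) -expr_div_n lerXn2r // nnegrE ltW //.
have V0 : 0 < #|G|%:R :> R by rewrite Vv exprn_gt0.
rewrite ler_pdivrMr ?mulr_gt0 ?exprn_gt0 //; apply: (le_trans chi_le).
apply: (@le_trans _ _ (2 * B / b2 ^+ 2 / omega * (#|G|%:R * (b2 ^+ 2 / k%:R)))); last first.
  by rewrite ler_wpM2l // ler_wpM2l // ltW.
have -> : 2 * B / b2 ^+ 2 / omega * (#|G|%:R * (b2 ^+ 2 / k%:R)) = B * v * (2 * s / k%:R).
  rewrite Vv /s; move: (lt0r_neq0 w0) (lt0r_neq0 b20) (lt0r_neq0 kR) => wn bn kn.
  by field; rewrite wn bn kn.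
by rewrite ler_peMr ?mulr_ge0 ?(ltW v0) ?(ltW B0) // ler_pdivlMr // mul1r.
Qed.

Let b6 := 2 / b1 + B + 2 * B / b2 ^+ 2.

Lemma max_cluster_tight omega : 1 <= omega ->
  1 - b6 / omega <= percP p (fun S : config G =>
    omega^-1 * v ^+ 2 <= maxc S <= omega * v ^+ 2).
Proof.
move=> w1; have w0 : 0 < omega by apply: lt_le_trans w1.
have t1 : 0 <= 2 / b1 by rewrite divr_ge0 // ltW.
have t2 : 0 <= 2 * B / b2 ^+ 2 by rewrite !mulr_ge0 ?invr_ge0 ?exprn_ge0 // ltW.
rewrite percPE; have [wb|wb] := leP (2 / b1) omega; last first.
  apply: (@le_trans _ _ 0); last exact: percE_ge0.
  rewrite subr_le0 ler_pdivlMr // mul1r (le_trans (ltW wb)) // /b6 -addrA lerDl.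
  by rewrite addr_ge0 // ltW.
apply: (@le_trans _ _ (1 - percE p (fun S : config G => (maxc S < omega^-1 * v ^+ 2)%R%:R)
   - percE p (fun S : config G => (omega * v ^+ 2 < maxc S)%R%:R))).
  have := max_cluster_upper_tail w1; have := max_cluster_lower_tail w1 wb.
  have : 0 <= 2 / b1 / omega by rewrite divr_ge0 // ltW.
  rewrite /b6 2!mulrDl; lra.
rewrite -{1}(@percE_cst R G p 1) -!percEB; apply: percE_le => // S _.
by do 2!case: leP => _; rewrite ?subr0 ?subrr ?sub0r ?lerN10.
Qed.

(** At [omega = 2 * b6] the window of [max_cluster_tight] has probability at
    least one half. *)
Lemma mean_max_cluster_ge :
  (4 * b6)^-1 * v ^+ 2 <= percE p (fun S : config G => maxc S).
Proof.
have t1 : 0 <= 2 / b1 by rewrite divr_ge0 // ltW.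
have t2 : 0 <= 2 * B / b2 ^+ 2 by rewrite !mulr_ge0 ?invr_ge0 ?exprn_ge0 // ltW.
have b61 : 1 <= b6 by rewrite /b6; move: B1; lra.
have b60 : 0 < b6 by apply: lt_le_trans b61.
have w1 : 1 <= 2 * b6 by lra.
have := max_cluster_tight w1; rewrite percPE.
have -> : 1 - b6 / (2 * b6) = 2^-1 by move: (lt0r_neq0 b60) => bn; field.
set P := percE _ _ => hP.
have -> : (4 * b6)^-1 * v ^+ 2 = (2 * b6)^-1 * v ^+ 2 * 2^-1.
  by move: (lt0r_neq0 b60) => bn; field.
have s0 : 0 <= (2 * b6)^-1 * v ^+ 2 by rewrite mulr_ge0 ?invr_ge0 ?mulr_ge0 // ltW.
apply: (@le_trans _ _ ((2 * b6)^-1 * v ^+ 2 * P)); first by rewrite ler_wpM2l.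
rewrite /P -percEZ; apply: percE_le => // S _.
by case: andP => [[h _]|_]; rewrite ?mulr1 ?mulr0.
Qed.

End LargestCluster.

(** * Scaling at criticality *)

Lemma connected_neighbour (G : sgraph) (o : G) : graph_connected G -> (1 < #|G|)%N ->
  exists y, adj o y.
Proof.
move=> conG; rewrite (cardD1 o) inE add1n ltnS => /card_gt0P[z].
rewrite !inE andbT => zo; have /connectP[[|y s] /=] := conG o z.
  by move=> _ e; rewrite e eqxx in zo.
by case/andP=> oy _ _; exists y.
Qed.

Lemma cube_root (R : realType) (x v : R) : 0 < x -> v = x `^ (1 / 3) ->
  [/\ 0 < v, x = v ^+ 3, x `^ (2 / 3) = v ^+ 2 & x `^ (- (1 / 3)) = v^-1].
Proof.
move=> x0 ->; have v0 := powR_gt0 (1 / 3) x0; split=> //.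
- rewrite -powR_mulrn ?(ltW v0) // -powRrM mul1r mulVf ?powRr1 ?(ltW x0) ?pnatr_eq0 //.
- by rewrite -powR_mulrn ?(ltW v0) // -powRrM mul1r mulrC.
- by rewrite powRN.
Qed.

Theorem theorem1p3 (R : realType) :
  exists2 b0 : R, 0 < b0 &
  exists b2 b3 : R, [/\ 0 < b2, 0 < b3 &
  forall Lambda : R, 0 <= Lambda ->
  exists b5 b8 : R, [/\ 0 < b5, 0 < b8 &
  forall lambda : R, 0 < lambda ->
  exists b1 b4 b6 b7 : R, [/\ 0 < b1, 0 < b4, 0 < b6, 0 < b7 &
  forall (G : sgraph) (o : G) (Omega : nat) (pc a0 : R),
    graph_connected G ->
    vertex_transitive G ->
    (forall x : G, degree x = Omega) ->
    1 < lambda * #|G|%:R `^ (1 / 3) < #|G|%:R ->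
    critical_threshold o lambda pc ->
    a0 <= b0 ->
    triangle_condition G pc a0 ->
    b0^-1 <= lambda * #|G|%:R `^ (1 / 3) ->
  forall p eps : R,
    p = pc + Omega%:R^-1 * eps ->
    0 <= p <= 1 ->
    `|eps| <= Lambda * #|G|%:R `^ (- (1 / 3)) ->
  [/\ (* (i) *)
      forall k : nat, (1 <= k)%N -> k%:R <= b1 * #|G|%:R `^ (2 / 3) ->
        b2 / Num.sqrt k%:R <= P_ge o k p <= b3 / Num.sqrt k%:R,
      (* (ii) *)
      b4 * #|G|%:R `^ (2 / 3)
        <= percE p (fun S : config G => (max_cluster_size S)%:R)
        <= b5 * #|G|%:R `^ (2 / 3),
      forall omega : R, 1 <= omega ->
        1 - b6 / omega <=
        percP p (fun S : config G =>
          omega^-1 * #|G|%:R `^ (2 / 3) <= (max_cluster_size S)%:R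
            <= omega * #|G|%:R `^ (2 / 3))
    & (* (iii) *)
      b7 * #|G|%:R `^ (1 / 3) <= chi o p <= b8 * #|G|%:R `^ (1 / 3)]]]].
Proof.
exists 1000^-1; first by rewrite invr_gt0.
exists 16000^-1, 4000; split; [by rewrite invr_gt0 | by [] |].
move=> Lambda L0; pose b8 := window_chi_bound Lambda.
have b81 : 1 <= b8 by apply: window_chi_bound_ge1.
have b80 : 0 < b8 by apply: lt_le_trans b81.
exists ((1 + b8) / 2), b8; split=> //; first by rewrite divr_gt0 // addr_gt0.
move=> lambda l0; pose b7 := (lambda^-1 + 2 * Lambda)^-1.
have b70 : 0 < b7 by rewrite invr_gt0 ltr_wpDr ?invr_gt0 // mulr_ge0.
have k0 : 0 < 4000 * (Lambda + 1) by rewrite mulr_gt0 // ltr_wpDl.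
(* [sqrt k <= c1 * v] is what both tail estimates ask of [k] *)
pose c1 := Num.min (4000 * (Lambda + 1))^-1 (b7 / 4000).
have c10 : 0 < c1 by rewrite lt_min invr_gt0 k0 divr_gt0.
pose b2 : R := 16000^-1.
have b20 : 0 < b2 by rewrite invr_gt0.
have b10 : 0 < c1 ^+ 2 by rewrite exprn_gt0.
pose b6 := 2 / c1 ^+ 2 + b8 + 2 * b8 / b2 ^+ 2.
have b60 : 0 < b6.
  have t1 : 0 < 2 / c1 ^+ 2 by rewrite divr_gt0.
  have t2 : 0 < 2 * b8 / b2 ^+ 2 by rewrite !mulr_gt0 ?invr_gt0 ?exprn_gt0.
  by rewrite addr_gt0 // addr_gt0.
exists (c1 ^+ 2), (4 * b6)^-1, b6, b7; split=> //; first by rewrite invr_gt0 mulr_gt0.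
move=> G o Omega pc a0 conG trG degG vlam [pc01 chi_pc] a0b tri _ p eps pE p01 heps.
have V1 : 1 < #|G|%:R :> R by case/andP: vlam => h /(lt_trans h).
have V0 : 0 < #|G|%:R :> R by apply: lt_trans V1.
set v := #|G|%:R `^ (1 / 3) in chi_pc *.
have [v0 Vv V2 VN] := cube_root V0 (erefl v); rewrite V2.
rewrite VN in heps.
have [y oy] : exists y, adj o y by apply: connected_neighbour; rewrite // -(ltr_nat R).
have oney : o != y by apply/eqP => e; rewrite e adj_irrefl in oy.
have O0 : (0 < Omega)%N by rewrite -(degG o) /degree; apply/card_gt0P; exists y; rewrite inE.
have [pc0 pcle1] := andP pc01; have [p0 p1] := andP p01.
have a01 : a0 <= 1000^-1 by [].
(* an occupied bond connects its ends, so the triangle condition makes [pc] small *)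
have pc1 : pc <= 1000^-1.
  apply: le_trans (tau_adj_ge pc01 oy) _.
  apply: le_trans (tau_le_triangle o y pc01) _.
  by have := tri o y; rewrite (negbTE oney) add0r => /le_trans; apply.
have OR : Omega%:R != 0 :> R by rewrite pnatr_eq0 -lt0n.
have hp : Omega%:R * (p - pc) = eps by rewrite pE addrAC subrr add0r mulrA mulfV // mul1r.
have up : Omega%:R * (p - pc) <= Lambda / v by rewrite hp (le_trans _ heps) // ler_norm.
have down : Omega%:R * (pc - p) <= Lambda / v.
  by rewrite -opprB mulrN hp (le_trans _ heps) // ler_normr lexx orbT.
have Xup : chi o p <= b8 * v.
  exact: (chi_upper o trG degG O0 pc0 pc1 a01 tri L0 v0 Vv p0 p1 up).
have Xlow : b7 * v <= chi o p.
  exact: (chi_lower trG degG pc0 pc1 l0 L0 v0 chi_pc p0 p1 down).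
have tails k : (1 <= k)%N -> k%:R <= c1 ^+ 2 * v ^+ 2 ->
    b2 / Num.sqrt k%:R <= P_ge o k p <= 4000 / Num.sqrt k%:R.
  move=> k1 kb; have kR : 0 < k%:R :> R by rewrite ltr0n.
  set r := Num.sqrt k%:R; have r0 : 0 < r by rewrite sqrtr_gt0.
  have rk : r ^+ 2 = k%:R by rewrite sqr_sqrtr // ltW.
  have rv : r <= c1 * v.
    by rewrite -(@ler_pXn2r _ 2) ?nnegrE ?(ltW r0) // ?rk ?exprMn // mulr_ge0 // ltW.
  apply/andP; split.
    rewrite /b2 -invfM.
    apply: (P_ge_window_lower trG degG pc0 pc1 a01 tri l0 L0 v0 chi_pc p0 p1 down k1 r0 rk).
    rewrite -ler_pdivlMl // (le_trans rv) // mulrA ler_wpM2r ?(ltW v0) //.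
    by rewrite ge_min [X in _ || (_ <= X)]mulrC lexx orbT.
  apply: (P_ge_upper o trG degG O0 pc0 pc1 a01 tri v0 p0 p1 up r0 rk).
  rewrite -ler_pdivlMl // (le_trans rv) // ler_wpM2r ?(ltW v0) //.
  by rewrite ge_min lexx.
have tail k : (1 <= k)%N -> k%:R <= c1 ^+ 2 * v ^+ 2 -> b2 / Num.sqrt k%:R <= P_ge o k p.
  by move=> k1 /(tails k k1)/andP[].
split=> //; last by rewrite Xlow.
- apply/andP; split; first exact: (mean_max_cluster_ge trG p01 v0 Vv b10 b20 b81 Xup tail).
  exact: (mean_max_cluster_le trG p01 v0 Vv Xup).
- by move=> omega; apply: (max_cluster_tight trG p01 v0 Vv b10 b20 b81 Xup tail).
Qed.
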